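(* The tropical Cayley-Markov action of a hyperbolic element $A\in SL_2(\mathbb Z)$ on the surface $T$ is ergodic (with respect to the Lebesgue area measure on $T$), with the Lyapunov exponent and the entropy both given by $\ln\rho(A)$, the logarithm of the spectral radius $\rho(A)$ of $A$. Moreover, the average growth of the Lyapunov exponent and of the entropy along the path $\gamma_\xi$ on the planar binary tree is given by the function $\Lambda(\xi)$: if $A_n(\xi)$ is the matrix attached to the $n$-th edge of $\gamma_\xi$, and $\lambda(A_n(\xi))$, $h(A_n(\xi))$ are the Lyapunov exponent and the entropy of its tropical Cayley-Markov action on $T$, then $$\limsup_{n\to\infty}\frac{\lambda(A_n(\xi))}{n}=\limsup_{n\to\infty}\frac{h(A_n(\xi))}{n}=\Lambda(\xi).$$
   Context: **The surface $T$.** $T\subset\mathbb R^3$ is the set of $(u,v,w)$ with $\max\{-u-v-w,\,-u+v+w,\,u-v+w,\,u+v-w\}=2$, i.e. the surface of the regular tetrahedron with vertices $(2,2,2),(2,-2,-2),(-2,2,-2),(-2,-2,2)$. **The action.** Let $f:\mathbb R^2\to\mathbb R$ be the piecewise linear function given by $f(u,v)=v$ if $u\ge|v|$, $f(u,v)=u$ if $v\ge|u|$, $f(u,v)=-v$ if $-u\ge|v|$, $f(u,v)=-u$ if $-v\ge|u|$. The tropical Vieta involution is $$(u,v,w)\mapsto(u,v,-w+2f(u,v)).$$ The tropical Cayley-Markov action is the action of the modular group $PSL_2(\mathbb Z)\cong\mathbb Z_2*\mathbb Z_3$ generated by the cyclic permutation of $u,v,w$ and the tropical Vieta involution: the factor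 $\mathbb Z_2$ acts by the tropical Vieta involution and the factor $\mathbb Z_3$ by cyclic permutations of the coordinates. No explicit matrices are specified for the generators. This action preserves $T$ and the usual Lebesgue (area) measure on $T$. An element $A\in SL_2(\mathbb Z)$ acts through its class in $PSL_2(\mathbb Z)$. **Hyperbolicity, spectral radius, exponents.** $A\in SL_2(\mathbb Z)$ is hyperbolic if $|\operatorname{tr}A|>2$. The spectral radius $\rho(A)$ is the maximum of the moduli of the eigenvalues of $A$. For a piecewise linear map $g$ of $T$ preserving Lebesgue measure, the Lyapunov exponent is the almost everywhere value of $\lim_{n\to\infty}\frac1n\ln\|D_xg^n\|$, and the entropy is the Kolmogorov-Sinai entropy with respect to the normalised Lebesgue measure. **Paths and $\Lambda$.** $SL_2(\mathbb N)$ is the monoid of matrices in $SL_2(\mathbb Z)$ with non-negative entries. On the Farey tree (a planar binary tree), neighbouring fractions $\frac pr>\frac qs$ with $ps-qr=1$ have Farey mediant $\frac{p+q}{r+s}$ and are combined into the matrix $\begin{pmatrix}p&q\\ r&s\end{pmatrix}\in SL_2(\mathbb N)$, attached to the edge separating them. Infinite paths $\gamma_\xi$ on the tree correspond to $\xi\in[0,\infty]$: start with $A_0(\xi)=\begin{pmatrix}1&0\\0&1\end{pmatrix}$ (fractions $\frac10=\infty$ and $\frac01=0$). Given $A_n(\xi)=\begin{pmatrix}p&q\\ r&s\end{pmatrix}$ with $\xi\in[\frac qs,\frac pr]$, put $A_{n+1}(\xi)=\begin{pmatrix}p&p+q\\ r&r+s\end{pmatrix}$ if $\xi\in[\frac{p+q}{r+s},\frac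 pr]$ and $A_{n+1}(\xi)=\begin{pmatrix}p+q&q\\ r+s&s\end{pmatrix}$ if $\xi\in[\frac qs,\frac{p+q}{r+s}]$ (either choice if $\xi$ is the mediant). The function $\Lambda$ is $$\Lambda(\xi)=\limsup_{n\to\infty}\frac{\ln\rho(A_n(\xi))}{n}.$$
   Formalization: The factor Z_2 acts by the tropical Vieta involution followed by the transposition of u and v; with the bare involution (orientation-reversing) the hyperbolic commutator of the generators, of trace 3, would preserve the coordinate u and so not be ergodic. *)

(* Defs.v *)
From HB Require Import structures.
From mathcomp Require Import all_boot all_order all_algebra.
From mathcomp Require Import all_classical all_reals all_analysis.
From mathcomp Require Import complex.

Set Implicit Arguments.
Unset Strict Implicit.
Unset Printing Implicit Defensive.

Import Order.TTheory GRing.Theory Num.Theory.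
Import numFieldNormedType.Exports.

Local Open Scope classical_set_scope.
Local Open Scope ring_scope.

Section Surface.
Variable R : realType.

Definition surfaceT : set (R * R * R) :=
  [set x | let: (u, v, w) := x in
     Num.max (Num.max (- u - v - w) (- u + v + w))
             (Num.max (u - v + w) (u + v - w)) = 2].

Definition vtx (i : 'I_4) : R * R * R :=
  nth (0, 0, 0) [:: (2, 2, 2); (2, -2, -2); (-2, 2, -2); (-2, -2, 2)] i.

Definition cross (a b : R * R * R) : R * R * R :=
  (a.1.2 * b.2 - a.2 * b.1.2, a.2 * b.1.1 - a.1.1 * b.2,
   a.1.1 * b.1.2 - a.1.2 * b.1.1).

Definition enorm (a : R * R * R) : R :=
  Num.sqrt (a.1.1 ^+ 2 + a.1.2 ^+ 2 + a.2 ^+ 2).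

Definition edge (i : 'I_4) (j : 'I_3) : R * R * R :=
  vtx (lift i j) - vtx (lift i ord0).

(* Affine parametrization, over the standard triangle, of the face of the
   tetrahedron opposite to the vertex i. *)
Definition face_param (i : 'I_4) (p : R * R) : R * R * R :=
  vtx (lift i ord0) + p.1 *: edge i (inord 1) + p.2 *: edge i (inord 2).

Definition std_triangle : set (R * R) :=
  [set p | [/\ 0 <= p.1, 0 <= p.2 & p.1 + p.2 <= 1]].

(* The surface integral of the indicator of A: on a face parametrized by phi,
   the area element is |d_s phi x d_t phi| ds dt, which is constant because phi
   is affine, and faces overlap only along edges. It is a measure on R^3 carried
   by surfaceT. *)
Definition area (A : set (R * R * R)) : \bar R :=
  (\sum_(i < 4)
     (enorm (cross (edge i (inord 1)) (edge i (inord 2))))%:E *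
     (lebesgue_measure \x lebesgue_measure)
       (std_triangle `&` face_param i @^-1` A))%E.

Definition normalized_area (A : set (R * R * R)) : \bar R :=
  (area A * ((fine (area surfaceT))^-1)%:E)%E.

End Surface.

Section Dynamics.
Context d (X : measurableType d) (R : realType).
Implicit Types (mu : set X -> \bar R) (g : X -> X).

Definition measure_preserving mu g : Prop :=
  measurable_fun [set: X] g /\
  forall A, measurable A -> mu (g @^-1` A) = mu A.

Definition ergodic mu g : Prop :=
  measure_preserving mu g /\
  forall A, measurable A -> g @^-1` A = A -> mu A = 0%E \/ mu (~` A) = 0%E.

(* A finite measurable partition is given by its labelling p : X -> 'I_k. *)
Definition measurable_labelling k (p : X -> 'I_k) : Prop :=
  forall j, measurable (p @^-1` [set j]).

Definition cylinder g k (p : X -> 'I_k) n (w : {ffun 'I_n -> 'I_k}) : set X :=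
  [set x | forall i : 'I_n, p (iter i g x) = w i].

(* Shannon entropy of the join of the partitions g^{-i} p, i < n; the atoms of
   measure 0 contribute 0. *)
Definition join_entropy mu g k (p : X -> 'I_k) (n : nat) : R :=
  \sum_(w : {ffun 'I_n -> 'I_k})
    (let m := fine (mu (cylinder g p w)) in - (m * ln m)).

Definition partition_entropy mu g k (p : X -> 'I_k) : R :=
  limn (fun n => join_entropy mu g p n / n%:R).

Definition ks_entropy mu g : \bar R :=
  ereal_sup [set h | exists k, exists2 p : X -> 'I_k,
    measurable_labelling p & h = (partition_entropy mu g p)%:E].

End Dynamics.

Section Lyapunov.
Variable R : realType.
Implicit Types (g : R * R * R -> R * R * R) (x v : R * R * R).

(* Away from the edges of the tetrahedron, this is the tangent plane. *)
Definition tangent x v : Prop := \forall t \near (0 : R), surfaceT (x + t *: v).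

(* Operator norm of D_x g restricted to the tangent space of the surface. *)
Definition tangent_norm g x : R :=
  sup [set r | exists2 v, tangent x v /\ `|v| <= 1 & r = `|'D_v g x|].

Definition lyapunov_exponent g (l : R) : Prop :=
  {ae @area R, forall x,
     (forall n v, tangent x v -> derivable (iter n g) x v) /\
     (fun n => ln (tangent_norm (iter n g) x) / n%:R) @ \oo --> l}.

End Lyapunov.

Section Action.
Variable R : realType.

Definition fpl (u v : R) : R :=
  if `|v| <= u then v
  else if `|u| <= v then u
  else if `|v| <= - u then - v
  else - u.

Definition vieta (x : R * R * R) : R * R * R :=
  let: (u, v, w) := x in (u, v, - w + 2 * fpl u v).

Definition cyc (x : R * R * R) : R * R * R :=
  let: (u, v, w) := x in (v, w, u).

Definition swap12 (x : R * R * R) : R * R * R :=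
  let: (u, v, w) := x in (v, u, w).

Definition mx2 (a b c e : int) : 'M[int]_2 :=
  \matrix_(i, j) (if i == 0 then (if j == 0 then a else b)
                  else (if j == 0 then c else e)).

Definition genS : 'M[int]_2 := mx2 0 1 (-1) 0.
Definition genU : 'M[int]_2 := mx2 0 1 (-1) (-1).

(* genS and genU have orders 2 and 3 in PSL_2(Z) = Z_2 * Z_3, and as
   Aut(PSL_2(Z)) = PGL_2(Z) every other pair of free-product generators is, up
   to signs, conjugate to this one by some P in GL_2(Z). The order-two generator
   acts as the Vieta involution followed by the transposition of u and v. The
   transposition cannot be dropped: the Vieta involution alone reverses the
   orientation of the surface (it acts as diag(1, -1) in PGL_2(Z)), and with it
   as image of genS the commutator of genS and genU, of trace 3, would act as
   vieta \o cyc \o vieta \o cyc^-1, which fixes the coordinate u and so is not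
   ergodic. *)
Record cayley_markov_action (P : 'M[int]_2)
    (act : 'M[int]_2 -> R * R * R -> R * R * R) : Prop := {
  act_one : act 1%:M = id ;
  act_mul : forall A B, \det A = 1 -> \det B = 1 ->
    act (A *m B) = act A \o act B ;
  act_order2 : act (P *m genS *m invmx P) = swap12 \o vieta ;
  act_order3 : act (P *m genU *m invmx P) = cyc }.

End Action.

Definition hyperbolic (A : 'M[int]_2) : Prop := 2 < `|\tr A|.

Definition spectral_radius (R : realType) (A : 'M[int]_2) : R :=
  sup [set r | exists2 z : R[i],
    eigenvalue (map_mx (fun k : int => k%:~R : R[i]) A) z
    & r = Normc.normc z].

Section Farey.
Variable R : realType.

(* p / r for p, r >= 0 not both zero, with 1 / 0 = +oo. *)
Definition frac (p r : int) : \bar R :=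
  if r == 0 then +oo%E else (p%:~R / r%:~R)%:E.

Definition mediant (A : 'M[int]_2) : \bar R :=
  frac (A 0 0 + A 0 1) (A 1 0 + A 1 1).

Definition upper_end (A : 'M[int]_2) : \bar R := frac (A 0 0) (A 1 0).

Definition lower_end (A : 'M[int]_2) : \bar R := frac (A 0 1) (A 1 1).

Definition step_up (A : 'M[int]_2) : 'M[int]_2 :=
  mx2 (A 0 0) (A 0 0 + A 0 1) (A 1 0) (A 1 0 + A 1 1).

Definition step_down (A : 'M[int]_2) : 'M[int]_2 :=
  mx2 (A 0 0 + A 0 1) (A 0 1) (A 1 0 + A 1 1) (A 1 1).

(* Both steps are allowed when xi is the mediant. *)
Definition farey_path (xi : \bar R) (A : nat -> 'M[int]_2) : Prop :=
  A 0%N = 1%:M /\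
  forall n,
    ((mediant (A n) <= xi <= upper_end (A n))%E /\
       A n.+1 = step_up (A n)) \/
    ((lower_end (A n) <= xi <= mediant (A n))%E /\
       A n.+1 = step_down (A n)).

(* The path that steps up when xi is the mediant. *)
Fixpoint std_path (xi : \bar R) (n : nat) : 'M[int]_2 :=
  if n is m.+1 then
    let B := std_path xi m in
    if (mediant B <= xi)%E then step_up B else step_down B
  else 1%:M.

Definition Lambda (xi : \bar R) : \bar R :=
  limn_esup (fun n => (ln (spectral_radius R (std_path xi n)) / n%:R)%:E).

End Farey.

(* Main.v *)
(** The surface is the quotient of the torus by -1, by a map under which area is
    a multiple of Lebesgue measure and the action of A is covered by a linear
    map M of the same trace as A. Let l be the eigenvalue of M with |l| >= 1; it
    satisfies |l| = rho(A).

    Ergodicity is the Hopf argument: membership in an invariant set is, up to a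
    null set, unchanged by translation along both eigenlines of M, hence by all
    translations of the torus. For the entropy from above, points with the same
    approximate position along the expanding direction have the same labels at
    most times outside a set of small measure, and about |l|^n positions suffice
    up to time n; from below, an itinerary recording sign and integer vector of
    a lift of each step confines the starting point to a strip of width of order
    |l|^-n. The Lyapunov exponent is that of M, since off the edges the quotient
    map is affine on small discs.

    Two Farey paths for the same xi differ only if xi is one of their mediants,
    and from then on traces grow at most linearly, so both averages tend to 0. *)

Require Import Defs.
From mathcomp Require Import all_boot all_order all_algebra.
From mathcomp Require Import all_classical all_reals all_analysis.
From mathcomp Require Import measurable_realfun complex ring lra zify.

Import Order.TTheory GRing.Theory Num.Theory.
Import numFieldNormedType.Exports.

Local Open Scope classical_set_scope.
Local Open Scope ring_scope.

Set Implicit Arguments.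
Unset Strict Implicit.
Unset Printing Implicit Defensive.

(** * Planar Lebesgue measure under affine maps *)

Section AffineLebesgue.
Context {R : realType}.

Notation leb := (@lebesgue_measure R).
Notation leb2 := (@lebesgue_measure R \x @lebesgue_measure R)%E.

(** The torus is never formed: it is represented by periodic subsets of the plane, measured on the
    unit square, and everything on the surface is pulled back along [pillow]. Two obstacles shape
    the rest. The matrices along a Farey path may be parabolic, the identity included, so exponent
    and entropy are computed under [1 <= |l|] alone and without diagonalizing: a vector [theta] with
    [M theta = l theta] and a linear form [eta] with [M z = l^-1 z + eta(z) theta] replace the
    Jordan form. The price is a factor [n] in the growth estimates, which the logarithm kills; only
    ergodicity uses [1 < |l|] and the decomposition for both eigenvalues. Labellings and invariant
    sets are merely measurable, while closeness of orbits is metric. The link is to approximate a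
    set and its complement from inside by two sets at positive distance; this serves the Hopf
    argument and the entropy bound alike. The lift of [A] is [P^-1 A P], so only trace and
    determinant are carried over, and [l] may be negative. *)

Lemma measurable_preimage d1 d2 (T1 : measurableType d1) (T2 : measurableType d2)
    (f : T1 -> T2) (E : set T2) :
  measurable_fun setT f -> measurable E -> measurable (f @^-1` E).
Proof. by move=> mf mE; rewrite -[X in measurable X]setTI; exact: mf. Qed.

(** By uniqueness of Lebesgue measure it suffices to test [|a|] times the pushforward on intervals
    []x, y]]. A negative [a] turns their preimages into intervals closed on the left, hence the two
    cases. *)
Lemma lebesgue_affine (a b : R) (E : set R) : a != 0 -> measurable E ->
  leb ((fun x => a * x + b) @^-1` E) = ((`|a|^-1)%:E * leb E)%E.
Proof.
move=> a0 mE.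
have mf : measurable_fun [set: measurableTypeR R]
    ((fun x => a * x + b) : measurableTypeR R -> measurableTypeR R).
  by apply: measurable_funD => //; exact: measurable_funM.
pose f : measurableTypeR R -> measurableTypeR R := fun x => a * x + b.
have -> : leb E = (`|a|%:E * pushforward leb f E)%E.
  pose nu := @mscale _ (measurableTypeR R) R (NngNum (normr_ge0 a))
    (pushforward leb f).
  have := @lebesgue_measure_unique R (nu mf) => /(_ _ E mE); apply.
  move=> _ [[x y] _ <-] /=.
  rewrite /nu /mscale /= /pushforward /f.
  have [xy|yx] := ltP x y; last first.
    rewrite set_itv_ge ?bnd_simp -?leNgt //.
    by rewrite preimage_set0 !measure0 mule0.
  rewrite lebesgue_measure_itv /= lte_fin xy.
  have [ap|an] := ltP 0 a.
    have -> : (fun t : R => a * t + b) @^-1` `]x, y] = `](x - b) / a, (y - b) / a]%classic.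
      apply/seteqP; split => t /=; rewrite !in_itv /= => /andP[h1 h2].
        by rewrite ltr_pdivrMr // ler_pdivlMr //; apply/andP; split; nra.
      move: h1 h2; rewrite ltr_pdivrMr // ler_pdivlMr // => h1 h2.
      by apply/andP; split; nra.
    rewrite lebesgue_measure_itv /= lte_fin ltr_pM2r ?invr_gt0 // ltrD2r xy.
    rewrite -!EFinB -EFinM gtr0_norm //; congr EFin; field.
    exact: a0.
  have {}an : a < 0 by rewrite lt_neqAle a0.
  have -> : (fun t : R => a * t + b) @^-1` `]x, y] = `[(y - b) / a, (x - b) / a[%classic.
    apply/seteqP; split => t /=; rewrite !in_itv /= => /andP[h1 h2].
      by rewrite ler_ndivrMr // ltr_ndivlMr //; apply/andP; split; nra.
    move: h1 h2; rewrite ler_ndivrMr // ltr_ndivlMr // => h1 h2.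
    by apply/andP; split; nra.
  rewrite lebesgue_measure_itv /= lte_fin ltr_nM2r ?invr_lt0 // ltrD2r xy.
  rewrite -!EFinB -EFinM ltr0_norm //; congr EFin; field.
  exact: a0.
rewrite muleA -EFinM mulVf ?normr_eq0 //.
by rewrite mul1e.
Qed.

(** The factor is that of preimages: for an affine map it is the inverse of the modulus of the
    determinant. *)
Definition scales_area (c : R) (f : R * R -> R * R) :=
  measurable_fun setT f /\
  forall E : set (R * R), measurable E -> leb2 (f @^-1` E) = (c%:E * leb2 E)%E.

Lemma scales_area_comp c d f g :
  scales_area c f -> scales_area d g -> scales_area (d * c) (f \o g).
Proof.
move=> [mf hf] [mg hg]; split; first exact: measurableT_comp.
move=> E mE; rewrite comp_preimage hg ?hf ?muleA ?EFinM //.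
exact: measurable_preimage.
Qed.

(** Horizontal slices suit maps that change only the first coordinate; uniqueness of the product
    measure gives them the same total. *)
Lemma leb2E (E : set (R * R)) : measurable E ->
  leb2 E = (\int[leb]_y leb (ysection E y))%E.
Proof.
move=> mE; apply: (@product_measure_unique _ _ _ _ _ leb leb
  [the measure _ _ of (leb \x^ leb)%E]) => // A B mA mB.
exact: product_measure2E.
Qed.

Lemma swap_scales_area : scales_area 1 (fun z => (z.2, z.1)).
Proof.
have mf : measurable_fun [set: R * R] (fun z : R * R => (z.2, z.1)).
  exact: measurable_fun_pair.
split => // E mE; rewrite mul1e [RHS]leb2E //.
Qed.

Lemma xaffine_scales_area (a : R) (b : R -> R) : a != 0 -> measurable_fun setT b ->
  scales_area `|a|^-1 (fun z => (a * z.1 + b z.2, z.2)).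
Proof.
move=> a0 mb.
have mf : measurable_fun [set: R * R] (fun z : R * R => (a * z.1 + b z.2, z.2)).
  apply: measurable_fun_pair => //; apply: measurable_funD.
    by apply: measurable_funM => //; exact: measurable_fst.
  by apply: measurableT_comp => //; exact: measurable_snd.
split => // E mE; have mfE := measurable_preimage mf mE.
rewrite [LHS]leb2E // [in RHS]leb2E //.
rewrite -ge0_integralZl //; last exact: (measurable_fun_ysection leb).
apply: eq_integral => y _.
have mEy := measurable_ysection y mE.
have := lebesgue_affine (b y) a0 mEy => <-; congr (leb _).
Qed.

(** Gaussian elimination: for [a != 0] the map is an affine change of the first coordinate followed
    by one of the second, of slope [(a d - b c) / a], the latter written as a change of the first
    coordinate between two swaps. If [a = 0], a swap beforehand exchanges the columns. *)
Lemma affine_scales_area (a b c d e f : R) : a * d - b * c != 0 ->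
  scales_area `|a * d - b * c|^-1
    (fun z => (a * z.1 + b * z.2 + e, c * z.1 + d * z.2 + f)).
Proof.
wlog a0 : a b c d / a != 0 => [hw|] D.
  have [a0|a0] := eqVneq a 0; last exact: hw.
  have b0 : b != 0.
    by apply: contraNneq D => b0; rewrite a0 b0 !mul0r subr0.
  have D' : b * c - a * d != 0 by rewrite -opprB oppr_eq0.
  have := scales_area_comp (hw b a d c b0 D') swap_scales_area.
  rewrite mul1r distrC; congr scales_area.
  by apply/funext => z /=; rewrite [a * _ + _]addrC [c * _ + _]addrC.
have m1 : measurable_fun [set: R] (fun y : R => b * y + e).
  by apply: measurable_funD => //; exact: measurable_funM.
have m2 : measurable_fun [set: R] (fun x : R => c / a * (x - e) + f).
  apply: measurable_funD => //; apply: measurable_funM => //.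
  exact: measurable_funB.
have Da : (a * d - b * c) / a != 0 by rewrite mulf_neq0 ?invr_eq0.
have h1 := xaffine_scales_area a0 m1.
have h2 := xaffine_scales_area Da m2.
have sw := swap_scales_area.
have := scales_area_comp (scales_area_comp (scales_area_comp sw h2) sw) h1.
rewrite !(mul1r, mulr1) -invfM -normrM mulrC divfK //; congr scales_area.
apply/funext => -[x y] /=; congr (_, _); [ring|field; exact: a0].
Qed.

End AffineLebesgue.

(** * The measure of periodic sets *)

Section TorusMeasure.
Context {R : realType}.

Notation leb := (@lebesgue_measure R).
Notation leb2 := (@lebesgue_measure R \x @lebesgue_measure R)%E.

Definition periodic1 (E : set R) := forall x, E (x + 1) <-> E x.

Lemma periodic1_int E : periodic1 E -> forall x (k : int), E (x + k%:~R) <-> E x.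
Proof.
move=> hE.
have nat_case x (n : nat) : E (x + n%:R) <-> E x.
  elim: n => [|n IH]; first by rewrite addr0.
  by rewrite -natr1 addrA hE.
move=> x [n|n]; first exact: nat_case.
rewrite NegzE mulrNz; rewrite -(nat_case (x - _) n.+1) subrK.
by [].
Qed.

(** An integer translation reduces to a window starting at some [r] in [[0, 1[]; its part beyond [1]
    is then moved back onto [[0, r[]. *)
Lemma lebesgue_periodic_window (E : set R) (a : R) : measurable E -> periodic1 E ->
  leb (E `&` `[a, a + 1[) = leb (E `&` `[0, 1[).
Proof.
move=> mE pE; pose n : R := (Num.floor a)%:~R; pose r := a - n.
have /andP[r0 r1] : 0 <= r < 1.
  have /andP[h1 h2] := floor_itv a; rewrite intrD in h2.
  by rewrite /r /n; apply/andP; split; lra.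
have mi (x y : R) : measurable (E `&` `[x, y[) by apply: measurableI.
have -> : E `&` `[a, a + 1[ = (fun x => 1 * x + - n) @^-1` (E `&` `[r, r + 1[).
  apply/seteqP; split => x /=; rewrite !in_itv /= mul1r => -[Ex /andP[h1 h2]].
    split; last by rewrite /r; apply/andP; split; lra.
    by rewrite -(periodic1_int pE _ (Num.floor a)) subrK.
  rewrite /r in h1 h2; split; last by apply/andP; split; lra.
  by rewrite -(periodic1_int pE _ (Num.floor a)) -/n subrK in Ex.
have /= -> := lebesgue_affine (- n) (oner_neq0 R) (mi r (r + 1)).
rewrite normr1 invr1 mul1e.
have -> : E `&` `[r, r + 1[ = (E `&` `[r, 1[) `|` (E `&` `[1, 1 + r[).
  rewrite -setIUr; congr (_ `&` _); apply/seteqP; split => x /=; rewrite !in_itv /=.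
    move=> /andP[h1 h2]; have [x1|x1] := ltP x 1; [left|right]; apply/andP; split=> //; lra.
  by move=> [] /andP[h1 h2]; apply/andP; split=> //; lra.
have -> : E `&` `[0, 1[ = (E `&` `[r, 1[) `|` (E `&` `[0, r[).
  rewrite -setIUr; congr (_ `&` _); apply/seteqP; split => x /=; rewrite !in_itv /=.
    move=> /andP[h1 h2]; have [x1|x1] := ltP x r; [right|left]; apply/andP; split=> //; lra.
  by move=> [] /andP[h1 h2]; apply/andP; split=> //; lra.
have disj (X Y : set R) : X `&` Y = set0 -> (E `&` X) `&` (E `&` Y) = set0.
  by move=> XY; rewrite setIACA XY setI0.
rewrite measureU; [|exact: mi|exact: mi|apply: disj]; last first.
  apply/seteqP; split => // x /=; rewrite !in_itv /=.
  by move=> [/andP[h1 h2] /andP[h3 h4]]; lra.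
rewrite [RHS]measureU; [|exact: mi|exact: mi|apply: disj]; last first.
  apply/seteqP; split => // x /=; rewrite !in_itv /=.
  by move=> [/andP[h1 h2] /andP[h3 h4]]; lra.
congr (_ + _)%E.
have -> : E `&` `[0, r[ = (fun x => 1 * x + 1) @^-1` (E `&` `[1, 1 + r[).
  apply/seteqP; split => x /=; rewrite !in_itv /= mul1r => -[Ex /andP[h1 h2]].
    by split; [rewrite pE|apply/andP; split; lra].
  by rewrite pE in Ex; split => //; apply/andP; split; lra.
have /= -> := lebesgue_affine 1 (oner_neq0 R) (mi 1 (1 + r)).
by rewrite normr1 invr1 mul1e.
Qed.

Lemma lebesgue_periodic_isometry (E : set R) (s b : R) : s = 1 \/ s = -1 ->
  measurable E -> periodic1 E ->
  leb ((fun x => s * x + b) @^-1` E `&` `[0, 1[) = leb (E `&` `[0, 1[).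
Proof.
move=> hs mE pE.
have mi (i : interval R) : measurable (E `&` [set` i]) by apply: measurableI.
case: hs => ->.
  rewrite -(lebesgue_periodic_window b mE pE).
  have -> : (fun x => 1 * x + b) @^-1` E `&` `[0, 1[ =
            (fun x => 1 * x + b) @^-1` (E `&` `[b, b + 1[).
    apply/seteqP; split => x /=; rewrite !in_itv /= mul1r => -[Ex /andP[h1 h2]];
      by split => //; apply/andP; split; lra.
  have /= -> := lebesgue_affine b (oner_neq0 R) (mi `[b, b + 1[).
  by rewrite normr1 invr1 mul1e.
rewrite -(lebesgue_periodic_window (b - 1) mE pE) subrK.
have -> : (fun x => -1 * x + b) @^-1` E `&` `[0, 1[ =
          (fun x => -1 * x + b) @^-1` (E `&` `]b - 1, b]).
  apply/seteqP; split => x /=; rewrite !in_itv /= mulN1r => -[Ex /andP[h1 h2]];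
    by split => //; apply/andP; split; lra.
have m1 : (-1 : R) != 0 by rewrite oppr_eq0 oner_neq0.
have /= -> := lebesgue_affine b m1 (mi `]b - 1, b]).
rewrite normrN normr1 invr1 mul1e.
(* The reflection turns [[0, 1[] into []b - 1, b]], which differs from the window [[b - 1, b[] by
   its two end points. *)
have null (c : R) : leb (E `&` [set c]) = 0%E.
  apply: (@subset_measure0 _ _ _ leb _ [set c]) => //.
  - exact: measurableI.
  - exact: lebesgue_measure_set1.
have b1 : (BRight (b - 1) <= BLeft b)%O by rewrite bnd_simp; lra.
have ms (c : R) : measurable (E `&` [set c]) by apply: measurableI.
rewrite -(setUitv1 true) // setIUr measureU0; [|exact: mi|exact: ms|exact: null].
rewrite -(setU1itv false) // setIUr setUC.
by rewrite measureU0; [|exact: mi|exact: ms|exact: null].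
Qed.

Definition periodic (E : set (R * R)) :=
  forall x y (k l : int), E (x + k%:~R, y + l%:~R) <-> E (x, y).

Definition unit_square : set (R * R) := `[0, 1[ `*` `[0, 1[.

(** Meant for periodic sets, for which the unit square is a fundamental domain; translations and
    unimodular maps preserve it on these. *)
Definition torus (E : set (R * R)) : \bar R := leb2 (E `&` unit_square).

Lemma measurable_unit_square : measurable unit_square.
Proof. exact: measurableX. Qed.

(** On each horizontal line the map is an isometry of the circle, so the one-dimensional invariance
    applies slice by slice. *)
Lemma torus_xisometry (E : set (R * R)) (s : R) (b : R -> R) : s = 1 \/ s = -1 ->
  measurable_fun setT b -> measurable E -> periodic E ->
  torus ((fun z => (s * z.1 + b z.2, z.2)) @^-1` E) = torus E.
Proof.
move=> hs mb mE pE.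
have s0 : s != 0 by case: hs => ->; rewrite ?oppr_eq0 oner_neq0.
have [mf _] := xaffine_scales_area s0 mb.
have mfE := measurable_preimage mf mE.
have mS := measurable_unit_square.
rewrite /torus leb2E; last exact: measurableI.
rewrite [RHS]leb2E; last exact: measurableI.
apply: eq_integral => y _.
have mEy := measurable_ysection y mE.
have [y01|y01] := boolP (y \in `[0, 1[); last first.
  by congr (leb _); apply/seteqP; split => x; rewrite /ysection /= !inE /=
    => -[_ [_]] /=; rewrite (negbTE y01).
have pEy : periodic1 (ysection E y).
  move=> x; rewrite /ysection /= !inE.
  by have := pE x y 1 0; rewrite addr0 mulr1z.
transitivity (leb ((fun x => s * x + b y) @^-1` (ysection E y) `&` `[0, 1[)).
  congr (leb _); apply/seteqP; split => x; rewrite /ysection /= !inE /=.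
    by move=> [? []].
  by move=> [? ?]; split => //; split.
rewrite lebesgue_periodic_isometry //.
congr (leb _); apply/seteqP; split => x; rewrite /ysection /= !inE /=.
  by move=> [? ?]; split => //; split.
by move=> [? []].
Qed.

Lemma torus_swap (E : set (R * R)) : measurable E ->
  torus ((fun z => (z.2, z.1)) @^-1` E) = torus E.
Proof.
move=> mE; have [_] := @swap_scales_area R.
move=> /(_ (E `&` unit_square)); rewrite mul1e /torus => <-; last first.
  by apply: measurableI => //; exact: measurable_unit_square.
congr (_ _); apply/seteqP; split => -[x y] /=.
  by move=> [? []].
by move=> [? []].
Qed.

End TorusMeasure.

(** * Integer matrices of size two and the generators of the modular group *)

Lemma mx2E (a b c e : int) :
  ((mx2 a b c e 0 0 = a) * (mx2 a b c e 0 1 = b) *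
   (mx2 a b c e 1 0 = c) * (mx2 a b c e 1 1 = e))%type.
Proof. by rewrite /mx2 !mxE. Qed.

Lemma ord2P (P : 'I_2 -> Prop) : P 0 -> P 1 -> forall i, P i.
Proof.
move=> P0 P1 i; case: (unliftP 0 i) => [j|] -> //.
by rewrite ord1 (_ : lift 0 0 = 1) //; exact: val_inj.
Qed.

Lemma mx2_eta (M : 'M[int]_2) : M = mx2 (M 0 0) (M 0 1) (M 1 0) (M 1 1).
Proof. by apply/matrixP; apply: ord2P; apply: ord2P; rewrite mx2E. Qed.

Lemma mulmx2 (A B : 'M[int]_2) : A *m B =
  mx2 (A 0 0 * B 0 0 + A 0 1 * B 1 0) (A 0 0 * B 0 1 + A 0 1 * B 1 1)
      (A 1 0 * B 0 0 + A 1 1 * B 1 0) (A 1 0 * B 0 1 + A 1 1 * B 1 1).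
Proof.
have l01 : lift ord0 ord0 = 1 :> 'I_2 by exact: val_inj.
by apply/matrixP; apply: ord2P; apply: ord2P;
  rewrite mx2E mxE !big_ord_recl big_ord0 addr0 ?l01.
Qed.

Lemma det2 (A : 'M[int]_2) : \det A = A 0 0 * A 1 1 - A 0 1 * A 1 0.
Proof. have l01 : lift ord0 ord0 = 1 :> 'I_2 by exact: val_inj.
have l10 : lift (1 : 'I_2) ord0 = 0 by exact: val_inj.
rewrite (expand_det_row _ 0) !big_ord_recl big_ord0 addr0 /cofactor.
rewrite !det_mx11 !mxE l01 l10 /= expr0 expr1; ring. Qed.

Lemma tr2 (A : 'M[int]_2) : \tr A = A 0 0 + A 1 1.
Proof.
have l01 : lift ord0 ord0 = 1 :> 'I_2 by exact: val_inj.
by rewrite /mxtrace !big_ord_recl big_ord0 addr0 ?l01.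
Qed.

Lemma scalar_mx2 (a : int) : a%:M = mx2 a 0 0 a.
Proof. by apply/matrixP; apply: ord2P; apply: ord2P; rewrite mx2E mxE. Qed.

(* The translation matrix and its powers are words in genS and genU, and the
   Euclidean algorithm on the first column reduces the lower left entry. *)
Lemma SL2Z_ind (Phi : 'M[int]_2 -> Prop) :
  Phi 1%:M -> Phi genS -> Phi genU ->
  (forall A B, \det A = 1 -> \det B = 1 -> Phi A -> Phi B -> Phi (A *m B)) ->
  forall M, \det M = 1 -> Phi M.
Proof.
move=> P1 PS PU PM.
pose T (k : int) := mx2 1 k 0 1.
have dT k : \det (T k) = 1 by rewrite det2 !mx2E; ring.
have dS : \det genS = 1 by rewrite det2 !mx2E; ring.
have dU : \det genU = 1 by rewrite det2 !mx2E; ring.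
have dM (A B : 'M[int]_2) : \det A = 1 -> \det B = 1 -> \det (A *m B) = 1.
  by move=> dA dB; rewrite det_mulmx dA dB mulr1.
have SS : genS *m genS = - 1%:M.
  rewrite mulmx2 !mx2E scalar_mx2.
  by apply/matrixP; apply: ord2P; apply: ord2P; rewrite [RHS]mxE !mx2E; ring.
have PN : Phi (- 1%:M) by rewrite -SS; exact: PM.
have dN : \det (- 1%:M : 'M[int]_2) = 1.
  by rewrite det2 scalar_mx2 !mxE /=; ring.
have PT1 : Phi (T 1).
  have -> : T 1 = (- 1%:M) *m (genS *m genU).
    rewrite !mulmx2 scalar_mx2 !(mx2E, mxE) /=.
    by apply/matrixP; apply: ord2P; apply: ord2P; rewrite !mx2E; ring.
  by apply: (PM) => //; [exact: dM|exact: PM].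
have PTN1 : Phi (T (-1)).
  have -> : T (-1) = genU *m (genU *m genS).
    rewrite !mulmx2 !mx2E.
    by apply/matrixP; apply: ord2P; apply: ord2P; rewrite !mx2E; ring.
  by apply: (PM) => //; [exact: dM|exact: PM].
have TD k l : T (k + l) = T k *m T l.
  rewrite mulmx2 !mx2E.
  by apply/matrixP; apply: ord2P; apply: ord2P; rewrite !mx2E; ring.
have PT k : Phi (T k).
  elim/int_ind: k => [|n IH|n IH].
  - by have -> : T 0 = 1%:M by rewrite scalar_mx2.
  - by rewrite -addn1 PoszD TD; exact: PM.
  - by rewrite -addn1 PoszD opprD TD; exact: PM.
move=> M; have [n] := ubnP (absz (M 1 0)); elim: n M => // n IH M Mn dM1.
have [c0|c0] := eqVneq (M 1 0) 0.
  have ae : M 0 0 * M 1 1 = 1 by rewrite -dM1 det2 c0; ring.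
  have /orP[/eqP a1|/eqP a1] : (M 0 0 == 1) || (M 0 0 == -1).
    have := congr1 absz ae; rewrite abszM => /eqP; rewrite muln_eq1.
    by move=> /andP[/eqP a1 _]; lia.
  - have -> : M = T (M 0 1).
      by rewrite {1}[M]mx2_eta c0 a1; rewrite a1 mul1r in ae; rewrite ae.
    exact: PT.
  - have e1 : M 1 1 = -1 by rewrite a1 mulN1r in ae; rewrite -ae opprK.
    have -> : M = (- 1%:M) *m T (- M 0 1).
      rewrite {1}[M]mx2_eta c0 a1 e1 mulmx2 scalar_mx2 !(mx2E, mxE) /=.
      by apply/matrixP; apply: ord2P; apply: ord2P; rewrite !mx2E; ring.
    exact: PM.
pose k := divz (M 0 0) (M 1 0).
pose N := genS *m (T (- k) *m M).
have dN1 : \det N = 1 by do 2 apply: (dM) => //.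
have N10 : N 1 0 = - modz (M 0 0) (M 1 0).
  by rewrite /N !mulmx2 !mx2E /modz /k; ring.
have PNN : Phi N.
  apply: IH => //; rewrite N10.
  have h1 := modz_ge0 (M 0 0) c0.
  have h2 := ltz_mod (M 0 0) c0.
  lia.
have -> : M = T k *m ((- 1%:M) *m (genS *m N)).
  rewrite /N [genS *m _]mulmxA SS !mulNmx !mulmxN opprK !mul1mx mulmxA -TD subrr.
  by rewrite -[T 0]scalar_mx2 mul1mx.
have dSN := dM _ _ dS dN1.
have PSN := PM _ _ dS dN1 PS PNN.
by apply: (PM) => //; [exact: dM|exact: PM].
Qed.

(** * The linear action on the torus *)

Section LinearAction.
Context {R : realType}.

Definition lin (M : 'M[int]_2) (z : R * R) : R * R :=
  ((M 0 0)%:~R * z.1 + (M 0 1)%:~R * z.2, (M 1 0)%:~R * z.1 + (M 1 1)%:~R * z.2).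

Lemma lin_mul A B : lin (A *m B) = lin A \o lin B.
Proof.
by apply/funext => z; rewrite /lin /= mulmx2 !mx2E !intrD !intrM; congr (_, _); ring.
Qed.

Lemma lin_one : lin 1%:M = id.
Proof.
apply/funext => -[x y]; rewrite /lin scalar_mx2 !mx2E /= mulr1z mulr0z.
by congr (_, _); ring.
Qed.

Lemma linD A z t : lin A (z + t) = lin A z + lin A t.
Proof. by rewrite /lin; congr (_, _) => /=; ring. Qed.

Lemma linZ A (c : R) z : lin A (c *: z) = c *: lin A z.
Proof. by rewrite /lin; congr (_, _) => /=; rewrite /GRing.scale /=; ring. Qed.

Lemma linN A z : lin A (- z) = - lin A z.
Proof. by rewrite -scaleN1r linZ scaleN1r. Qed.

Lemma linB A z t : lin A (z - t) = lin A z - lin A t.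
Proof. by rewrite linD linN. Qed.

Lemma measurable_lin A : measurable_fun setT (lin A).
Proof.
by apply: measurable_fun_pair; apply: measurable_funD;
  apply: measurable_funM => //; (exact: measurable_fst || exact: measurable_snd).
Qed.

Lemma periodic_lin A (E : set (R * R)) : periodic E -> periodic (lin A @^-1` E).
Proof.
move=> pE x y k l; rewrite /preimage /= /lin /=.
have <- := pE ((A 0 0)%:~R * x + (A 0 1)%:~R * y) ((A 1 0)%:~R * x + (A 1 1)%:~R * y)
  (A 0 0 * k + A 0 1 * l) (A 1 0 * k + A 1 1 * l).
rewrite !intrD !intrM; set u := (_, _); set v := (_, _).
suff -> : u = v by [].
by rewrite /u /v; congr (_, _); ring.
Qed.

(** A general unimodular matrix cuts the unit square into many pieces, so invariance is proved on
    words: each generator is a map [(- x + b y, y)] followed by the swap of coordinates, with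
    [b = 0] for [genS] and [b = -1] for [genU]. *)
Lemma torus_lin A (E : set (R * R)) : \det A = 1 -> measurable E -> periodic E ->
  torus (lin A @^-1` E) = torus E.
Proof.
move=> dA; move: A dA E; apply: SL2Z_ind => [E|E mE pE|E mE pE|A B _ _ hA hB E mE pE].
- by rewrite lin_one.
- pose F := (fun z : R * R => (z.2, z.1)) @^-1` E.
  have mF : measurable F by apply: measurable_preimage mE; exact: measurable_fun_pair.
  have pF : periodic F by move=> x y k l; exact: pE.
  rewrite -(torus_swap mE) -(torus_xisometry (or_intror erefl) (measurable_cst (0 : R)) mF pF).
  congr torus; apply/seteqP; split => -[x y]; rewrite /preimage /F /lin /= !mx2E /=;
    by rewrite !(mulrN1z, mulr1z, mulr0z, mul0r, mul1r, addr0, add0r).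
- pose F := (fun z : R * R => (z.2, z.1)) @^-1` E.
  have mF : measurable F by apply: measurable_preimage mE; exact: measurable_fun_pair.
  have pF : periodic F by move=> x y k l; exact: pE.
  have mo : measurable_fun [set: R] (fun y : R => - y) by apply: measurable_funN.
  rewrite -(torus_swap mE) -(torus_xisometry (or_intror erefl) mo mF pF).
  congr torus; apply/seteqP; split => -[x y]; rewrite /preimage /F /lin /= !mx2E /=;
    by rewrite !(mulrN1z, mulr1z, mulr0z, mul0r, mul1r, mulN1r, addr0, add0r).
- rewrite lin_mul comp_preimage hB ?hA //; last exact: periodic_lin.
  by apply: measurable_preimage mE; exact: measurable_lin.
Qed.

Lemma torus_shift (v : R * R) (E : set (R * R)) : measurable E -> periodic E ->
  torus ((fun z => z + v) @^-1` E) = torus E.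
Proof.
move=> mE pE.
pose F := (fun z : R * R => (z.1, z.2 + v.2)) @^-1` E.
have mF : measurable F.
  by apply: measurable_preimage mE; apply: measurable_fun_pair;
    [exact: measurable_fst|apply: measurable_funD => //; exact: measurable_snd].
have pF : periodic F by move=> x y k l; rewrite /F /preimage /= addrAC pE.
pose G := (fun z : R * R => (z.2, z.1)) @^-1` E.
have mG : measurable G by apply: measurable_preimage mE; exact: measurable_fun_pair.
have pG : periodic G by move=> x y k l; exact: pE.
have h1 := torus_xisometry (or_introl erefl) (measurable_cst v.1) mF pF.
have h2 := torus_xisometry (or_introl erefl) (measurable_cst v.2) mG pG.
have mG' : measurable ((fun z : R * R => (1 * z.1 + cst v.2 z.2, z.2)) @^-1` G).
  apply: measurable_preimage mG; apply: measurable_fun_pair; last exact: measurable_snd.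
  by apply: measurable_funD => //; apply: measurable_funM => //; exact: measurable_fst.
transitivity (torus F).
  rewrite -h1; congr torus; apply/seteqP; split => -[x y];
  by rewrite /F /preimage /= !mul1r.
rewrite -(torus_swap mE) -h2 -(torus_swap mG'); congr torus.
by apply/seteqP; split => -[x y]; rewrite /F /G /preimage /= !mul1r.
Qed.

End LinearAction.

(** * The pillowcase map *)

Section Pillowcase.
Context {R : realType}.

(* [saw t] is [2 - 8 dist(t, Z)]. *)
Definition saw (t : R) : R := `|8 * (t - (Num.floor t)%:~R) - 4| - 2.

Lemma saw_int t (k : int) : saw (t + k%:~R) = saw t.
Proof.
rewrite /saw floorDrz ?intr_int // intrKfloor intrD.
by congr (`|8 * _ - 4| - 2); ring.
Qed.

Lemma saw01 t : 0 <= t <= 1 -> saw t = `|8 * t - 4| - 2.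
Proof.
move=> /andP[t0 t1]; have [tl|] := ltP t 1.
  rewrite /saw (_ : Num.floor t = 0) ?mulr0z ?subr0 //.
  by apply/eqP; rewrite floor_eq mulr0z add0r mulr1z t0.
move=> tg; have -> : t = 0 + 1%:~R by rewrite mulr1z add0r; apply/eqP; rewrite eq_le t1.
rewrite saw_int /saw floor0 mulr0z mulr1z.
by rewrite [`|_|]ler0_norm ?[`|_|]ger0_norm; lra.
Qed.

Lemma saw_half t : 0 <= t <= 2^-1 -> saw t = 2 - 8 * t.
Proof.
move=> h; rewrite saw01; last by apply/andP; split; lra.
by rewrite ler0_norm; lra.
Qed.

Lemma frac_decomp (t : R) : exists (n : int) (r : R), 0 <= r < 1 /\ t = r + n%:~R.
Proof.
exists (Num.floor t), (t - (Num.floor t)%:~R); rewrite subrK; split => //.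
have /andP[h1 h2] := floor_itv t; rewrite intrD in h2.
by apply/andP; split; lra.
Qed.

Lemma sawN t : saw (- t) = saw t.
Proof.
have [n [r [/andP[r0 r1] ->]]] := frac_decomp t.
have -> : - (r + n%:~R) = (1 - r) + (- n - 1)%:~R by rewrite intrB mulrNz; ring.
rewrite !saw_int !saw01; try by apply/andP; split; lra.
by rewrite -[in RHS]normrN; congr (`|_| - _); ring.
Qed.

(** [a] is the distance from [t] to the integers. Folding reduces identities about [saw] to the
    interval [[0, 1/2]], where it is affine. *)
Lemma fold_decomp (t : R) : exists (a s : R) (k : int),
  [/\ 0 <= a <= 2^-1, s = 1 \/ s = -1 & t = s * a + k%:~R].
Proof.
have [n [r [/andP[r0 r1] ->]]] := frac_decomp t.
have [h|h] := leP r 2^-1.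
  by exists r, 1, n; split; [rewrite r0|left|rewrite mul1r].
exists (1 - r), (-1), (n + 1); split; [apply/andP; split; lra|by right|].
by rewrite intrD; ring.
Qed.

Lemma saw_sign (s t : R) : s = 1 \/ s = -1 -> saw (s * t) = saw t.
Proof. by case=> ->; rewrite ?mul1r // mulN1r sawN. Qed.

Lemma saw_fold (a s : R) (k : int) : 0 <= a <= 2^-1 -> s = 1 \/ s = -1 ->
  saw (s * a + k%:~R) = 2 - 8 * a.
Proof. by move=> ha hs; rewrite saw_int saw_sign // saw_half. Qed.

(** The distance to the integers is at most the distance to [k]. Equality for the nearest integer
    turns this into the Lipschitz bound. *)
Lemma saw_ge t (k : int) : 2 - 8 * `|t - k%:~R| <= saw t.
Proof.
rewrite -(saw_int t (- k)) mulrNz; set u := t - _.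
have [n [r [/andP[r0 r1] ->]]] := frac_decomp u.
rewrite saw_int saw01; last by apply/andP; split; lra.
have hs := ler_norm (8 * r - 4); have hs' := ler_norm (- (8 * r - 4)).
rewrite normrN in hs'.
have h1 := ler_norm (r + n%:~R); have h2 := ler_norm (- (r + n%:~R)).
rewrite normrN in h2.
have [n0|n0|n0] := ltgtP n 0.
- have : (n%:~R : R) <= (-1)%:~R by rewrite ler_int; lia.
  by rewrite mulrN1z => ?; lra.
- have : 1%:~R <= (n%:~R : R) by rewrite ler_int; lia.
  by rewrite mulr1z => ?; lra.
- by rewrite n0 mulr0z addr0 in h1 *; lra.
Qed.

Lemma saw_lipschitz s t : `|saw s - saw t| <= 8 * `|s - t|.
Proof.
have half u v : saw u <= saw v + 8 * `|u - v|.
  have [a [e [k [ha he E]]]] := fold_decomp u.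
  have -> : saw u = 2 - 8 * `|u - k%:~R|.
    rewrite E saw_fold // addrK; case/andP: ha => a0 _.
    by case: he => ->; rewrite ?mul1r ?mulN1r ?normrN ger0_norm.
  have := saw_ge v k; have := ler_distD u v k%:~R; rewrite (distrC v u) => *; lra.
rewrite ler_norml; have := half s t; have := half t s; rewrite (distrC t s) => *.
by apply/andP; split; lra.
Qed.

Lemma measurable_saw : measurable_fun setT saw.
Proof.
have c : continuous saw.
  move=> x; apply/cvgrPdist_lt => e e0; near=> y.
  apply: le_lt_trans (saw_lipschitz _ _) _.
  rewrite -ltr_pdivlMl //; near: y.
  by apply: (@nbhsx_ballx _ R^o); rewrite mulr_gt0 // invr_gt0.
exact: continuous_measurable_fun.
Unshelve. all: by end_near. Qed.

(* The pillowcase map: it identifies the quotient of the torus by -1 with the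
   surface, intertwining the linear action and the tropical one. *)
Definition pillow (z : R * R) : R * R * R := (saw z.1, saw z.2, saw (z.1 + z.2)).

Lemma measurable_pillow : measurable_fun setT pillow.
Proof.
apply: measurable_fun_pair; first apply: measurable_fun_pair;
  apply: (measurableT_comp measurable_saw); [exact: measurable_fst|exact: measurable_snd|].
by apply: measurable_funD; [exact: measurable_fst|exact: measurable_snd].
Qed.

Lemma pillow_int x y (k l : int) : pillow (x + k%:~R, y + l%:~R) = pillow (x, y).
Proof. by rewrite /pillow /= addrACA -intrD !saw_int. Qed.

Lemma pillowN z : pillow (- z) = pillow z.
Proof. by rewrite /pillow /= -opprD !sawN. Qed.

Lemma periodic_pillow (B : set (R * R * R)) : periodic (pillow @^-1` B).
Proof. by move=> x y k l; rewrite /preimage /= pillow_int. Qed.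

Lemma measurable_pillow_preimage (B : set (R * R * R)) :
  measurable B -> measurable (pillow @^-1` B).
Proof. by apply: measurable_preimage; exact: measurable_pillow. Qed.

Lemma pillow_lipschitz z t : `|pillow z - pillow t| <= 16 * `|z - t|.
Proof.
have h1 : `|z.1 - t.1| <= `|z - t| by rewrite prod_normE le_max lexx.
have h2 : `|z.2 - t.2| <= `|z - t| by rewrite prod_normE le_max lexx orbT.
have N0 := normr_ge0 (z - t); move: N0 h1 h2; move: `|z - t| => N N0 h1 h2.
rewrite !prod_normE /= !ge_max; apply/andP; split; first (apply/andP; split);
  apply: le_trans (saw_lipschitz _ _) _; [lra|lra|].
have := ler_normD (z.1 - t.1) (z.2 - t.2).
by rewrite (_ : z.1 - t.1 + _ = z.1 + z.2 - (t.1 + t.2)); [lra|ring].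
Qed.

(** The tropical form of [cos (x + y) + cos (x - y) = 2 cos x cos y]: both [x + y] and [x - y]
    complete [(saw x, saw y)] to a point of the surface, and the Vieta involution exchanges them.
    After folding, the four cases of [fpl] are the triangles into which the diagonals cut the square
    of side [1/2]. *)
Lemma saw_add_sub x y : saw (x - y) = - saw (x + y) + 2 * fpl (saw x) (saw y).
Proof.
have [a [s [k [ha hs ->]]]] := fold_decomp x.
have [b [t [l [hb ht ->]]]] := fold_decomp y.
rewrite !saw_fold // (_ : s * a + _ - _ = (s * a - t * b) + (k - l)%:~R); last first.
  by rewrite intrB; ring.
rewrite (_ : s * a + k%:~R + (t * b + l%:~R) = (s * a + t * b) + (k + l)%:~R); last first.
  by rewrite intrD; ring.
rewrite !saw_int.
have key : saw (a - b) + saw (a + b) = 2 * fpl (2 - 8 * a) (2 - 8 * b).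
  case/andP: ha => a0 a1; case/andP: hb => b0 b1.
  rewrite [saw (a + b)]saw01; last by apply/andP; split; lra.
  have -> : saw (a - b) = 2 - 8 * `|a - b|.
    have [ab|ab] := leP b a.
      by rewrite ger0_norm ?subr_ge0 // saw_half //; apply/andP; split; lra.
    rewrite ltr0_norm ?subr_lt0 // -sawN saw_half //.
    by apply/andP; split; lra.
  rewrite /fpl; case: ifPn => c1; last case: ifPn => c2; last case: ifPn => c3.
  - move: c1; rewrite ler_norml => /andP[? ?].
    by rewrite [`|a - b|]ler0_norm ?[`|_ - 4|]ler0_norm; lra.
  - move: c2; rewrite ler_norml => /andP[? ?].
    by rewrite [`|a - b|]ger0_norm ?[`|_ - 4|]ler0_norm; lra.
  - move: c3; rewrite ler_norml => /andP[? ?].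
    by rewrite [`|a - b|]ger0_norm ?[`|_ - 4|]ger0_norm; lra.
  - move: c1 c2 c3; rewrite !ler_norml !negb_and -!ltNge.
    move=> /orP c1 /orP c2 /orP c3.
    have h1 : a <= b by case: c1 => ?; case: c2 => ?; case: c3 => ?; lra.
    have h2 : 4 <= 8 * (a + b) by case: c1 => ?; case: c2 => ?; case: c3 => ?; lra.
    by rewrite [`|a - b|]ler0_norm ?[`|_ - 4|]ger0_norm; lra.
have key' : saw (a + b) = - saw (a - b) + 2 * fpl (2 - 8 * a) (2 - 8 * b) by lra.
have {}key : saw (a - b) = - saw (a + b) + 2 * fpl (2 - 8 * a) (2 - 8 * b) by lra.
have e1 : saw (- a - b) = saw (a + b) by rewrite -sawN opprD !opprK.
have e2 : saw (- a + b) = saw (a - b) by rewrite -sawN opprD opprK.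
by case: hs => ->; case: ht => ->; rewrite ?mul1r ?mulN1r ?opprK ?e1 ?e2.
Qed.

(** [genS] sends [(x, y)] to [(y, - x)]: the first two coordinates are exchanged, evenness of [saw]
    forgets the sign, and [x + y] becomes [y - x], which is the Vieta involution. *)
Lemma pillow_genS z : swap12 (vieta (pillow z)) = pillow (lin genS z).
Proof.
case: z => x y; rewrite /pillow /lin !mx2E /= !(mulrN1z, mulr1z, mulr0z).
rewrite !mul0r add0r addr0 mul1r mulN1r sawN.
by congr (_, _, _); rewrite -saw_add_sub -sawN opprB addrC.
Qed.

Lemma pillow_genU z : cyc (pillow z) = pillow (lin genU z).
Proof.
case: z => x y; rewrite /pillow /lin !mx2E /= !(mulrN1z, mulr1z, mulr0z).
rewrite mul0r add0r mul1r !mulN1r -opprD sawN; congr (_, _, _).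
by rewrite -sawN; congr saw; ring.
Qed.

End Pillowcase.

(** * Covering the action by linear maps *)

Section PillowAction.
Context {R : realType}.

Lemma measurable_proj3 :
  [/\ measurable_fun [set: R * R * R] (fun x => x.1.1),
      measurable_fun [set: R * R * R] (fun x => x.1.2) &
      measurable_fun [set: R * R * R] (fun x => x.2)].
Proof.
split; last exact: measurable_snd.
- by apply: (measurableT_comp measurable_fst); exact: measurable_fst.
- by apply: (measurableT_comp measurable_snd); exact: measurable_fst.
Qed.

Lemma measurable_fpl d (T : measurableType d) (f g : T -> R) :
  measurable_fun setT f -> measurable_fun setT g ->
  measurable_fun setT (fun x => fpl (f x) (g x)).
Proof.
move=> mf mg.
have mnf : measurable_fun setT (fun x => - f x) by exact: measurable_funN.
have mng : measurable_fun setT (fun x => - g x) by exact: measurable_funN.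
have maf : measurable_fun setT (fun x => `|f x|) by exact: measurableT_comp.
have mag : measurable_fun setT (fun x => `|g x|) by exact: measurableT_comp.
by rewrite /fpl; do 3 (apply: measurable_fun_ifT => //; first exact: measurable_fun_ler).
Qed.

Lemma measurable_swap_vieta : measurable_fun [set: R * R * R] (@swap12 R \o @vieta R).
Proof.
have [m1 m2 m3] := measurable_proj3.
have -> : @swap12 R \o @vieta R =
    (fun x : R * R * R => (x.1.2, x.1.1, - x.2 + 2 * fpl x.1.1 x.1.2)).
  by apply/funext => -[[u v] w].
apply: measurable_fun_pair; first exact: measurable_fun_pair.
apply: measurable_funD; first exact: measurable_funN.
by apply: measurable_funM => //; exact: measurable_fpl.
Qed.

Lemma measurable_cyc : measurable_fun [set: R * R * R] (@cyc R).
Proof.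
have [m1 m2 m3] := measurable_proj3.
have -> : @cyc R = (fun x : R * R * R => (x.1.2, x.2, x.1.1)).
  by apply/funext => -[[u v] w].
by apply: measurable_fun_pair => //; exact: measurable_fun_pair.
Qed.

(** [act] is known only on two generators conjugated by [P], so both measurability and the covering
    relation are propagated along words in [genS] and [genU]. *)
Lemma conj_action (P : 'M[int]_2) (act : 'M[int]_2 -> R * R * R -> R * R * R) :
  P \in unitmx -> cayley_markov_action P act -> forall M, \det M = 1 ->
  measurable_fun setT (act (P *m M *m invmx P)) /\
  forall z, act (P *m M *m invmx P) (pillow z) = pillow (lin M z).
Proof.
move=> hP [a1 aM aS aU].
have dc M : \det M = 1 -> \det (P *m M *m invmx P) = 1.
  by move=> dM; rewrite !det_mulmx det_inv dM mulr1 mulrV.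
apply: SL2Z_ind => [|||A B dA dB [mA hA] [mB hB]].
- by rewrite mulmx1 mulmxV // a1; split => [|z]; rewrite ?lin_one.
- rewrite aS; split; first exact: measurable_swap_vieta.
  by move=> z; exact: pillow_genS.
- by rewrite aU; split; [exact: measurable_cyc|exact: pillow_genU].
- have -> : P *m (A *m B) *m invmx P =
      (P *m A *m invmx P) *m (P *m B *m invmx P).
    by rewrite !mulmxA mulmxKV.
  rewrite aM ?dc //; split; first exact: measurableT_comp.
  by move=> z; rewrite /= hB hA lin_mul.
Qed.

(** The lift is [P^-1 A P]. Its trace and determinant are those of [A], and the eigenvalues are all
    that the estimates retain of it. *)
Lemma action_lift (P : 'M[int]_2) (act : 'M[int]_2 -> R * R * R -> R * R * R) :
  P \in unitmx -> cayley_markov_action P act -> forall A, \det A = 1 ->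
  exists M, [/\ \det M = 1, \tr M = \tr A, measurable_fun setT (act A) &
    forall z, act A (pillow z) = pillow (lin M z)].
Proof.
move=> hP hact A dA; exists (invmx P *m A *m P).
have dM : \det (invmx P *m A *m P) = 1.
  by rewrite !det_mulmx det_inv dA mulr1 mulVr.
have [] := conj_action hP hact dM.
rewrite !mulmxA mulmxV // mul1mx mulmxK // => mA hA; split => //.
by rewrite mxtrace_mulC mulmxA mulmxV // mul1mx.
Qed.

Lemma iter_pillow (g : R * R * R -> R * R * R) M :
  (forall z, g (pillow z) = pillow (lin M z)) ->
  forall n z, iter n g (pillow z) = pillow (iter n (lin M) z).
Proof. by move=> h n z; elim: n => //= n ->. Qed.

End PillowAction.

(** * Surface area as a multiple of the torus measure *)

Section PillowArea.
Context {R : realType}.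

Notation leb2 := (@lebesgue_measure R \x @lebesgue_measure R)%E.

Notation std := (@std_triangle R).

Lemma measure_eq_off_null d (T : measurableType d) (mu : {measure set T -> \bar R})
    (X Y N : set T) : measurable X -> measurable Y -> measurable N -> mu N = 0%E ->
  X `\` N = Y `\` N -> mu X = mu Y.
Proof.
move=> mX mY mN N0 XY.
have n0 Z : measurable Z -> mu (Z `&` N) = 0%E.
  move=> mZ; apply: (@subset_measure0 _ _ _ mu _ N) => //; exact: measurableI.
by rewrite (measureDI mu mX mN) (measureDI mu mY mN) XY; congr (_ + _)%E; exact: etrans (n0 X mX) (esym (n0 Y mY)).
Qed.

Lemma leb2_split (X Y : set (R * R)) : measurable X -> measurable Y ->
  leb2 X = (leb2 (X `\` Y) + leb2 (X `&` Y))%E.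
Proof. exact: (@measureDI _ _ _ [the measure _ _ of leb2] X Y). Qed.

Lemma leb2_eq_off_null (X Y N : set (R * R)) : measurable X -> measurable Y ->
  measurable N -> leb2 N = 0%E -> X `\` N = Y `\` N -> leb2 X = leb2 Y.
Proof. exact: (@measure_eq_off_null _ _ [the measure _ _ of leb2] X Y N). Qed.

Lemma leb2_null_setU (X Y : set (R * R)) : measurable X -> measurable Y ->
  leb2 X = 0%E -> leb2 Y = 0%E -> leb2 (X `|` Y) = 0%E.
Proof. exact: (@null_set_setU _ _ _ [the measure _ _ of leb2] X Y). Qed.

Lemma measurable_line (a b c : R) : measurable [set z : R * R | a * z.1 + b * z.2 = c].
Proof.
have -> : [set z : R * R | a * z.1 + b * z.2 = c] =
    (fun z => a * z.1 + b * z.2) @^-1` [set c] by [].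
apply: measurable_preimage => //; apply: measurable_funD;
  apply: measurable_funM => //; (exact: measurable_fst || exact: measurable_snd).
Qed.

(** The similarity [(a z.1 + b z.2, - b z.1 + a z.2)], of determinant [a^2 + b^2], carries the line
    to a vertical one. *)
Lemma null_line (a b c : R) : (a, b) != 0 ->
  leb2 [set z : R * R | a * z.1 + b * z.2 = c] = 0%E.
Proof.
move=> ab0.
have D : a * a - b * (- b) != 0.
  rewrite mulrN opprK -!expr2 paddr_eq0 ?sqr_ge0 // !sqrf_eq0.
  by apply: contra ab0 => /andP[/eqP -> /eqP ->].
have [_ /(_ ([set c] `*` setT))] := affine_scales_area 0 0 D.
have -> : (fun z : R * R => (a * z.1 + b * z.2 + 0, - b * z.1 + a * z.2 + 0)) @^-1`
    ([set c] `*` setT) = [set z : R * R | a * z.1 + b * z.2 = c].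
  by apply/seteqP; split => z; rewrite /preimage /= addr0; [case|].
move=> ->; last exact: measurableX.
by rewrite product_measure1E //= lebesgue_measure_set1 mul0e mule0.
Qed.

Definition null_set2 (X : set (R * R)) := measurable X /\ leb2 X = 0%E.

Lemma null_set2U X Y : null_set2 X -> null_set2 Y -> null_set2 (X `|` Y).
Proof.
by move=> [mX X0] [mY Y0]; split; [exact: measurableU|exact: leb2_null_setU].
Qed.

Lemma null_set2_line (a b c : R) : (a != 0) || (b != 0) ->
  null_set2 [set z : R * R | a * z.1 + b * z.2 = c].
Proof.
move=> ab; split; first exact: measurable_line.
by apply: null_line; rewrite xpair_eqE negb_and.
Qed.

Lemma std_triangle_measurable : measurable std.
Proof.
have -> : @std_triangle R = (fst @^-1` `[0, +oo[) `&` (snd @^-1` `[0, +oo[) `&`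
    ((fun p => p.1 + p.2) @^-1` `]-oo, 1]).
  apply/seteqP; split => p; rewrite /std_triangle /= !in_itv /= !andbT.
    by case.
  by case=> -[].
apply: measurableI; first apply: measurableI.
- by apply: measurable_preimage => //; exact: measurable_fst.
- by apply: measurable_preimage => //; exact: measurable_snd.
- apply: measurable_preimage => //; apply: measurable_funD; [exact: measurable_fst|exact: measurable_snd].
Qed.

Definition half_map (a : R * R) (p : R * R) : R * R := (a.1 + p.1 / 2, a.2 + p.2 / 2).

Lemma half_map_scales a : scales_area 4 (half_map a).
Proof.
have D : (2^-1 : R) * 2^-1 - 0 * 0 != 0 by rewrite mul0r subr0 mulf_neq0 ?invr_eq0.
have := affine_scales_area a.1 a.2 D.
have -> : `|2^-1 * 2^-1 - 0 * 0|^-1 = 4 :> R.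
  rewrite mul0r subr0 ger0_norm; last by lra.
  by rewrite -invfM invrK; ring.
congr scales_area; apply/funext => p; rewrite /half_map.
by congr (_, _); ring.
Qed.

Lemma measurable_half_map a E : measurable E -> measurable (half_map a @^-1` E).
Proof. by apply: measurable_preimage; have [] := half_map_scales a. Qed.

(** Four times the area of the part of [E] in the half-size triangle with its right angle at [a]. *)
Definition small_triangle (E : set (R * R)) (a : R * R) : \bar R :=
  leb2 (std `&` half_map a @^-1` E).

(** [face_param] lists the vertices of a face in an order that [pillow] need not respect; an affine
    symmetry of the triangle corrects this without changing areas. *)
Lemma std_triangle_sym (a b c d e f : R) (F : set (R * R)) :
  `|a * d - b * c| = 1 -> measurable F ->
  (forall p, std (a * p.1 + b * p.2 + e, c * p.1 + d * p.2 + f) <->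
             std p) ->
  leb2 (std `&`
    (fun p => (a * p.1 + b * p.2 + e, c * p.1 + d * p.2 + f)) @^-1` F) =
  leb2 (std `&` F).
Proof.
move=> D mF st.
have D0 : a * d - b * c != 0 by rewrite -normr_eq0 D oner_neq0.
have [_ /(_ (std `&` F))] := affine_scales_area e f D0.
rewrite D invr1 mul1e => <-; last by apply: measurableI => //; exact: std_triangle_measurable.
congr (leb2 _); apply/seteqP; split => p [h1 h2]; split => //.
  by rewrite /preimage /=; apply/st.
exact/st.
Qed.

Definition even_set (E : set (R * R)) := forall z, E (- z) <-> E z.

Lemma small_triangle_int E (a b : R * R) (k l : int) : periodic E ->
  b.1 = a.1 + k%:~R -> b.2 = a.2 + l%:~R -> small_triangle E b = small_triangle E a.
Proof.
move=> pE h1 h2; congr (leb2 (_ `&` _)); apply/seteqP; split => p;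
  by rewrite /preimage /half_map /= h1 h2 addrAC [_ + l%:~R + _]addrAC pE.
Qed.

Definition half_square (a : R * R) : set (R * R) :=
  `[a.1, a.1 + 2^-1[ `*` `[a.2, a.2 + 2^-1[.

Definition opposite_corner (a : R * R) : R * R := (a.1 + 2^-1, a.2 + 2^-1).

(** The diagonal cuts the half square into the triangle at [a] and an upper one. The map [z -> - z],
    followed by the translation by [2 a + (1, 1)], which is integral, carries the upper triangle to
    the one at the opposite corner; both maps preserve [E]. *)
Lemma quarter_square E (a : R * R) (k l : int) : measurable E -> periodic E -> even_set E ->
  a.1 + a.1 = k%:~R -> a.2 + a.2 = l%:~R ->
  (4%:E * leb2 (E `&` half_square a) =
   small_triangle E a + small_triangle E (opposite_corner a))%E.
Proof.
move=> mE pE eE ak al.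
have [mh hh] := half_map_scales a.
rewrite -hh; last by apply: measurableI => //; exact: measurableX.
pose F := half_map a @^-1` E.
have mF : measurable F by exact: measurable_half_map.
pose sq : set (R * R) := `[0, 1[ `*` `[0, 1[.
have msq : measurable sq by exact: measurableX.
have -> : half_map a @^-1` (E `&` half_square a) = F `&` sq.
  apply/seteqP; split => p; rewrite /half_square /F /sq /preimage /half_map /= !in_itv /=.
    by move=> [? [/andP[? ?] /andP[? ?]]]; split=> //; split; apply/andP; split; lra.
  by move=> [? [/andP[? ?] /andP[? ?]]]; split=> //; split; apply/andP; split; lra.
have mst := std_triangle_measurable.
rewrite (leb2_split (measurableI _ _ mF msq) mst) addeC; congr (_ + _)%E.
  rewrite /small_triangle -/F.
  (* The triangle is closed and the square half-open, so the two sets agree only off these boundary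
     lines. *)
  pose N := [set z : R * R | 1 * z.1 + 0 * z.2 = 1] `|` [set z : R * R | 0 * z.1 + 1 * z.2 = 1].
  have N0 : null_set2 N.
    by apply: null_set2U; apply: null_set2_line; rewrite oner_neq0 ?orbT.
  apply: (@leb2_eq_off_null _ _ N).
  - by apply: measurableI => //; exact: measurableI.
  - exact: measurableI.
  - exact: N0.1.
  - exact: N0.2.
  apply/seteqP; split => p; rewrite /N /sq /std_triangle /= !in_itv /= !mul1r !mul0r add0r addr0.
    by move=> [[[Fp _] ?] ?].
  move=> [[[p1 p2 p12] Fp] /not_orP[n1 n2]]; split; last by move=> [].
  split => //; split => //.
  split; apply/andP; split => //.
    by rewrite lt_neqAle; apply/andP; split; [exact/eqP|lra].
  by rewrite lt_neqAle; apply/andP; split; [exact/eqP|lra].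
have mG : measurable (half_map (opposite_corner a) @^-1` E) by exact: measurable_half_map.
(* The upper half of the square is compared with the triangle through [p -> (1 - p.1, 1 - p.2)]. *)
have D : (-1 : R) * -1 - 0 * 0 != 0 by rewrite mul0r subr0 mulN1r opprK oner_neq0.
have [_ hr] := affine_scales_area 1 1 D.
have := hr (std `&` half_map (opposite_corner a) @^-1` E) (measurableI _ _ mst mG).
rewrite mul0r subr0 mulN1r opprK normr1 invr1 mul1e /small_triangle => <-.
pose N := [set z : R * R | 1 * z.1 + 0 * z.2 = 0] `|` [set z : R * R | 0 * z.1 + 1 * z.2 = 0]
   `|` [set z : R * R | 1 * z.1 + 1 * z.2 = 1] `|` [set z : R * R | 1 * z.1 + 0 * z.2 = 1]
   `|` [set z : R * R | 0 * z.1 + 1 * z.2 = 1].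
have N0 : null_set2 N.
  by rewrite /N; do !apply: null_set2U; apply: null_set2_line; rewrite oner_neq0 ?orbT.
apply: (@leb2_eq_off_null _ _ N) => //; try apply N0.
- by apply: measurableD => //; exact: measurableI.
- apply: measurable_preimage; last exact: measurableI.
  by have [] := affine_scales_area 1 1 D.
apply/seteqP; split => p; rewrite /N /sq /std_triangle /preimage /= !in_itv /= !mul1r !mul0r !add0r !addr0 !mulN1r.
  move=> [[[Fp [/andP[? ?] /andP[? ?]]] nst] nN]; split => //; split.
    split => /=; [lra|lra|].
    have [//|h] := leP (- p.1 + 1 + (- p.2 + 1)) 1.
    by exfalso; apply: nst; split; lra.
  move: Fp; rewrite /F /half_map /opposite_corner /preimage /= => Fp.
  apply/eE; rewrite -(pE _ _ (k + 1) (l + 1)) !intrD -ak -al mulr1z.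
  by move: Fp; congr (E (_, _)) => /=; field.
move=> [[[/= h1 h2 h3] Fp] nN]; split => //.
have n1 : p.1 < 1.
  rewrite lt_neqAle; apply/andP; split; last lra.
  by apply/eqP => E1; apply: nN; left; right.
have n2 : p.2 < 1.
  rewrite lt_neqAle; apply/andP; split; last lra.
  by apply/eqP => E1; apply: nN; right.
split; last by move=> [g1 g2 g3]; apply: nN; left; left; right; lra.
split; last by split; apply/andP; split; lra.
move: Fp; rewrite /F /half_map /opposite_corner /preimage /= => Fp.
apply/eE; rewrite -(pE _ _ (k + 1) (l + 1)) !intrD -ak -al mulr1z.
by move: Fp; congr (E (_, _)) => /=; field.
Qed.

End PillowArea.

Section AreaPillow.
Context {R : realType}.

Notation leb2 := (@lebesgue_measure R \x @lebesgue_measure R)%E.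
Notation std := (@std_triangle R).

Lemma le_leb2 (X Y : set (R * R)) : measurable X -> measurable Y -> X `<=` Y ->
  (leb2 X <= leb2 Y)%E.
Proof.
move=> mX mY XY.
by apply: (@le_measure _ _ _ [the measure _ _ of leb2]); rewrite ?inE.
Qed.

Lemma leb2_unit_square : leb2 (@unit_square R) = 1%E.
Proof.
rewrite /unit_square product_measure1E //= lebesgue_measure_itv /= lte_fin ltr01.
by rewrite oppr0 adde0 mule1.
Qed.

Lemma leb2_ge0 (X : set (R * R)) : measurable X -> (0 <= leb2 X)%E.
Proof. by move=> mX; apply: (@measure_ge0 _ _ _ [the measure _ _ of leb2]). Qed.

Lemma torus_ge0 E : measurable E -> (0 <= @torus R E)%E.
Proof. by move=> mE; apply: leb2_ge0; apply: measurableI => //; exact: measurable_unit_square. Qed.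

Lemma torus_le1 E : measurable E -> (@torus R E <= 1)%E.
Proof.
move=> mE; rewrite -leb2_unit_square; apply: le_leb2.
- by apply: measurableI => //; exact: measurable_unit_square.
- exact: measurable_unit_square.
- exact: subIsetr.
Qed.

Lemma torus_fin E : measurable E -> @torus R E \is a fin_num.
Proof.
move=> mE; rewrite ge0_fin_numE ?torus_ge0 //.
by apply: le_lt_trans (torus_le1 mE) _; rewrite ltry.
Qed.

Lemma small_triangle_fin E (a : R * R) : measurable E -> small_triangle E a \is a fin_num.
Proof.
move=> mE; have m1 : measurable (std `&` half_map a @^-1` E).
  by apply: measurableI; [exact: std_triangle_measurable|exact: measurable_half_map].
rewrite ge0_fin_numE ?leb2_ge0 //.
have mQ : measurable (`[0, 1]%classic `*` `[0, 1]%classic : set (R * R)) by exact: measurableX.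
apply: (le_lt_trans (le_leb2 m1 mQ _)).
  move=> p [[/= ? ? ?] _]; split; rewrite /= in_itv /=; apply/andP; split; lra.
rewrite product_measure1E //= lebesgue_measure_itv /= lte_fin ltr01.
by rewrite oppr0 adde0 mule1 ltry.
Qed.

Lemma torus_split (E : set (R * R)) : measurable E ->
  torus E = (leb2 (E `&` half_square (0, 0)%R) + leb2 (E `&` half_square (0, 2^-1)%R) +
   leb2 (E `&` half_square (2^-1, 0)%R) + leb2 (E `&` half_square (2^-1, 2^-1)%R))%E.
Proof.
move=> mE; rewrite /torus; set U := E `&` _.
have mU : measurable U by apply: measurableI => //; exact: measurable_unit_square.
pose A := fst @^-1` `]-oo, (2^-1 : R)[ : set (R * R).
pose B := snd @^-1` `]-oo, (2^-1 : R)[ : set (R * R).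
have mA : measurable A by apply: measurable_preimage => //; exact: measurable_fst.
have mB : measurable B by apply: measurable_preimage => //; exact: measurable_snd.
rewrite (leb2_split mU mA) (leb2_split (measurableD mU mA) mB).
rewrite (leb2_split (measurableI _ _ mU mA) mB).
have -> : U `\` A `\` B = E `&` half_square (2^-1, 2^-1)%R.
  apply/seteqP; split => p; rewrite /U /A /B /unit_square /half_square /preimage /= !in_itv /=.
    move=> [[[? [/andP[? ?] /andP[? ?]]] /negP]]; rewrite -leNgt => ? /negP.
    by rewrite -leNgt => ?; split => //; split; apply/andP; split; lra.
  move=> [? [/andP[? ?] /andP[? ?]]]; split; last by apply/negP; rewrite -leNgt.
  split; last by apply/negP; rewrite -leNgt.
  by split => //; split; apply/andP; split; lra.
have -> : (U `\` A) `&` B = E `&` half_square (2^-1, 0)%R.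
  apply/seteqP; split => p; rewrite /U /A /B /unit_square /half_square /preimage /= !in_itv /=.
    move=> [[[? [/andP[? ?] /andP[? ?]]] /negP]]; rewrite -leNgt => ? ?.
    by split => //; split; apply/andP; split; lra.
  move=> [? [/andP[? ?] /andP[? ?]]]; split; last lra.
  split; last by apply/negP; rewrite -leNgt.
  by split => //; split; apply/andP; split; lra.
have -> : (U `&` A) `\` B = E `&` half_square (0, 2^-1)%R.
  apply/seteqP; split => p; rewrite /U /A /B /unit_square /half_square /preimage /= !in_itv /=.
    move=> [[[? [/andP[? ?] /andP[? ?]]] ?] /negP]; rewrite -leNgt => ?.
    by split => //; split; apply/andP; split; lra.
  move=> [? [/andP[? ?] /andP[? ?]]]; split; last by apply/negP; rewrite -leNgt.
  split; last lra.
  by split => //; split; apply/andP; split; lra.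
have -> : (U `&` A) `&` B = E `&` half_square (0, 0)%R.
  apply/seteqP; split => p; rewrite /U /A /B /unit_square /half_square /preimage /= !in_itv /=.
    move=> [[[? [/andP[? ?] /andP[? ?]]] ?] ?].
    by split => //; split; apply/andP; split; lra.
  move=> [? [/andP[? ?] /andP[? ?]]]; split; last lra.
  split; last lra.
  by split => //; split; apply/andP; split; lra.
move: (leb2 _) (leb2 _) (leb2 _) (leb2 _) => a b c d.
by rewrite addeC [(b + a)%E]addeC [(d + c)%E]addeC addeA.
Qed.

Lemma four_quarters (a b c d x y z w : \bar R) :
  a \is a fin_num -> b \is a fin_num -> c \is a fin_num -> d \is a fin_num ->
  x \is a fin_num -> y \is a fin_num -> z \is a fin_num -> w \is a fin_num ->
  (4%:E * a = x + w)%E -> (4%:E * b = y + z)%E -> (4%:E * c = z + y)%E ->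
  (4%:E * d = w + x)%E -> (2%:E * (a + b + c + d) = x + y + z + w)%E.
Proof.
case: a => [a| |] //; case: b => [b| |] //; case: c => [c| |] //; case: d => [d| |] // _ _ _ _.
case: x => [x| |] //; case: y => [y| |] //; case: z => [z| |] //; case: w => [w| |] // _ _ _ _.
rewrite -!EFinD -!EFinM => -[h1] [h2] [h3] [h4]; congr EFin; lra.
Qed.

(** Modulo integers, each of the four corners occurs twice among the eight triangles that make up
    the half squares. So four times the torus measure is twice the sum on the right. *)
Lemma torus_small_triangles (E : set (R * R)) : measurable E -> periodic E -> even_set E ->
  (2%:E * torus E = small_triangle E (0, 0)%R + small_triangle E (0, 2^-1)%R +
   small_triangle E (2^-1, 0)%R + small_triangle E (2^-1, 2^-1)%R)%E.
Proof.
move=> mE pE eE.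
have fin4 (a : R * R) : leb2 (E `&` half_square a) \is a fin_num.
  have mh : measurable (E `&` half_square a) by apply: measurableI => //; exact: measurableX.
  rewrite ge0_fin_numE ?leb2_ge0 //.
  have mQ : measurable (half_square a) by exact: measurableX.
  apply: (le_lt_trans (le_leb2 mh mQ _)); first exact: subIsetr.
  rewrite /half_square product_measure1E //= !lebesgue_measure_itv /= !lte_fin.
  by rewrite !ltrDl invr_gt0 ltr0n -!EFinB -EFinM ltry.
have half : (2^-1 + 2^-1 : R) = 1%:~R by rewrite mulr1z; lra.
have zero : (0 + 0 : R) = 0%:~R by rewrite mulr0z addr0.
have q00 := @quarter_square _ E (0, 0) _ _ mE pE eE zero zero.
have q01 := @quarter_square _ E (0, 2^-1) _ _ mE pE eE zero half.
have q10 := @quarter_square _ E (2^-1, 0) _ _ mE pE eE half zero.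
have q11 := @quarter_square _ E (2^-1, 2^-1) _ _ mE pE eE half half.
have o00 : opposite_corner (0, 0) = (2^-1, 2^-1) :> R * R by rewrite /opposite_corner /= !add0r.
have o01 : small_triangle E (opposite_corner (0, 2^-1)) = small_triangle E (2^-1, 0)%R.
  by clear - mE pE; apply: (@small_triangle_int _ _ _ _ 0 1) => //=; rewrite ?mulr0z ?mulr1z; lra.
have o10 : small_triangle E (opposite_corner (2^-1, 0)) = small_triangle E (0, 2^-1)%R.
  by clear - mE pE; apply: (@small_triangle_int _ _ _ _ 1 0) => //=; rewrite ?mulr0z ?mulr1z; lra.
have o11 : small_triangle E (opposite_corner (2^-1, 2^-1)) = small_triangle E (0, 0)%R.
  by clear - mE pE; apply: (@small_triangle_int _ _ _ _ 1 1) => //=; rewrite ?mulr0z ?mulr1z; lra.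
rewrite o00 in q00; rewrite o01 in q01; rewrite o10 in q10; rewrite o11 in q11.
rewrite (torus_split mE).
exact: (four_quarters (fin4 _) (fin4 _) (fin4 _) (fin4 _) (small_triangle_fin _ mE)
  (small_triangle_fin _ mE) (small_triangle_fin _ mE) (small_triangle_fin _ mE) q00 q01 q10 q11).
Qed.

(** A copy of [vtx] on natural numbers, where [bump i j] reduces for concrete [i] and [j]. *)
Definition vtx_nat (n : nat) : R * R * R :=
  nth (0, 0, 0) [:: (2, 2, 2); (2, -2, -2); (-2, 2, -2); (-2, -2, 2)] n.

Lemma edgeE (i : 'I_4) : ((edge R i (inord 1) = vtx_nat (bump i 1) - vtx_nat (bump i 0)) *
  (edge R i (inord 2) = vtx_nat (bump i 2) - vtx_nat (bump i 0)))%type.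
Proof. by rewrite /edge /vtx /vtx_nat /= !inordK. Qed.

Lemma face_paramE (i : 'I_4) (p : R * R) : face_param i p =
  vtx_nat (bump i 0) + p.1 *: (vtx_nat (bump i 1) - vtx_nat (bump i 0))
  + p.2 *: (vtx_nat (bump i 2) - vtx_nat (bump i 0)).
Proof. by rewrite /face_param !edgeE. Qed.

(** The cross product of two edges of a face has all its coordinates equal to [16] or [-16], so this
    is twice the area of a face. *)
Definition face_area : R := Num.sqrt (16 ^+ 2 + 16 ^+ 2 + 16 ^+ 2).

Lemma face_area_gt0 : 0 < face_area.
Proof. by rewrite sqrtr_gt0; rewrite !addr_gt0 // exprn_gt0. Qed.

Lemma ord4P (Q : 'I_4 -> Prop) : Q (Ordinal (isT : (0 < 4)%N)) ->
  Q (Ordinal (isT : (1 < 4)%N)) -> Q (Ordinal (isT : (2 < 4)%N)) ->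
  Q (Ordinal (isT : (3 < 4)%N)) -> forall i, Q i.
Proof.
move=> h0 h1 h2 h3 [[|[|[|[|//]]]] hi].
- by rewrite (_ : Ordinal hi = Ordinal (isT : (0 < 4)%N)) //; exact: val_inj.
- by rewrite (_ : Ordinal hi = Ordinal (isT : (1 < 4)%N)) //; exact: val_inj.
- by rewrite (_ : Ordinal hi = Ordinal (isT : (2 < 4)%N)) //; exact: val_inj.
- by rewrite (_ : Ordinal hi = Ordinal (isT : (3 < 4)%N)) //; exact: val_inj.
Qed.

Lemma enorm_face (i : 'I_4) :
  enorm (cross (edge R i (inord 1)) (edge R i (inord 2))) = face_area.
Proof.
rewrite !edgeE /enorm /face_area; congr Num.sqrt.
by elim/ord4P: i; rewrite /cross /vtx_nat /=; ring.
Qed.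

End AreaPillow.

Section AreaFormula.
Context {R : realType}.

Notation leb2 := (@lebesgue_measure R \x @lebesgue_measure R)%E.
Notation std := (@std_triangle R).

Lemma saw_half_up (t : R) : 2^-1 <= t <= 1 -> saw t = 8 * t - 6.
Proof.
by move=> /andP[h1 h2]; rewrite saw01 ?ger0_norm; try (by lra); apply/andP; split; lra.
Qed.

Lemma saw_one_sub (t : R) : saw (1 - t) = saw t.
Proof. by rewrite -sawN opprB -(saw_int t (-1)) mulrN1z. Qed.

Lemma saw_add_one (t : R) : saw (1 + t) = saw t.
Proof. by rewrite -(saw_int t 1) mulr1z addrC. Qed.

Lemma face_term (i : 'I_4) (a : R * R) (m1 m2 m3 m4 m5 m6 : R) (B : set (R * R * R)) :
  measurable B -> `|m1 * m4 - m2 * m3| = 1 ->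
  (forall p, std (m1 * p.1 + m2 * p.2 + m5, m3 * p.1 + m4 * p.2 + m6) <-> std p) ->
  (forall p, std p -> face_param i p =
     pillow (half_map a (m1 * p.1 + m2 * p.2 + m5, m3 * p.1 + m4 * p.2 + m6))) ->
  ((enorm (cross (edge R i (inord 1)) (edge R i (inord 2))))%:E *
     leb2 (std `&` face_param i @^-1` B))%E =
  ((@face_area R)%:E * small_triangle (pillow @^-1` B) a)%E.
Proof.
move=> mB D st hf; rewrite enorm_face; congr (_ * _)%E.
have mE := measurable_half_map a (measurable_pillow_preimage mB).
rewrite /small_triangle -(std_triangle_sym D mE st).
congr (leb2 _); apply/seteqP; split => p [h1 h2]; split => //.
  by move: h2; rewrite /preimage /= hf.
by move: h2; rewrite /preimage /= hf.
Qed.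

(** [pillow] maps the four half-size triangles, with right angles at the half-integral corners,
    affinely onto the four faces. The coefficients here and in the next three lemmas permute the
    vertices of the triangle so that both parametrizations agree. *)
Lemma face_pillow0 (p : R * R) : std p -> face_param (Ordinal (isT : (0 < 4)%N)) p =
  pillow (half_map (2^-1, 2^-1) (-1 * p.1 + -1 * p.2 + 1, 1 * p.1 + 0 * p.2 + 0)).
Proof.
move=> [h1 h2 h3]; rewrite face_paramE /vtx_nat /pillow /half_map /=.
rewrite [saw (2^-1 + (-1 * _ + _ + _) / 2)]saw_half_up; last by apply/andP; split; lra.
rewrite [saw (2^-1 + (1 * _ + _ + _) / 2)]saw_half_up; last by apply/andP; split; lra.
rewrite [X in saw X](_ : _ = 1 + (1 - p.2) / 2); last by field.
rewrite saw_add_one saw_half; last by apply/andP; split; lra.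
by rewrite /GRing.scale /=; congr (_, _, _) => /=; rewrite /GRing.scale /=; field.
Qed.

Lemma face_pillow1 (p : R * R) : std p -> face_param (Ordinal (isT : (1 < 4)%N)) p =
  pillow (half_map (2^-1, 0) (-1 * p.1 + -1 * p.2 + 1, 0 * p.1 + 1 * p.2 + 0)).
Proof.
move=> [h1 h2 h3]; rewrite face_paramE /vtx_nat /pillow /half_map /=.
rewrite [saw (2^-1 + (-1 * _ + _ + _) / 2)]saw_half_up; last by apply/andP; split; lra.
rewrite [saw (0 + _)]saw_half; last by apply/andP; split; lra.
rewrite [X in saw X](_ : _ = 1 - p.1 / 2); last by field.
rewrite saw_one_sub saw_half; last by apply/andP; split; lra.
by rewrite /GRing.scale /=; congr (_, _, _) => /=; rewrite /GRing.scale /=; field.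
Qed.

Lemma face_pillow2 (p : R * R) : std p -> face_param (Ordinal (isT : (2 < 4)%N)) p =
  pillow (half_map (0, 2^-1) (0 * p.1 + 1 * p.2 + 0, -1 * p.1 + -1 * p.2 + 1)).
Proof.
move=> [h1 h2 h3]; rewrite face_paramE /vtx_nat /pillow /half_map /=.
rewrite [saw (2^-1 + _)]saw_half_up; last by apply/andP; split; lra.
rewrite [saw (0 + (0 * _ + _ + _) / 2)]saw_half; last by apply/andP; split; lra.
rewrite [X in saw X](_ : _ = 1 - p.1 / 2); last by field.
rewrite saw_one_sub saw_half; last by apply/andP; split; lra.
by rewrite /GRing.scale /=; congr (_, _, _) => /=; rewrite /GRing.scale /=; field.
Qed.

Lemma face_pillow3 (p : R * R) : std p -> face_param (Ordinal (isT : (3 < 4)%N)) p =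
  pillow (half_map (0, 0) (0 * p.1 + 1 * p.2 + 0, 1 * p.1 + 0 * p.2 + 0)).
Proof.
move=> [h1 h2 h3]; rewrite face_paramE /vtx_nat /pillow /half_map /=.
rewrite !saw_half; try by apply/andP; split; lra.
by rewrite /GRing.scale /=; congr (_, _, _) => /=; rewrite /GRing.scale /=; field.
Qed.

Lemma sum4 (F : 'I_4 -> \bar R) : (\sum_(i < 4) F i =
  F (Ordinal (isT : (0 < 4)%N)) + F (Ordinal (isT : (1 < 4)%N)) +
  F (Ordinal (isT : (2 < 4)%N)) + F (Ordinal (isT : (3 < 4)%N)))%E.
Proof.
rewrite !big_ord_recl big_ord0 adde0 !addeA.
by congr (_ + _ + _ + _)%E; congr F; exact: val_inj.
Qed.

(** Each face corresponds to one of the four small triangles. The constant [2 * face_area] is the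
    total area of the four faces. *)
Lemma area_pillow (B : set (R * R * R)) : measurable B ->
  area B = ((2 * @face_area R)%:E * torus (pillow @^-1` B))%E.
Proof.
move=> mB; pose E := pillow @^-1` B.
have mE : measurable E := measurable_pillow_preimage mB.
have eE : even_set E by move=> z; rewrite /E /preimage /= pillowN.
have hT := torus_small_triangles mE (@periodic_pillow _ B) eE.
have -> : ((2 * @face_area R)%:E * torus E = (@face_area R)%:E * (2%:E * torus E))%E.
  by rewrite muleA -EFinM [2 * _]mulrC.
rewrite hT.
have D1 : `|-1 * 0 - -1 * 1| = 1 :> R by rewrite (_ : _ - _ = 1) ?normr1 //; ring.
have D2 : `|-1 * 1 - -1 * 0| = 1 :> R by rewrite (_ : _ - _ = -1) ?normrN ?normr1 //; ring.
have D3 : `|0 * -1 - 1 * -1| = 1 :> R by rewrite (_ : _ - _ = 1) ?normr1 //; ring.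
have D4 : `|0 * 0 - 1 * 1| = 1 :> R by rewrite (_ : _ - _ = -1) ?normrN ?normr1 //; ring.
have t0 := @face_term _ _ _ _ _ _ _ _ B mB D1 _ face_pillow0.
have t1 := @face_term _ _ _ _ _ _ _ _ B mB D2 _ face_pillow1.
have t2 := @face_term _ _ _ _ _ _ _ _ B mB D3 _ face_pillow2.
have t3 := @face_term _ _ _ _ _ _ _ _ B mB D4 _ face_pillow3.
rewrite [LHS]sum4 t0 ?t1 ?t2 ?t3; try (by clear; move=> p; split => -[/= h1 h2 h3]; split => /=; lra).
have f (a : R * R) := small_triangle_fin a mE; rewrite -/E.
move: (f (0, 0)) (f (0, 2^-1)) (f (2^-1, 0)) (f (2^-1, 2^-1)).
move: (small_triangle E (0, 0)) (small_triangle E (0, 2^-1))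
  (small_triangle E (2^-1, 0)) (small_triangle E (2^-1, 2^-1)) => a b c d.
case: a => [a| |] //; case: b => [b| |] //; case: c => [c| |] //; case: d => [d| |] // _ _ _ _.
change ((face_area * d + face_area * c + face_area * b + face_area * a)%:E =
  (@face_area R * (a + b + c + d))%:E).
by congr EFin; ring.
Qed.

(** After folding both coordinates only [saw (a + b)] and [saw (a - b)] can occur in third place.
    Comparing [a + b] with [1/2], respectively [a] with [b], selects the linear form that takes the
    value [2]. *)
Lemma surface_pillow (z : R * R) : surfaceT (pillow z).
Proof.
suff H (a b : R) : 0 <= a <= 2^-1 -> 0 <= b <= 2^-1 -> forall w,
    w = saw (a + b) \/ w = saw (a - b) -> surfaceT (2 - 8 * a, 2 - 8 * b, w).
  case: z => x y; rewrite /pillow /=.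
  have [a [s [k [ha hs ->]]]] := fold_decomp x.
  have [b [t [l [hb ht ->]]]] := fold_decomp y.
  rewrite !saw_fold // addrACA -intrD saw_int; apply: H => //.
  by case: hs => ->; case: ht => ->; rewrite ?mul1r ?mulN1r ?opprK -?opprD ?sawN;
    [left|right|right; rewrite -sawN opprD opprK|left].
move=> /andP[a0 a1] /andP[b0 b1] w hw; rewrite /surfaceT /=.
have mx (u v x y : R) : u <= 2 -> v <= 2 -> x <= 2 -> y <= 2 ->
  [\/ u = 2, v = 2, x = 2 | y = 2] -> Num.max (Num.max u v) (Num.max x y) = 2.
  move=> h1 h2 h3 h4 h; apply/eqP; rewrite eq_le !ge_max h1 h2 h3 h4 /=.
  by rewrite !le_max; case: h => ->; rewrite lexx ?orbT.
case: hw => ->.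
  have [h|h] := leP (a + b) 2^-1.
    rewrite saw_half; last by apply/andP; split; lra.
    by apply: mx; try lra; apply: Or44; lra.
  rewrite saw_half_up; last by apply/andP; split; lra.
  by apply: mx; try lra; apply: Or41; lra.
have [h|h] := leP b a.
  rewrite saw_half; last by apply/andP; split; lra.
  by apply: mx; try lra; apply: Or42; lra.
rewrite -sawN opprB saw_half; last by apply/andP; split; lra.
by apply: mx; try lra; apply: Or43; lra.
Qed.

Lemma measurable_surface : measurable (@surfaceT R).
Proof.
have [m1 m2 m3] := @measurable_proj3 R.
pose f (x : R * R * R) := Num.max (Num.max (- x.1.1 - x.1.2 - x.2) (- x.1.1 + x.1.2 + x.2))
             (Num.max (x.1.1 - x.1.2 + x.2) (x.1.1 + x.1.2 - x.2)).
have -> : @surfaceT R = f @^-1` [set 2].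
  by apply/seteqP; split => -[[u v] w].
apply: measurable_preimage => //.
have n1 := measurable_funN m1.
apply: measurable_maxr; apply: measurable_maxr;
  do ?[apply: measurable_funB => //|apply: measurable_funD => //].
Qed.

Lemma torusT : torus (@setT (R * R)) = 1%E.
Proof. by rewrite /torus setTI leb2_unit_square. Qed.

Lemma normalized_areaE (B : set (R * R * R)) : measurable B ->
  normalized_area B = torus (pillow @^-1` B).
Proof.
move=> mB; rewrite /normalized_area !area_pillow //; last exact: measurable_surface.
have -> : pillow @^-1` (@surfaceT R) = setT.
  by apply/seteqP; split => z // _; exact: surface_pillow.
rewrite torusT mule1 /= muleC muleA -EFinM mulVf ?mul1e //.
by rewrite mulf_neq0 // gt_eqF // face_area_gt0.
Qed.

Lemma area_eq0 (B : set (R * R * R)) : measurable B ->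
  torus (pillow @^-1` B) = 0%E -> area B = 0%E.
Proof. by move=> mB B0; rewrite area_pillow // B0 mule0. Qed.

End AreaFormula.

(** * Approximation of measurable sets by separated sets *)

Section Separation.
Context {R : realType}.
Notation T := (R * R * R)%type.
Variable mu : {measure set T -> \bar R}.
Hypothesis mu_fin : (mu setT < +oo)%E.

(** Plays the part of inner regularity: instead of compact subsets, two measurable sets at distance
    at least [dl] exhaust the set and its complement up to measure [e]. *)
Definition separable_set (A : set T) := forall e : R, 0 < e ->
  exists F F' : set T, exists2 dl : R, 0 < dl &
  [/\ measurable F /\ measurable F', F `<=` A /\ F' `<=` ~` A,
      forall x y, F x -> F' y -> dl <= `|x - y| &
      (mu (~` (F `|` F')) <= e%:E)%E].

Lemma separable_setC A : separable_set A -> separable_set (~` A).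
Proof.
move=> hA e e0; have [F [F' [dl dl0 [[mF mF'] [FA FA'] h m]]]] := hA e e0.
exists F', F, dl => //; split => //.
- by split => //; rewrite setCK.
- by move=> x y Fx Fy; rewrite distrC; exact: h.
- by rewrite setUC.
Qed.

Lemma separable_set0 : separable_set set0.
Proof.
move=> e e0; exists set0, setT, 1 => //; split => //.
- by split => //; rewrite setC0.
- by rewrite set0U setCT measure0 lee_fin ltW.
Qed.

Lemma mu_fin_lt A : measurable A -> (mu A < +oo)%E.
Proof. by move=> mA; apply: le_lt_trans mu_fin; apply: le_measure; rewrite ?inE. Qed.

Lemma small_tail (F : (set T)^nat) (e : R) : (forall n, measurable (F n)) -> 0 < e ->
  exists N, (mu (\bigcup_n F n `\` \big[setU/set0]_(n < N) F n) <= e%:E)%E.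
Proof.
move=> mF e0.
pose D N := \bigcup_n F n `\` \big[setU/set0]_(n < N) F n.
have mD N : measurable (D N).
  by apply: measurableD; [exact: bigcup_measurable|exact: bigsetU_measurable].
have D0 : \bigcap_N D N = set0.
  apply/seteqP; split => // x /= h.
  have [[n _ Fnx] _] := h 0%N I.
  have [_] := h n.+1 I; apply.
  by rewrite -bigcup_mkord; exists n => //=.
have : (mu \o D) N @[N --> \oo] --> mu (\bigcap_N D N).
  apply: nonincreasing_cvg_mu => //; first exact: mu_fin_lt.
  - by apply: bigcapT_measurable.
  - move=> m n mn; apply/subsetPset => x [h1 h2]; split => //; apply: contra_not h2.
    rewrite -!bigcup_mkord => -[i /= im Fi]; exists i => //=.
    exact: leq_trans im mn.
rewrite D0 measure0 => /fine_cvgP[fD /cvgrPdist_lt /(_ e e0)] hD.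
near \oo => N; exists N.
have f : mu (D N) \is a fin_num by near: N; exact: fD.
rewrite -/(D N) -(fineK f) lee_fin ltW //.
have : `|0 - fine (mu (D N))| < e by near: N; exact: hD.
by rewrite sub0r normrN; apply: le_lt_trans; exact: ler_norm.
Unshelve. all: by end_near. Qed.

(** Half of [e] is spread over the [n]-th approximations. The other half pays for truncating the
    union of the inner sets at [N], after which only finitely many distances matter and their
    minimum is positive; the outer set is the intersection of all the [F' n]. *)
Lemma separable_bigcup (A : (set T)^nat) :
  (forall n, separable_set (A n)) -> separable_set (\bigcup_n A n).
Proof.
move=> hA e e0.
have e2 (n : nat) : 0 < e / 2 / (2 ^ n.+1)%:R.
  by rewrite !divr_gt0 // ltr0n expn_gt0.
have /choice[F hF] n := hA n _ (e2 n).
have /choice[F' hF'] := hF.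
have /choice[dl h] : forall n, exists dl : R, 0 < dl /\
    [/\ measurable (F n) /\ measurable (F' n), F n `<=` A n /\ F' n `<=` ~` A n,
      forall x y, F n x -> F' n y -> dl <= `|x - y| &
      (mu (~` (F n `|` F' n)) <= (e / 2 / (2 ^ n.+1)%:R)%:E)%E].
  by move=> n; have [d ? ?] := hF' n; exists d.
have mF n : measurable (F n) by have [_ [[]]] := h n.
have mF' n : measurable (F' n) by have [_ [[]]] := h n.
have e20 : 0 < e / 2 by rewrite divr_gt0.
have [N hN] := small_tail mF e20.
have [d d0 hd] : exists2 d : R, 0 < d & forall n, (n < N)%N -> d <= dl n.
  elim: N {hN} => [|N [d d0 hd]]; first by exists 1.
  exists (Num.min d (dl N)); first by rewrite lt_min d0 /=; have [] := h N.
  move=> n; rewrite ltnS leq_eqVlt => /predU1P[->|nN]; first by rewrite ge_min lexx orbT.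
  by rewrite ge_min hd.
have mU : measurable (\big[setU/set0]_(n < N) F n) by exact: bigsetU_measurable.
have mI : measurable (\bigcap_n F' n) by exact: bigcapT_measurable.
exists (\big[setU/set0]_(n < N) F n), (\bigcap_n F' n), d => //; split => //.
- split.
    rewrite -bigcup_mkord => x [n /= _ Fnx]; exists n => //.
    by have [_ [_ [s _] _ _]] := h n; exact: s.
  move=> x hx [n _ Anx]; have [_ [_ [_ s] _ _]] := h n.
  by have := s x (hx n I).
- move=> x y; rewrite -bigcup_mkord => -[n /= nN Fnx] F'y.
  apply: le_trans (hd n nN) _; have [_ [_ _ s _]] := h n; exact: s (F'y n I).
pose X n := ~` (F n `|` F' n).
have mX n : measurable (X n) by apply: measurableC; exact: measurableU.
pose Y := \bigcup_n F n `\` \big[setU/set0]_(n < N) F n.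
have mY : measurable Y by apply: measurableD => //; exact: bigcup_measurable.
have sub : ~` (\big[setU/set0]_(n < N) F n `|` \bigcap_n F' n) `<=` \bigcup_n X n `|` Y.
  move=> x /= /not_orP[h1 h2].
  have [hU|hU] := pselect ((\bigcup_n F n) x); first by right.
  left; apply: contrapT => hX; apply: h2 => n _.
  apply: contrapT => hn; apply: hX; exists n => //= -[Fn|//].
  by apply: hU; exists n.
have mXX : measurable (\bigcup_n X n) by exact: bigcup_measurable.
apply: (@le_trans _ _ (mu (\bigcup_n X n `|` Y))).
  by apply: le_measure; rewrite ?inE //; [apply: measurableC; exact: measurableU|exact: measurableU].
apply: (le_trans (measureU2 mu mXX mY)).
have -> : e%:E = ((e / 2)%:E + (e / 2)%:E)%E by rewrite -EFinD -splitr.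
apply: leeD => //.
apply: (le_trans (measure_sigma_subadditive mu mX mXX (fun x hx => hx))).
apply: le_trans (epsilon_trick0 xpredT (ltW e20)).
by apply: lee_nneseries => // n _; have [_ [_ _ _ s]] := h n.
Qed.

(** The strip where [f] lies strictly between [a - 1/(N+1)] and [a] shrinks to the empty set, and
    the Lipschitz bound makes its width a lower bound for the distance between the two sides. *)
Lemma separable_halfspace (f : T -> R) (a : R) : measurable_fun setT f ->
  (forall x y, `|f x - f y| <= `|x - y|) -> separable_set (f @^-1` `]-oo, a[).
Proof.
move=> mf lf e e0.
pose D n := f @^-1` `]a - n.+1%:R^-1, a[.
have mD n : measurable (D n) by exact: measurable_preimage.
have D0 : \bigcap_N D N = set0.
  apply/seteqP; split => // x /= h.
  have := h 0%N I; rewrite /D /preimage /= in_itv /= => /andP[_ fxa].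
  have : 0 < a - f x by rewrite subr_gt0.
  move=> /ltr_add_invr[n]; rewrite add0r => hn.
  have := h n I; rewrite /D /preimage /= in_itv /= => /andP[+ _].
  by rewrite ltrBlDl -ltrBlDr; move=> /(lt_trans hn); rewrite ltxx.
have : (mu \o D) N @[N --> \oo] --> mu (\bigcap_N D N).
  apply: nonincreasing_cvg_mu => //; first exact: mu_fin_lt.
  - by apply: bigcapT_measurable.
  - move=> m n mn; apply/subsetPset => x; rewrite /D /preimage /= !in_itv /= => /andP[h1 ->].
    rewrite andbT; apply: le_lt_trans h1; rewrite lerB // lef_pV2 ?posrE ?ltr0n //.
    by rewrite ler_nat.
rewrite D0 measure0 => /fine_cvgP[fD /cvgrPdist_lt /(_ e e0)] hD.
near \oo => N.
have f1 : mu (D N) \is a fin_num by near: N; exact: fD.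
have f2 : `|0 - fine (mu (D N))| < e by near: N; exact: hD.
exists (f @^-1` `]-oo, a - N.+1%:R^-1]), (f @^-1` `[a, +oo[), (N.+1%:R^-1) => //; split.
- by split; exact: measurable_preimage.
- split => x; rewrite /preimage /= !in_itv /=.
    by move=> h; apply: le_lt_trans h _; rewrite ltrBlDr ltrDl.
  by rewrite andbT => h; rewrite ltNge h.
- move=> x y; rewrite /preimage /= !in_itv /= andbT => h1 h2.
  apply: le_trans (lf x y); rewrite distrC.
  by apply: le_trans (ler_norm _); rewrite lerBrDl; apply: le_trans h2; rewrite -lerBrDr.
- have -> : ~` (f @^-1` `]-oo, a - N.+1%:R^-1] `|` f @^-1` `[a, +oo[) = D N.
    apply/seteqP; split => x; rewrite /D /preimage /= !in_itv /= andbT.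
      by move=> /not_orP[/negP h1 /negP h2]; rewrite !ltNge h1 h2.
    by move=> /andP[h1 h2] [h|h]; [move: h1|move: h2]; rewrite ltNge h.
  rewrite -(fineK f1) lee_fin ltW //.
  by apply: le_lt_trans f2; rewrite sub0r normrN ler_norm.
Unshelve. all: by end_near. Qed.

Lemma separable_sigma_algebra : sigma_algebra setT separable_set.
Proof.
split; first exact: separable_set0.
- by move=> A hA; rewrite setTD; exact: separable_setC.
- exact: separable_bigcup.
Qed.

(** On a copy of the space carrying the separable sets as its sigma-algebra, the coordinates are
    measurable because half-spaces are separable. Hence so is the identity map to the space with its
    usual sigma-algebra. *)
Lemma separable_measurable A : measurable A -> separable_set A.
Proof.
move=> mA.
pose T' := g_sigma_algebraType separable_set.
have coord (f : T -> R) : measurable_fun setT f ->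
    (forall x y, `|f x - f y| <= `|x - y|) ->
    measurable_fun setT (f : T' -> R).
  move=> mf lf; apply: (measurability (@RGenInftyO.G R)); first exact: RGenInftyO.measurableE.
  move=> _ [_ [x ->] <-]; rewrite setTI.
  by apply: sub_sigma_algebra; exact: separable_halfspace.
have [m1 m2 m3] := @measurable_proj3 R.
have c1 := coord _ m1; have c2 := coord _ m2; have c3 := coord _ m3.
have mid : measurable_fun setT (fun x : T' => (x.1.1, x.1.2, x.2) : T).
  apply: measurable_fun_pair; first apply: measurable_fun_pair.
  - by apply: c1 => x y; rewrite !prod_normE !le_max lexx.
  - by apply: c2 => x y; rewrite !prod_normE !le_max lexx orbT.
  - by apply: c3 => x y; rewrite !prod_normE !le_max lexx orbT.
have := measurable_preimage mid mA.
have -> : (fun x : T' => (x.1.1, x.1.2, x.2) : T) @^-1` A = A.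
  by apply/seteqP; split => -[[u v] w].
rewrite /measurable /= sigma_algebra_id //; exact: separable_sigma_algebra.
Qed.

(** A Lusin theorem for finite labellings: off a set of small measure the labelling is uniformly
    locally constant. The labels are separated from the rest one after the other, each at the cost
    of [e / k]. *)
Lemma labelling_uniform k (p : T -> 'I_k) (e : R) : measurable_labelling p -> 0 < e ->
  exists G : set T, exists2 dl : R, 0 < dl &
  [/\ measurable G, (mu (~` G) <= e%:E)%E &
      forall x y, G x -> G y -> `|x - y| < dl -> p x = p y].
Proof.
move=> mp e0.
have key (ep : R) : 0 < ep -> forall n, (n <= k)%N -> exists G : set T, exists2 dl : R, 0 < dl &
  [/\ measurable G, (mu (~` G) <= (ep *+ n)%:E)%E &
      forall x y, G x -> G y -> `|x - y| < dl -> (p x < n)%N -> p x = p y].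
  move=> ep0; elim=> [_|n IH nk].
    exists setT, 1 => //; split => //.
    by rewrite setCT measure0 mulr0n.
  have [G [dl dl0 [mG hG sG]]] := IH (ltnW nk).
  have [F [F' [d d0 [[mF mF'] [FA FA'] h m]]]] :=
    separable_measurable (mp (Ordinal nk)) ep0.
  exists (G `&` (F `|` F')), (Num.min dl d); first by rewrite lt_min dl0.
  have mFF : measurable (F `|` F') by exact: measurableU.
  split; first exact: measurableI.
    rewrite setCI mulrSr EFinD.
    apply: le_trans (measureU2 mu (measurableC mG) (measurableC mFF)) _.
    exact: leeD.
  move=> x y [Gx Fx] [Gy Fy]; rewrite lt_min => /andP[h1 h2].
  rewrite ltnS leq_eqVlt => /predU1P[pxn|]; last exact: sG.
  have px : p x = Ordinal nk by exact: val_inj.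
  have {}Fx : F x by case: Fx => // /FA' /=; rewrite px.
  case: Fy => [/FA /= ->//|F'y].
  by have := h x y Fx F'y; rewrite leNgt h2.
have [k0|k0] := posnP k.
  exists setT, 1 => //; split => //; first by rewrite setCT measure0 lee_fin ltW.
  by move=> x; exfalso; case: (p x) => m; rewrite k0.
have ek : 0 < e / k%:R by rewrite divr_gt0 // ltr0n.
have [G [dl dl0 [mG hG sG]]] := key _ ek k (leqnn k).
exists G, dl => //; split => //.
- by move: hG; rewrite -[e / _ *+ _]mulr_natr divfK // pnatr_eq0 -lt0n.
- by move=> x y Gx Gy h; apply: sG.
Qed.

End Separation.

(** * Eigenvectors and the growth of iterates *)

Section Eigenvectors.
Context {R : realType}.

Definition form (eta z : R * R) : R := eta.1 * z.1 + eta.2 * z.2.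

Lemma formZ eta (c : R) z : form eta (c *: z) = c * form eta z.
Proof. by rewrite /form /= /GRing.scale /=; ring. Qed.

Lemma formB eta z t : form eta (z - t) = form eta z - form eta t.
Proof. by rewrite /form /=; ring. Qed.

(* [M - l^-1] has rank at most one: it is [theta] times the row [eta], and by
   Cayley-Hamilton these are eigenvectors of [M] for [l]. *)
Lemma eigen_decomp (M : 'M[int]_2) (l l' : R) : \det M = 1 ->
  l * l' = 1 -> l + l' = (\tr M)%:~R ->
  exists eta theta : R * R, [/\ eta != 0,
    forall z, form eta (lin M z) = l * form eta z,
    forall z, lin M z = l' *: z + form eta z *: theta & lin M theta = l *: theta].
Proof.
move=> dM ll tM; pose p : R := (M 0 0)%:~R; pose q : R := (M 0 1)%:~R.
pose r : R := (M 1 0)%:~R; pose s : R := (M 1 1)%:~R.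
have D : p * s - q * r = 1.
  by rewrite /p /q /r /s -!intrM -intrB -det2 dM mulr1z.
have pE : p = l + l' - s by rewrite tM tr2 intrD -/p -/s; ring.
have qr : q * r = p * s - l * l' by rewrite ll; lra.
have A1 : r * p + (s - l') * r = l * r by rewrite pE; ring.
have A2 : r * q + (s - l') * s = l * (s - l') by rewrite [r * q]mulrC qr pE; ring.
have A3 : (p - l') * (s - l') = q * r by rewrite qr pE; ring.
have A4 : (p - l') * p + q * r = l * (p - l') by rewrite qr pE; ring.
have A5 : (p - l') * q + q * s = l * q by rewrite pE; ring.
have pw (a b c d : R) : a = c -> b = d -> (a, b) = (c, d) by move=> -> ->.
have [r0|r0] := eqVneq r 0; last first.
  exists (r, s - l'), ((p - l') / r, 1); split.
  - by apply: contra r0 => /eqP[-> _].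
  - move=> z; rewrite /form /lin /= -/p -/q -/r -/s.
    transitivity ((r * p + (s - l') * r) * z.1 + (r * q + (s - l') * s) * z.2); first by ring.
    by rewrite A1 A2; ring.
  - move=> [x y]; rewrite /form /lin /= -/p -/q -/r -/s.
    apply: pw; rewrite /= /GRing.scale /=; last by ring.
    rewrite (_ : _ * ((p - l') / r) = (p - l') * x + ((p - l') * (s - l') / r) * y); last by field.
    by rewrite A3; field.
  - rewrite /lin /= -/p -/q -/r -/s; apply: pw; rewrite /= /GRing.scale /=; last first.
      by rewrite pE; field.
    rewrite (_ : p * _ + q * 1 = ((p - l') * p + q * r) / r); last by field.
    by rewrite A4; field.
have [q0|q0] := eqVneq q 0; last first.
  exists (p - l', q), (1, (s - l') / q); split.
  - by apply: contra q0 => /eqP[_ ->].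
  - move=> z; rewrite /form /lin /= -/p -/q -/r -/s.
    transitivity (((p - l') * p + q * r) * z.1 + ((p - l') * q + q * s) * z.2); first by ring.
    by rewrite A4 A5; ring.
  - move=> [x y]; rewrite /form /lin /= -/p -/q -/r -/s.
    apply: pw; rewrite /= /GRing.scale /=; first by ring.
    rewrite (_ : _ * ((s - l') / q) = (s - l') * y + ((p - l') * (s - l') / q) * x); last by field.
    by rewrite A3; field.
  - rewrite /lin /= -/p -/q -/r -/s; apply: pw; rewrite /= /GRing.scale /=.
      by rewrite pE; field.
    rewrite (_ : r * 1 + _ = (r * q + (s - l') * s) / q); last by field.
    by rewrite A2; field.
(* With both off-diagonal entries zero the matrix is [1] or [-1], so [theta = 0] serves with any
   nonzero form. *)
have ps : p = s.
  have e : M 0 0 * M 1 1 = 1.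
    have M10 : M 1 0 = 0 by apply/eqP; rewrite -(intr_eq0 R) -/r r0.
    by rewrite -dM det2 M10; ring.
  by rewrite /p /s; congr (_%:~R); have := congr1 absz e; rewrite abszM => /eqP;
    rewrite muln_eq1 => /andP[/eqP a1 /eqP a2]; nia.
have lE : l = p.
  have h : (l - p) ^+ 2 = 0 by rewrite -ps r0 mulr0 subr0 in D; rewrite expr2; nra.
  by apply/eqP; rewrite -subr_eq0 -sqrf_eq0 h.
have l'E : l' = p by rewrite pE lE; lra.
exists (1, 0), 0; split.
- by apply/eqP => -[/eqP]; rewrite oner_eq0.
- by move=> z; rewrite /form /lin /= -/p -/q -/r -/s q0 r0 lE; ring.
- move=> [x y]; rewrite /form /lin /= -/p -/q -/r -/s q0 r0 l'E -ps.
  by rewrite scaler0 addr0; apply: pw; rewrite /= /GRing.scale /=; ring.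
- by rewrite scaler0 /lin /= !mulr0 addr0.
Qed.


End Eigenvectors.

Section Growth.
Context {R : realType}.

Lemma iter_lin_eigen (M : 'M[int]_2) (c : R) v n : lin M v = c *: v ->
  iter n (lin M) v = c ^+ n *: v.
Proof.
move=> h; elim: n => [|n IH]; first by rewrite expr0 scale1r.
by rewrite iterS IH linZ h scalerA exprSr.
Qed.

Lemma iter_linD (M : 'M[int]_2) n (z t : R * R) :
  iter n (lin M) (z + t) = iter n (lin M) z + iter n (lin M) t.
Proof. by elim: n => //= n ->; rewrite linD. Qed.

Lemma iter_linZ (M : 'M[int]_2) n (c : R) (z : R * R) :
  iter n (lin M) (c *: z) = c *: iter n (lin M) z.
Proof. by elim: n => //= n ->; rewrite linZ. Qed.

Lemma iter_linB (M : 'M[int]_2) n (z t : R * R) :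
  iter n (lin M) (z - t) = iter n (lin M) z - iter n (lin M) t.
Proof. by elim: n => //= n ->; rewrite linB. Qed.

Lemma iter_form (M : 'M[int]_2) (eta : R * R) (l : R) n z :
  (forall z, form eta (lin M z) = l * form eta z) ->
  form eta (iter n (lin M) z) = l ^+ n * form eta z.
Proof.
move=> h; elim: n => [|n IH]; first by rewrite expr0 mul1r.
by rewrite iterS h IH exprS mulrA.
Qed.

Lemma norm_pairZ (c : R) (z : R * R) : `|c *: z| = `|c| * `|z|.
Proof. exact: normrZ. Qed.

(** Writing [M^(n+1) z] as [M^n (M z)] and splitting [M z] gives [l' M^n z + l^n eta(z) theta],
    where [|l'| <= 1]. The factor [n] makes room for Jordan blocks and disappears once logarithms
    are divided by [n]. *)
Lemma iter_growth (M : 'M[int]_2) (l l' : R) (eta theta : R * R) :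
  1 <= `|l| -> l * l' = 1 ->
  (forall z, lin M z = l' *: z + form eta z *: theta) -> lin M theta = l *: theta ->
  forall n z, `|iter n (lin M) z| <=
    `|z| + n%:R * `|l| ^+ n * (`|theta| * `|form eta z|).
Proof.
move=> l1 ll hM ht n z; elim: n => [|n IH] /=; first by rewrite mul0r mul0r addr0.
have l'1 : `|l'| <= 1.
  have l0 : 0 < `|l| by apply: lt_le_trans l1.
  by rewrite -(ler_pM2l l0) -normrM ll normr1 mulr1.
have -> : lin M (iter n (lin M) z) = l' *: iter n (lin M) z + (l ^+ n * form eta z) *: theta.
  rewrite -iterS iterSr hM iter_linD !iter_linZ (iter_lin_eigen _ ht) scalerA.
  by congr (_ + _ *: _); rewrite mulrC.
apply: le_trans (ler_normD _ _) _; rewrite !norm_pairZ normrM normrX.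
have h1 : `|l'| * `|iter n (lin M) z| <= `|iter n (lin M) z|.
  by rewrite ler_piMl.
have h2 : `|l| ^+ n * (`|theta| * `|form eta z|) <= `|l| ^+ n.+1 * (`|theta| * `|form eta z|).
  by rewrite ler_wpM2r ?mulr_ge0 // ler_weXn2l.
have h3 : n%:R * (`|l| ^+ n * (`|theta| * `|form eta z|)) <=
    n%:R * (`|l| ^+ n.+1 * (`|theta| * `|form eta z|)) by rewrite ler_wpM2l.
move: IH h1 h2 h3; rewrite -natr1 -!mulrA [`|form eta z| * `|theta|]mulrC.
move: (`|theta| * `|form eta z|) => a.
move: (`|l| ^+ n * a) (`|l| ^+ n.+1 * a) => b c.
rewrite mulrDl mul1r; move: (n%:R * b) (n%:R * c) => *; lra.
Qed.

(** [l] is a root of largest modulus of [X^2 - t X + 1]; for negative [t] both roots change sign.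
    The boundary case [|t| = 2] is included for the sake of the Farey paths. *)
Lemma exists_eigenvalue (t : int) : 2 <= `|t| ->
  exists l l' : R, [/\ l * l' = 1, l + l' = t%:~R, 1 <= `|l| & 2 < `|t| -> 1 < `|l|].
Proof.
wlog t0 : t / 0 <= t => [hw t2|].
  have [t0|t0] := leP 0 t; first exact: hw.
  have nt0 : 0 <= - t by rewrite oppr_ge0 ltW.
  have nt2 : 2 <= `|- t| by rewrite normrN.
  have [l [l' [h1 h2 h3]]] := hw (- t) nt0 nt2; rewrite normrN => h4.
  exists (- l), (- l'); rewrite mulrNN normrN -opprD h2 mulrNz opprK; split => //.
rewrite ger0_norm // => t2.
have t2R : 2 <= (t%:~R : R) by rewrite (_ : 2 = (2 : int)%:~R) ?ler_int.
pose s : R := Num.sqrt (t%:~R ^+ 2 - 4).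
have s2 : s ^+ 2 = t%:~R ^+ 2 - 4 by rewrite sqr_sqrtr //; nra.
have s0 : 0 <= s by exact: sqrtr_ge0.
have l1 : 1 <= (t%:~R + s) / 2 by lra.
exists ((t%:~R + s) / 2), ((t%:~R - s) / 2); split.
- have E : (t%:~R + s) / 2 * ((t%:~R - s) / 2) = (t%:~R ^+ 2 - s ^+ 2) / 4 by field.
  by rewrite E s2; lra.
- by field.
- by rewrite ger0_norm //; lra.
- move=> t3; have t3R : 2 < (t%:~R : R) by rewrite (_ : 2 = (2 : int)%:~R) ?ltr_int.
  by rewrite ger0_norm; lra.
Qed.

End Growth.

(** * Ergodicity *)

Section Ergodicity.
Context {R : realType}.
Notation T := (R * R * R)%type.
Notation leb2 := (@lebesgue_measure R \x @lebesgue_measure R)%E.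

(** The pushforward under [pillow] of Lebesgue measure on the unit square: the separation lemmas
    take a bundled measure. *)
Lemma surface_measure_exists : exists mu : {measure set T -> \bar R},
  (forall B, mu B = torus (pillow @^-1` B)) /\ (mu setT < +oo)%E.
Proof.
have mf := @measurable_pillow R.
pose nu : {measure set (measurableTypeR R * measurableTypeR R) -> \bar R} :=
  [the measure _ _ of mrestr [the measure _ _ of leb2] (@measurable_unit_square R)].
exists (measure_function_pushforward__canonical__measure_function_Measure nu mf).
split => //; change ((torus (@pillow R @^-1` setT) < +oo)%E).
by rewrite preimage_setT torusT ltry.
Qed.

Lemma le_torus (X Y : set (R * R)) : measurable X -> measurable Y -> X `<=` Y ->
  (torus X <= torus Y)%E.
Proof.
move=> mX mY XY; apply: le_leb2.
- by apply: measurableI => //; exact: measurable_unit_square.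
- by apply: measurableI => //; exact: measurable_unit_square.
- exact: setSI.
Qed.

Lemma torusU_le (X Y : set (R * R)) : measurable X -> measurable Y ->
  (torus (X `|` Y) <= torus X + torus Y)%E.
Proof.
move=> mX mY; rewrite /torus setIUl.
by apply: (@measureU2 _ _ _ [the measure _ _ of leb2]); apply: measurableI => //;
  exact: measurable_unit_square.
Qed.

(** Invariance of [E] under translations up to null sets is stated as the nullity of [escape E v]
    for every [v]; the reverse inclusion is the case of [- v]. *)
Definition escape (E : set (R * R)) (v : R * R) := [set z | E z /\ ~ E (z + v)].

Lemma measurable_shift (E : set (R * R)) v : measurable E -> measurable ((fun z => z + v) @^-1` E).
Proof.
apply: measurable_preimage; apply: measurable_fun_pair; apply: measurable_funD => //;
  (exact: measurable_fst || exact: measurable_snd).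
Qed.

Lemma measurable_escape E v : measurable E -> measurable (escape E v).
Proof.
move=> mE; rewrite (_ : escape E v = E `&` ~` ((fun z => z + v) @^-1` E)) //.
by apply: measurableI => //; apply: measurableC; exact: measurable_shift.
Qed.

Lemma periodic_shift (E : set (R * R)) (v : R * R) :
  periodic E -> periodic ((fun z => z + v) @^-1` E).
Proof.
move=> pE x y k l; rewrite /preimage /=.
rewrite (_ : (x + k%:~R, y + l%:~R) + v = (x + v.1 + k%:~R, y + v.2 + l%:~R)); last first.
  by congr (_, _); rewrite /= addrAC.
by rewrite pE.
Qed.

Lemma periodic_escape E v : periodic E -> periodic (escape E v).
Proof.
move=> pE x y k l; have := periodic_shift v pE x y k l; rewrite /preimage /escape /= => ->.
by rewrite pE.
Qed.

Lemma measurable_iter_lin M n : measurable_fun setT (iter n (@lin R M)).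
Proof.
elim: n => [|n IH]; first exact: measurable_id.
by rewrite (_ : iter n.+1 _ = lin M \o iter n (lin M)) //; apply: measurableT_comp => //;
  exact: measurable_lin.
Qed.

Lemma torus_iter_lin M n (E : set (R * R)) : \det M = 1 -> measurable E -> periodic E ->
  torus (iter n (lin M) @^-1` E) = torus E.
Proof.
move=> dM; elim: n E => [|n IH] E mE pE; first exact: erefl.
have mE' : measurable (lin M @^-1` E).
  by apply: measurable_preimage mE; exact: measurable_lin.
transitivity (torus (iter n (lin M) @^-1` (lin M @^-1` E))).
  by congr torus.
by rewrite (IH _ mE' (periodic_lin _ pE)) (torus_lin dM mE pE).
Qed.

(* Along a contracted direction [v], the orbits of [z] and [z + v] become
   arbitrarily close, while membership in [E] does not change. *)
Lemma contracted_escape (B : set T) (M : 'M[int]_2) (c : R) v :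
  measurable B -> \det M = 1 -> `|c| < 1 -> lin M v = c *: v ->
  (forall z, B (pillow (lin M z)) <-> B (pillow z)) ->
  torus (escape (pillow @^-1` B) v) = 0%E.
Proof.
move=> mB dM c1 hv inv.
pose E := pillow @^-1` B.
have mE : measurable E := measurable_pillow_preimage mB.
have mX := measurable_escape v mE.
apply/eqP; rewrite eq_le torus_ge0 // andbT.
apply/lee_addgt0Pr => e e0; rewrite add0e.
have [mu [muE mu_fin]] := surface_measure_exists.
have e2 : 0 < e / 2 by rewrite divr_gt0.
have [F [F' [dl dl0 [[mF mF'] [FB FB'] sep hmu]]]] := separable_measurable mu_fin mB e2.
have [n hn] : exists n, 16 * `|c ^+ n *: v| < dl.
  have hc : c ^+ n @[n --> \oo] --> (0 : R) by exact: cvg_expr.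
  have p0 : 0 < 16 * (`|v| + 1) by rewrite mulr_gt0 // ltr_wpDl.
  have /cvgrPdist_lt /(_ _ (divr_gt0 dl0 p0)) [N _ hN] := hc.
  exists N; have := hN N (leqnn N); rewrite /= sub0r normrN norm_pairZ ltr_pdivlMr //.
  apply: le_lt_trans; rewrite mulrCA ler_wpM2l // ler_wpM2l //.
  by rewrite lerDl.
pose G := pillow @^-1` (F `|` F').
have mFF : measurable (F `|` F') by exact: measurableU.
have mG : measurable (~` G) by apply: measurableC; exact: measurable_pillow_preimage.
have pG : periodic (~` G) by move=> x y k l; rewrite /G /preimage /= pillow_int.
have hG : (torus (~` G) <= (e / 2)%:E)%E by rewrite muE in hmu.
have invn m z : B (pillow (iter m (lin M) z)) <-> B (pillow z).
  by elim: m => //= m IH; rewrite inv.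
pose w := iter n (lin M) v.
have mY1 : measurable (iter n (lin M) @^-1` (~` G)).
  by apply: measurable_preimage mG; exact: measurable_iter_lin.
have mS : measurable ((fun z => z + w) @^-1` (~` G)) by exact: measurable_shift.
have mY2 : measurable (iter n (lin M) @^-1` ((fun z => z + w) @^-1` (~` G))).
  by apply: measurable_preimage mS; exact: measurable_iter_lin.
have sub : escape E v `<=` iter n (lin M) @^-1` (~` G) `|`
    iter n (lin M) @^-1` ((fun z => z + w) @^-1` (~` G)).
  move=> z [Ez nEz]; apply: contrapT => /not_orP[/contrapT g1 /contrapT g2].
  rewrite /preimage /= in g2; rewrite /w -iter_linD in g2.
  have h1 : B (pillow (iter n (lin M) z)) by apply/invn.
  have h2 : ~ B (pillow (iter n (lin M) (z + v))) by move/invn.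
  have f1 : F (pillow (iter n (lin M) z)) by case: g1 => // /FB'.
  have f2 : F' (pillow (iter n (lin M) (z + v))) by case: g2 => // /FB.
  have := sep _ _ f1 f2; rewrite leNgt => /negP; apply.
  apply: le_lt_trans (pillow_lipschitz _ _) _.
  by rewrite iter_linD opprD addrA subrr sub0r normrN (iter_lin_eigen _ hv).
have mY := measurableU _ _ mY1 mY2.
apply: (le_trans (le_torus mX mY sub)).
apply: (le_trans (torusU_le mY1 mY2)).
have -> : e%:E = ((e / 2)%:E + (e / 2)%:E)%E by rewrite -EFinD -splitr.
have pS := periodic_shift w pG.
rewrite (torus_iter_lin n dM mG pG) (torus_iter_lin n dM mS pS) (torus_shift w mG pG).
exact: leeD.
Qed.

Lemma escapeD (E : set (R * R)) v w : measurable E -> periodic E ->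
  torus (escape E v) = 0%E -> torus (escape E w) = 0%E -> torus (escape E (v + w)) = 0%E.
Proof.
move=> mE pE hv hw.
have mv := measurable_escape v mE; have mw := measurable_escape w mE.
have mvw := measurable_escape (v + w) mE.
have ms := measurable_shift v mw.
apply/eqP; rewrite eq_le torus_ge0 // andbT.
have sub : escape E (v + w) `<=` escape E v `|` (fun z => z + v) @^-1` (escape E w).
  move=> z [Ez nE]; have [Ev|Ev] := pselect (E (z + v)); last by left.
  by right; split => //; rewrite -addrA.
apply: (le_trans (le_torus mvw (measurableU _ _ mv ms) sub)).
apply: (le_trans (torusU_le mv ms)).
by rewrite (torus_shift v mw (periodic_escape w pE)) hv hw adde0.
Qed.

Lemma periodicC (E : set (R * R)) : periodic E -> periodic (~` E).
Proof. by move=> pE x y k l; have [h1 h2] := pE x y k l; split; exact: contra_not. Qed.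

(** Fubini for the indicator of [Y]: one order of integration gives [c * L E], the other gives
    zero. *)
Lemma null_sections d (X : measurableType d) (L : {finite_measure set X -> \bar R})
    (Y : set (X * X)) (E : set X) (c : \bar R) :
  measurable Y -> measurable E -> (0 <= c)%E -> (forall v, L (ysection Y v) = 0%E) ->
  (forall z, E z -> L (xsection Y z) = c) -> (forall z, ~ E z -> L (xsection Y z) = 0%E) ->
  (c * L E = 0)%E.
Proof.
move=> mY mE c0 hy hE hnE.
have fub : (\int[L]_z L (xsection Y z) = \int[L]_v L (ysection Y v))%E.
  apply: (@product_measure_unique _ _ _ _ _ L L [the measure _ _ of (L \x^ L)%E]) => //.
  by move=> A B mA mB; exact: product_measure2E.
rewrite [RHS]integral0_eq // in fub.
rewrite -fub -[E in LHS]setIT -integral_indic // -ge0_integralZl //; last first.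
  by apply/measurable_EFinP; exact: measurable_indic.
apply: eq_integral => z _; rewrite indicE.
have [zE|zE] := boolP (z \in E); first by rewrite mule1 hE //; rewrite inE in zE.
by rewrite mule0 hnE //; rewrite notin_setE in zE.
Qed.

(** Consider the pairs [(z, v)] with [z] in [E] and [z + v] outside. The slice at [v] is an escape
    set, hence null; the slice at a point of [E] is a translate of the complement. By Fubini the
    product of the measures of [E] and of its complement is zero. *)
Lemma escape_null_trivial (E : set (R * R)) : measurable E -> periodic E ->
  (forall v, torus (escape E v) = 0%E) -> torus E = 0%E \/ torus (~` E) = 0%E.
Proof.
move=> mE pE h.
pose X : set ((R * R) * (R * R)) := [set zv | E zv.1 /\ ~ E (zv.1 + zv.2)].
have mX : measurable X.
  have -> : X = (fst @^-1` E) `&` (~` ((fun zv => zv.1 + zv.2) @^-1` E)) by [].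
  apply: measurableI.
  - by apply: measurable_preimage => //; exact: measurable_fst.
  - apply: measurableC; apply: measurable_preimage mE.
    have f1 := measurableT_comp (@measurable_fst _ _ R R) (@measurable_fst _ _ (R * R)%type (R * R)%type).
    have f2 := measurableT_comp (@measurable_snd _ _ R R) (@measurable_fst _ _ (R * R)%type (R * R)%type).
    have f3 := measurableT_comp (@measurable_fst _ _ R R) (@measurable_snd _ _ (R * R)%type (R * R)%type).
    have f4 := measurableT_comp (@measurable_snd _ _ R R) (@measurable_snd _ _ (R * R)%type (R * R)%type).
    by apply: measurable_fun_pair; exact: measurable_funD.
have Qfin : (leb2 (@unit_square R) < +oo)%E by rewrite leb2_unit_square ltry.
pose mu2 : {measure set (measurableTypeR R * measurableTypeR R)%type -> \bar R} :=
  [the measure _ _ of leb2].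
pose L : {finite_measure set (measurableTypeR R * measurableTypeR R)%type -> \bar R} :=
  mfrestr (f := mu2) (@measurable_unit_square R) Qfin.
have LE A : L A = torus A by [].
have mnE : measurable (~` E) by exact: measurableC.
have pnE := periodicC pE.
have hy v : L (ysection X v) = 0%E.
  rewrite LE (_ : ysection X v = escape E v); first exact: h.
  by apply/seteqP; split => z; rewrite /ysection /X /escape /= inE.
have hE z : E z -> L (xsection X z) = torus (~` E).
  move=> Ez; rewrite LE -(torus_shift z mnE pnE); congr torus.
  apply/seteqP; split => v; rewrite /xsection /X /preimage /= inE /= addrC.
    by case.
  by move=> ?; split.
have hnE z : ~ E z -> L (xsection X z) = 0%E.
  move=> nEz; rewrite (_ : xsection X z = set0) ?measure0 //.
  by apply/seteqP; split => // v; rewrite /xsection /X /= inE /= => -[].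
have := @null_sections _ (measurableTypeR R * measurableTypeR R)%type L X E _ mX mE (torus_ge0 mnE) hy hE hnE.
rewrite LE => /eqP; rewrite mule_eq0 => /orP[]/eqP ->; [by right|by left].
Qed.

End Ergodicity.

Section ErgodicAction.
Context {R : realType}.
Notation T := (R * R * R)%type.

Lemma area_preserving (g : T -> T) (M : 'M[int]_2) : \det M = 1 ->
  measurable_fun setT g -> (forall z, g (pillow z) = pillow (lin M z)) ->
  measure_preserving (@area R) g.
Proof.
move=> dM mg hg; split; first exact: mg.
move=> A mA; have mgA := measurable_preimage mg mA.
rewrite (area_pillow mA) (area_pillow mgA); congr (_ * _)%E.
rewrite -(torus_lin dM (measurable_pillow_preimage mA) (@periodic_pillow _ A)).
by congr torus; apply/seteqP; split => z; rewrite /preimage /= hg.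
Qed.

Definition adj2 (M : 'M[int]_2) := mx2 (M 1 1) (- M 0 1) (- M 1 0) (M 0 0).

Lemma det_adj2 M : \det M = 1 -> \det (adj2 M) = 1.
Proof. by rewrite !det2 !mx2E => <-; ring. Qed.

Lemma lin_adj2 M (z : R * R) : \det M = 1 ->
  lin M (lin (adj2 M) z) = z /\ lin (adj2 M) (lin M z) = z.
Proof.
move=> dM.
have e1 : M *m adj2 M = 1%:M.
  rewrite mulmx2 !mx2E scalar_mx2; congr mx2; rewrite -?dM ?det2; ring.
have e2 : adj2 M *m M = 1%:M.
  rewrite mulmx2 !mx2E scalar_mx2; congr mx2; rewrite -?dM ?det2; ring.
split.
  by have := lin_mul M (adj2 M) => /(_ R); rewrite e1 lin_one => /(congr1 (@^~ z)) /= <-.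
by have := lin_mul (adj2 M) M => /(_ R); rewrite e2 lin_one => /(congr1 (@^~ z)) /= <-.
Qed.

Lemma hyperbolic_ergodic (g : T -> T) (M : 'M[int]_2) : \det M = 1 -> 2 < `|\tr M| ->
  measurable_fun setT g -> (forall z, g (pillow z) = pillow (lin M z)) ->
  ergodic (@area R) g.
Proof.
move=> dM hM mg hg; split; first exact: area_preserving hg.
move=> B mB gB.
have inv z : B (pillow (lin M z)) <-> B (pillow z).
  by rewrite -hg -[in X in _ <-> X]gB.
have [l [l' [ll tl l1 /(_ hM) lgt]]] := @exists_eigenvalue R _ (ltW hM).
have l'l : l' * l = 1 by rewrite mulrC.
have tl' : l' + l = (\tr M)%:~R by rewrite addrC.
have [eta [th [_ _ hz hth]]] := eigen_decomp dM ll tl.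
have [eta' [th' [_ _ hz' hth']]] := eigen_decomp dM l'l tl'.
have l0 : 0 < `|l| by exact: lt_le_trans l1.
have l'1 : `|l'| < 1 by rewrite -(ltr_pM2l l0) -normrM ll normr1 mulr1.
have dll : l - l' != 0.
  by apply/eqP => /subr0_eq e; move: l'1; rewrite -e ltNge l1.
pose E := pillow @^-1` B.
have mE : measurable E := measurable_pillow_preimage mB.
have pE : periodic E := @periodic_pillow _ B.
have esc_s (c : R) : torus (escape E (c *: th')) = 0%E.
  apply: (contracted_escape (M := M) mB dM l'1) => //.
  by rewrite linZ hth' !scalerA mulrC.
(* The unstable direction is contracted by the inverse matrix, under which [B] is invariant as
   well. *)
have esc_u (c : R) : torus (escape E (c *: th)) = 0%E.
  apply: (contracted_escape (M := adj2 M) mB (det_adj2 dM) l'1).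
    have -> : c *: th = lin M ((c * l') *: th).
      by rewrite linZ hth scalerA -mulrA l'l mulr1.
    rewrite (lin_adj2 _ dM).2 linZ hth !scalerA; congr (_ *: _).
    by transitivity (c * l' * (l' * l)); [rewrite l'l mulr1|ring].
  by move=> z; rewrite -inv (lin_adj2 _ dM).1.
have esc v : torus (escape E v) = 0%E.
  have -> : v = (form eta v / (l - l')) *: th + (- (form eta' v) / (l - l')) *: th'.
    (* Equate the decompositions of [lin M v] with respect to [l] and to [l']. *)
    have h : (l - l') *: v = form eta v *: th - form eta' v *: th'.
      have sub (x y a b : R * R) : x + a = y + b -> y - x = a - b.
        by move=> e; rewrite -(addrK b y) -e [x + a]addrC addrAC addrK.
      by rewrite scalerBl; apply: sub; rewrite -hz hz'.
    transitivity ((l - l')^-1 *: ((l - l') *: v)); first by rewrite scalerA mulVf // scale1r.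
    by rewrite h scalerBr !scalerA mulNr scaleNr; congr (_ *: _ - _ *: _); rewrite mulrC.
  exact: escapeD.
have [h|h] := escape_null_trivial mE pE esc; [left|right]; apply: area_eq0 => //.
exact: measurableC.
Qed.

End ErgodicAction.

(** * Entropy from above *)

Section GibbsCoding.
Context {R : realType}.

Lemma ln_le_sub1 (x : R) : 0 < x -> ln x <= x - 1.
Proof.
move=> x0; have := @le_ln1Dx R (x - 1); rewrite [1 + _]addrC subrK; apply.
by rewrite ltrBrDr addNr.
Qed.

Lemma ln_prod_pos (I : finType) (q : I -> R) : (forall i, 0 < q i) ->
  ln (\prod_i q i) = \sum_i ln (q i).
Proof.
move=> q0; have [] : 0 < \prod_i q i /\ ln (\prod_i q i) = \sum_i ln (q i); last by [].
apply: (big_rec2 (fun a b => 0 < a /\ ln a = b)); first by rewrite ln1.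
by move=> i a b _ [a0 <-]; rewrite mulr_gt0 // lnM ?posrE.
Qed.

(** Comes from [ln x <= x - 1] at [x = Q w / P w], multiplied by [P w] and summed; words with
    [P w = 0] are treated apart. *)
Lemma gibbs (W : finType) (P Q : W -> R) : (forall w, 0 <= P w) ->
  (forall w, 0 < Q w) -> \sum_w P w = 1 -> \sum_w Q w = 1 ->
  \sum_w - (P w * ln (P w)) <= \sum_w P w * - ln (Q w).
Proof.
move=> P0 Q0 P1 Q1.
have h w : - (P w * ln (P w)) <= P w * - ln (Q w) + (Q w - P w).
  have := P0 w; rewrite le_eqVlt => /predU1P[<-|Pw].
    by rewrite !mul0r oppr0 add0r addr0 ltW.
  have QP : 0 < Q w / P w by rewrite divr_gt0.
  have := ln_le_sub1 QP; rewrite lnM ?posrE ?invr_gt0 // lnV ?posrE // => h.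
  have {}h : P w * (ln (Q w) - ln (P w)) <= P w * (Q w / P w - 1) by rewrite ler_pM2l.
  have e : P w * (Q w / P w - 1) = Q w - P w by field; rewrite gt_eqF.
  by rewrite e mulrBr in h; rewrite mulrN; lra.
apply: le_trans (ler_sum _ (fun w _ => h w)) _.
by rewrite big_split /= sumrB Q1 P1 subrr addr0.
Qed.

(* A word which agrees with the code word [guess y] in most places is cheap to
   encode once the code [y] is known. *)
Lemma code_entropy_bound (k n : nat) (Y : finType) (m : {ffun 'I_n -> 'I_k} -> Y -> R)
    (guess : Y -> 'I_n -> 'I_k) (dl e : R) :
  (forall w y, 0 <= m w y) -> \sum_w \sum_y m w y = 1 -> (0 < k)%N ->
  0 < dl < 1 ->
  (forall i : 'I_n, \sum_(wy : {ffun 'I_n -> 'I_k} * Y | wy.1 i != guess wy.2 i) m wy.1 wy.2 <= e) ->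
  \sum_w - ((\sum_y m w y) * ln (\sum_y m w y)) <=
  ln #|Y|%:R + n%:R * (- ln (1 - dl)) + n%:R * (e * - ln (dl / k%:R)).
Proof.
move=> m0 m1 k0 /andP[d0 d1] he.
have kR : 0 < k%:R :> R by rewrite ltr0n.
have Y0 : 0 < #|Y|%:R :> R.
  rewrite ltr0n lt0n; apply/eqP => Y0.
  move: m1; rewrite big1 => [/esym/eqP|w _]; first by rewrite oner_eq0.
  by rewrite big1 // => y _; have := fintype0 y Y0.
have dk0 : 0 < dl / k%:R by rewrite divr_gt0.
(* A noisy letter: the guess with weight [1 - dl], a uniform letter with weight [dl]. The uniform
   part keeps [q] positive, so that a wrong letter costs at most [- ln (dl / k)]. The comparison
   measure [Q] is the average over all codes of the products of these laws. *)
pose q (a b : 'I_k) : R := (1 - dl) * (a == b)%:R + dl / k%:R.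
have q0 a b : 0 < q a b.
  by rewrite /q ltr_wpDl // mulr_ge0 // subr_ge0 ltW.
have q1 b : \sum_a q a b = 1.
  rewrite /q big_split /= -mulr_sumr (bigD1 b) //= eqxx big1 => [|a /negbTE -> //].
  rewrite addr0 mulr1 sumr_const card_ord -[_ *+ k]mulr_natr divfK ?subrK //.
  by rewrite gt_eqF.
pose pr (w : {ffun 'I_n -> 'I_k}) y := \prod_i q (w i) (guess y i).
have pr0 w y : 0 < pr w y by apply: prodr_gt0 => i _; exact: q0.
have pr1 y : \sum_w pr w y = 1.
  rewrite /pr -(bigA_distr_bigA (fun i a => q a (guess y i))).
  by rewrite big1 // => i _; exact: q1.
pose Q w := #|Y|%:R^-1 * \sum_y pr w y.
have QY w y : #|Y|%:R^-1 * pr w y <= Q w.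
  rewrite /Q ler_pM2l ?invr_gt0 // (bigD1 y) //= lerDl sumr_ge0 // => y' _.
  exact: ltW.
have [y0 _] : exists y0 : Y, true.
  by move: Y0; rewrite ltr0n => /card_gt0P[y0 _]; exists y0.
have Q0 w : 0 < Q w.
  by apply: lt_le_trans (QY w y0); rewrite mulr_gt0 ?invr_gt0.
have Q1 : \sum_w Q w = 1.
  rewrite /Q -mulr_sumr exchange_big /= (eq_bigr (fun=> 1)) => [|y _]; last exact: pr1.
  by rewrite sumr_const mulVf // gt_eqF.
have P0 w : 0 <= \sum_y m w y by rewrite sumr_ge0.
apply: le_trans (gibbs P0 Q0 m1 Q1) _.
pose c (wy : {ffun 'I_n -> 'I_k} * Y) (i : 'I_n) : R :=
  - ln (1 - dl) + (wy.1 i != guess wy.2 i)%:R * - ln (dl / k%:R).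
have lnq (a b : 'I_k) : - ln (q a b) <= - ln (1 - dl) + (a != b)%:R * - ln (dl / k%:R).
  rewrite /q; case: eqVneq => ab /=.
    rewrite mulr1 mul0r addr0 lerN2 ler_ln ?posrE ?subr_gt0 // ?lerDl ?ltW //.
    by rewrite addr_gt0 // subr_gt0.
  rewrite mulr0 add0r mul1r lerDr oppr_ge0 ln_le0 //.
  by rewrite gerBl ltW.
have hlnQ w y : - ln (Q w) <= ln #|Y|%:R + \sum_i c (w, y) i.
  apply: (@le_trans _ _ (- ln (#|Y|%:R^-1 * pr w y))).
    by rewrite lerN2 ler_ln ?posrE ?QY // mulr_gt0 ?invr_gt0.
  rewrite lnM ?posrE ?invr_gt0 // lnV ?posrE // opprD opprK lerD2l.
  rewrite ln_prod_pos => [|i]; last exact: q0.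
  rewrite -sumrN; apply: ler_sum => i _; exact: lnq.
apply: (@le_trans _ _ (\sum_w \sum_y m w y * (ln #|Y|%:R + \sum_i c (w, y) i))).
  apply: ler_sum => w _; rewrite mulr_suml; apply: ler_sum => y _.
  exact: ler_wpM2l.
rewrite pair_bigA /=.
have m1' : \sum_(wy : {ffun 'I_n -> 'I_k} * Y) m wy.1 wy.2 = 1.
  by rewrite -m1 pair_bigA.
rewrite (eq_bigr (fun wy => m wy.1 wy.2 * ln #|Y|%:R +
    \sum_i m wy.1 wy.2 * c wy i)); last first.
  by move=> [w y] _ /=; rewrite mulrDr mulr_sumr.
rewrite big_split /= -mulr_suml m1' mul1r exchange_big /= -addrA lerD2l.
rewrite -mulrDr mulr_natl -[X in _ <= _ *+ X](card_ord n) -sumr_const.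
apply: ler_sum => i _; rewrite /c.
rewrite (eq_bigr (fun wy => m wy.1 wy.2 * - ln (1 - dl) +
    m wy.1 wy.2 * (wy.1 i != guess wy.2 i)%:R * - ln (dl / k%:R))); last first.
  by move=> wy _; rewrite mulrDr mulrA.
rewrite big_split /= -!mulr_suml m1' mul1r lerD2l.
apply: ler_wpM2r.
  rewrite oppr_ge0 ln_le0 // ler_pdivrMr // mul1r.
  by apply: (le_trans (ltW d1)); rewrite ler1n.
apply: le_trans (he i); rewrite [X in _ <= X]big_mkcond /=.
by apply: ler_sum => wy _; case: ifP => _; rewrite ?mulr1 ?mulr0.
Qed.

End GibbsCoding.

Section EntropyUpper.
Context {R : realType}.
Notation T := (R * R * R)%type.
Notation leb2 := (@lebesgue_measure R \x @lebesgue_measure R)%E.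

Definition measurable_labels (F : finType) (f : R * R -> F) :=
  forall a, measurable (f @^-1` [set a]).

Lemma measurable_labels_pred (F : finType) (f : R * R -> F) (P : pred F) :
  measurable_labels f -> measurable [set z | P (f z)].
Proof.
move=> mf; rewrite (_ : [set z | P (f z)] = \bigcup_(a in [set a | P a]) f @^-1` [set a]).
  by apply: fin_bigcup_measurable => // a _; exact: mf.
apply/seteqP; split => z /=; first by move=> Pz; exists (f z).
by move=> [a /= Pa ->].
Qed.

Lemma sum_torus_labels (F : finType) (f : R * R -> F) (P : pred F) :
  measurable_labels f ->
  \sum_(a | P a) fine (torus (f @^-1` [set a])) = fine (torus [set z | P (f z)]).
Proof.
move=> mf; rewrite -big_enum /=.
have -> : [set z | P (f z)] = [set z | f z \in enum P].
  by apply/seteqP; split => z /=; rewrite mem_enum.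
have := enum_uniq P; elim: (enum P) => [_|a s IH /= /andP[nas us]].
  rewrite big_nil (_ : [set z | f z \in [::]] = set0); last by apply/seteqP; split.
  rewrite /torus set0I.
  by rewrite (@measure0 _ _ _ [the measure _ _ of leb2]).
have ms : measurable [set z | f z \in s] by exact: (@measurable_labels_pred F f (fun b => b \in s)).
rewrite big_cons (IH us) -fineD; [|exact: torus_fin|exact: torus_fin].
congr fine; rewrite /torus -(@measureU _ _ _ [the measure _ _ of leb2]).
- congr (leb2 _); rewrite -setIUl; congr (_ `&` _).
  apply/seteqP; split => z /=; first by rewrite inE; case => ->; rewrite ?eqxx ?orbT.
  by rewrite inE => /orP[/eqP|]; [left|right].
- by apply: measurableI; [exact: mf|exact: measurable_unit_square].
- by apply: measurableI; [exact: ms|exact: measurable_unit_square].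
- apply/seteqP; split => // z /= [[fz _] [zs _]].
  by move: nas; rewrite -fz zs.
Qed.

Lemma le_torus_square (X Y : set (R * R)) : measurable X -> measurable Y ->
  X `&` unit_square `<=` Y -> (torus X <= torus Y)%E.
Proof.
move=> mX mY XY; apply: le_leb2.
- by apply: measurableI => //; exact: measurable_unit_square.
- by apply: measurableI => //; exact: measurable_unit_square.
- by move=> z [Xz Qz]; split => //; exact: XY.
Qed.

Lemma measurable_iter (g : T -> T) n : measurable_fun setT g -> measurable_fun setT (iter n g).
Proof.
move=> mg; elim: n => [|n IH]; first exact: measurable_id.
by rewrite (_ : iter n.+1 g = g \o iter n g) //; exact: measurableT_comp.
Qed.

Lemma measurable_cylinder (g : T -> T) k (p : T -> 'I_k) n w :
  measurable_fun setT g -> measurable_labelling p -> measurable (@cylinder _ _ g k p n w).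
Proof.
move=> mg mp.
have -> : cylinder g p w = \bigcap_(i in [set: 'I_n]) (iter i g @^-1` (p @^-1` [set w i])).
  apply/seteqP; split => x /= h; first by move=> i _; exact: h.
  by move=> i; exact: (h i I).
apply: fin_bigcap_measurable => // i _.
by apply: measurable_preimage (mp _); exact: measurable_iter.
Qed.

Variables (g : T -> T) (M : 'M[int]_2).
Hypotheses (mg : measurable_fun setT g) (dM : \det M = 1)
  (hg : forall z, g (pillow z) = pillow (lin M z)).

Definition word k (p : T -> 'I_k) n (z : R * R) : {ffun 'I_n -> 'I_k} :=
  [ffun i : 'I_n => p (pillow (iter i (lin M) z))].

Lemma word_cylinder k (p : T -> 'I_k) n w :
  @word k p n @^-1` [set w] = pillow @^-1` (cylinder g p w).
Proof.
apply/seteqP; split => z; rewrite /word /cylinder /preimage /=.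
  by move=> <- i; rewrite ffunE (iter_pillow hg).
by move=> h; apply/ffunP => i; rewrite ffunE -(iter_pillow hg) h.
Qed.

Lemma measurable_word k (p : T -> 'I_k) n : measurable_labelling p ->
  measurable_labels (@word k p n).
Proof.
by move=> mp w; rewrite word_cylinder; apply: measurable_pillow_preimage; exact: measurable_cylinder.
Qed.

Lemma join_entropyE k (p : T -> 'I_k) n : measurable_labelling p ->
  join_entropy (@normalized_area R) g p n =
  \sum_w (let m := fine (torus (@word k p n @^-1` [set w])) in - (m * ln m)).
Proof.
move=> mp; apply: eq_bigr => w _.
by rewrite normalized_areaE ?word_cylinder //; exact: measurable_cylinder.
Qed.

(** If two points share a code and both orbits are in [G] at time [i], closeness of the orbits
    forces the same label. A wrong guess at time [i] therefore puts the orbit outside [G] at that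
    time, an event whose measure does not depend on [i]. *)
Lemma join_entropy_code (k : nat) (p : T -> 'I_k) (n : nat) (Y : finType) (r : R * R -> Y)
    (G : set T) (ep dl e : R) : measurable_labelling p -> measurable_labels r -> measurable G ->
  (torus (pillow @^-1` (~` G)) <= e%:E)%E ->
  (forall x y, G x -> G y -> `|x - y| < ep -> p x = p y) ->
  (forall z t, unit_square z -> unit_square t -> r z = r t ->
     forall i, (i < n)%N -> 16 * `|iter i (lin M) z - iter i (lin M) t| < ep) ->
  0 < dl < 1 ->
  join_entropy (@normalized_area R) g p n <=
  ln #|Y|%:R + n%:R * (- ln (1 - dl)) + n%:R * (e * - ln (dl / k%:R)).
Proof.
move=> mp mr mG hG pG hr d01.
have k0 : (0 < k)%N by case: (p (pillow 0)) => j; exact: leq_trans.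
pose f (z : R * R) : {ffun 'I_n -> 'I_k} * Y := (word p n z, r z).
have mf : measurable_labels f.
  move=> [w y]; rewrite (_ : f @^-1` _ = (@word k p n @^-1` [set w]) `&` (r @^-1` [set y])).
    by apply: measurableI; [exact: measurable_word|exact: mr].
  by apply/seteqP; split => z; rewrite /f /preimage /=; [move=> [-> ->]|move=> [-> ->]].
pose m w y := fine (torus (f @^-1` [set (w, y)])).
pose S (y : Y) (i : 'I_n) := [set z | [/\ unit_square z, r z = y & G (pillow (iter i (lin M) z))]].
(* The representative of a code is chosen for each time separately, so that its orbit is in [G] at
   that time. Where none exists, [xget] returns [0], and then every point of the code is outside [G]
   at time [i]. *)
pose guess y (i : 'I_n) := p (pillow (iter i (lin M) (xget (0 : R * R) (S y i)))).
have mE w : \sum_y m w y = fine (torus (@word k p n @^-1` [set w])).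
  have := sum_torus_labels (fun wy => wy.1 == w) mf.
  rewrite (_ : [set z | _] = @word k p n @^-1` [set w]); last first.
    by apply/seteqP; split => z; rewrite /f /preimage /=; [move/eqP|move=> ->].
  move=> <-; rewrite /m -(big_pred1_eq (idx := 0) +%R w (fun w => \sum_y fine (torus (f @^-1` [set (w, y)])))).
  by rewrite pair_big /=; apply: eq_big => [[w' y]|[w' y] _] //=; rewrite andbT.
have := @code_entropy_bound R k n Y m guess dl e _ _ k0 d01 _.
rewrite (join_entropyE n mp); under [in X in _ -> _ -> _ -> X]eq_bigr do rewrite mE.
apply.
- by move=> w y; rewrite /m fine_ge0 // torus_ge0.
- rewrite (eq_bigr (fun w => fine (torus (@word k p n @^-1` [set w])))); last by move=> w _; rewrite mE.
  rewrite sum_torus_labels; last exact: measurable_word.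
  by rewrite (_ : [set z | _] = setT) ?torusT //; apply/seteqP.
move=> i; rewrite (eq_bigr (fun wy => fine (torus (f @^-1` [set wy])))); last by case.
rewrite (sum_torus_labels _ mf).
have mX := measurable_labels_pred (fun wy : {ffun 'I_n -> 'I_k} * Y => wy.1 i != guess wy.2 i) mf.
rewrite -lee_fin fineK; last exact: torus_fin.
have mnG : measurable (pillow @^-1` (~` G)).
  by apply: measurable_pillow_preimage; exact: measurableC.
rewrite -(torus_iter_lin i dM mnG (@periodic_pillow _ _)) in hG.
apply: le_trans hG.
apply: (le_torus_square mX).
  by apply: measurable_preimage mnG; exact: measurable_iter_lin.
move=> z [/= /negP hz Qz] Gz; apply: hz.
have Sz : S (r z) i z by [].
have [Q' r' G'] : S (r z) i (xget 0 (S (r z) i)) by apply: xgetPex; exists z.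
rewrite ffunE /guess; apply/eqP; apply: pG => //.
apply: le_lt_trans (pillow_lipschitz _ _) _.
by apply: hr.
Qed.

End EntropyUpper.

Section Spanning.
Context {R : realType}.

(** The index of the interval of length [1/N] containing [f z]. For [f] with values in [[0, B]] and
    [K = B * N] the index is at most [K], and [inord] does not truncate. *)
Definition cell (K N : nat) (f : R * R -> R) (z : R * R) : 'I_K.+1 :=
  inord (Num.truncn (f z * N%:R)).

Lemma measurable_cell K N (f : R * R -> R) : measurable_fun setT f ->
  measurable_labels (cell K N f).
Proof.
move=> mf a.
have mN : measurable_fun setT (fun z => f z * N%:R) by exact: measurable_funM.
rewrite (_ : _ @^-1` _ = \bigcup_(m in [set m | inord m = a :> 'I_K.+1])
    [set z | Num.truncn (f z * N%:R) = m]); last first.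
  apply/seteqP; split => z; rewrite /cell /preimage /=; first by move=> <-; exists (Num.truncn (f z * N%:R)).
  by move=> [m /= <- ->].
apply: bigcup_measurable => m _.
have [->|m0] := eqVneq m 0%N.
  rewrite (_ : [set z | _] = (fun z => f z * N%:R) @^-1` `]-oo, 1[); first exact: measurable_preimage.
  apply/seteqP; split => z; rewrite /preimage /= in_itv /=; first by move=> h; have := truncn_le_nat (f z * N%:R) 0; rewrite h => <-.
  by move=> h; apply/eqP; rewrite -leqn0 truncn_le_nat.
rewrite (_ : [set z | _] = (fun z => f z * N%:R) @^-1` `[m%:R, m.+1%:R[); first exact: measurable_preimage.
apply/seteqP; split => z; rewrite /preimage /= in_itv /=.
  move=> h; rewrite -h; apply: truncn_itv.
  by apply: contraT; rewrite -ltNge => h'; move: m0; rewrite -h -leqn0 truncn_le_nat (lt_trans h').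
by move=> h; apply: truncn_def.
Qed.

Lemma cell_close (B N : nat) (f : R * R -> R) z t :
  0 <= f z <= B%:R -> 0 <= f t <= B%:R -> cell (B * N) N f z = cell (B * N) N f t ->
  `|f z - f t| * N%:R <= 1.
Proof.
move=> /andP[z0 zB] /andP[t0 tB] /(congr1 (@nat_of_ord _)).
have bd (x : R) : 0 <= x -> x <= B%:R -> (Num.truncn (x * N%:R) < (B * N).+1)%N.
  move=> x0 xB; rewrite ltnS -(ler_nat R); apply: (@le_trans _ _ (x * N%:R)).
    by rewrite truncn_le mulr_ge0.
  by rewrite natrM ler_wpM2r.
rewrite !inordK ?bd // => e.
have /andP[h1 h2] := truncn_itv (mulr_ge0 z0 (ler0n R N)).
have /andP[h3 h4] := truncn_itv (mulr_ge0 t0 (ler0n R N)).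
rewrite e -natr1 in h1 h2; rewrite -natr1 in h4.
rewrite -[N%:R in leLHS]ger0_norm // -normrM mulrBl ler_norml.
by apply/andP; split; lra.
Qed.

Lemma form_bound (eta z : R * R) : unit_square z -> `|form eta z| <= `|eta.1| + `|eta.2|.
Proof.
rewrite /unit_square /= !in_itv /= => -[/andP[a1 a2] /andP[b1 b2]].
apply: le_trans (ler_normD _ _) _; rewrite !normrM (ger0_norm a1) (ger0_norm b1).
by apply: lerD; rewrite ler_piMr // ltW.
Qed.

Lemma measurable_form (eta : R * R) : measurable_fun setT (form eta).
Proof.
by apply: measurable_funD; apply: measurable_funM => //;
  (exact: measurable_fst || exact: measurable_snd).
Qed.

(** By [iter_growth] orbits separate only through the form [eta]. So the two coordinates are cut
    with a fixed mesh and the form with a mesh of order [1 / (n |l|^n)], which determines the number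
    of cells. *)
Lemma spanning_labels (M : 'M[int]_2) (l l' : R) (eta theta : R * R) (ep : R) :
  1 <= `|l| -> l * l' = 1 ->
  (forall z, lin M z = l' *: z + form eta z *: theta) -> lin M theta = l *: theta ->
  0 < ep -> exists2 C : R, 0 < C & forall n, exists (Y : finType) (r : R * R -> Y),
  [/\ measurable_labels r, #|Y|%:R <= C * n.+1%:R * `|l| ^+ n, (0 < #|Y|)%N &
    forall z t, unit_square z -> unit_square t -> r z = r t ->
     forall i, (i < n)%N -> 16 * `|iter i (lin M) z - iter i (lin M) t| < ep].
Proof.
move=> l1 ll hz ht ep0.
have natup (x : R) : 0 <= x -> exists2 N : nat, (0 < N)%N & x < N%:R /\ N%:R <= x + 1.
  move=> x0; exists (Num.truncn x).+1 => //.
  have /andP[h1 h2] := truncn_itv x0; split => //.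
  by rewrite -natr1 lerD2r.
(* The [64] is [4 * 16]: after the factor [16], the coordinates and the form contribute at most
   [ep / 4] each. *)
have [N1 N10 [hN1 _]] : exists2 N : nat, (0 < N)%N & 64 / ep < N%:R /\ N%:R <= 64 / ep + 1.
  by apply: natup; rewrite divr_ge0 // ltW.
have [B B0 [hB _]] : exists2 N : nat, (0 < N)%N & `|eta.1| + `|eta.2| < N%:R /\ N%:R <= `|eta.1| + `|eta.2| + 1.
  by apply: natup; rewrite addr_ge0.
pose c : R := (N1.+1 * N1.+1)%:R.
have c0 : 0 < c by rewrite ltr0n.
pose th := 64 * `|theta| / ep.
have th0 : 0 <= th by rewrite divr_ge0 ?mulr_ge0 // ltW.
pose D : R := (2 * B)%:R * (th + 1) + 1.
have D0 : 0 < D by rewrite ltr_wpDl // mulr_ge0 // addr_ge0.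
exists (c * D); first by rewrite mulr_gt0.
move=> n; have ln1 : 1 <= `|l| ^+ n by exact: exprn_ege1.
have X0 : 0 <= n%:R * `|l| ^+ n * th 
    by apply: mulr_ge0 => //; apply: mulr_ge0 => //; exact: exprn_ge0.
have [N2 N20 [hN2 hN2']] := natup _ X0.
pose f1 (z : R * R) := z.1; pose f2 (z : R * R) := z.2.
(* On the unit square the form lies in [[- B, B]]; the shift brings it into [[0, 2 B]], as
   [cell_close] wants. *)
pose f3 (z : R * R) := form eta z + B%:R.
exists [the finType of ('I_(1 * N1).+1 * 'I_(1 * N1).+1 * 'I_(2 * B * N2).+1)%type].
exists (fun z => (cell (1 * N1) N1 f1 z, cell (1 * N1) N1 f2 z, cell (2 * B * N2) N2 f3 z)).
split.
- move=> [[a b] d]; rewrite (_ : _ @^-1` _ = (cell (1 * N1) N1 f1 @^-1` [set a] `&`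
    cell (1 * N1) N1 f2 @^-1` [set b]) `&` cell (2 * B * N2) N2 f3 @^-1` [set d]).
    apply: measurableI; first apply: measurableI; apply: measurable_cell.
    + exact: measurable_fst.
    + exact: measurable_snd.
    + by apply: measurable_funD => //; exact: measurable_form.
  by apply/seteqP; split => z; rewrite /preimage /=; [move=> [-> -> ->]|move=> [[-> ->] ->]].
- rewrite !card_prod !card_ord mul1n natrM -/c -mulrA -mulrA ler_pM2l //.
  rewrite -natr1 natrM /D.
  have h1 : (2 * B)%:R * N2%:R <= (2 * B)%:R * (n%:R * `|l| ^+ n * th + 1).
    by rewrite ler_wpM2l.
  have h2 : (2 * B)%:R * (n%:R * `|l| ^+ n * th + 1) <= (2 * B)%:R * (th + 1) * (n.+1%:R * `|l| ^+ n).
    rewrite -[_ * (th + 1) * _]mulrA ler_wpM2l // -natr1.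
    have := mulr_ge0 (ler0n R n) (exprn_ge0 n (normr_ge0 l)).
    have := mulr_ge0 th0 (exprn_ge0 n (normr_ge0 l)).
    set u := th; clearbody u; move: (`|l| ^+ n) (n%:R : R) ln1 => x y x1 ux0 nx0.
    rewrite [leRHS](_ : _ = y * x * u + y * x + u * x + x); [lra|ring].
  have h3 : 1 <= n.+1%:R * `|l| ^+ n.
    by rewrite mulr_ege1 // ler1n.
  rewrite mulrDl mul1r; lra.
- by rewrite !card_prod !card_ord.
- move=> z t Qz Qt [e1 e2 e3] i ni.
  have bz := form_bound eta Qz; have bt := form_bound eta Qt.
  move: (Qz) (Qt); rewrite /unit_square /= !in_itv /=.
  move=> [/andP[z10 z11] /andP[z20 z21]] [/andP[t10 t11] /andP[t20 t21]].
  have a1 : `|z.1 - t.1| * N1%:R <= 1.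
    by apply: (cell_close _ _ e1); apply/andP; split => //; exact: ltW.
  have a2 : `|z.2 - t.2| * N1%:R <= 1.
    by apply: (cell_close _ _ e2); apply/andP; split => //; exact: ltW.
  have a3 : `|form eta (z - t)| * N2%:R <= 1.
    have -> : form eta (z - t) = f3 z - f3 t by rewrite formB /f3; ring.
    apply: (cell_close _ _ e3); rewrite /f3 natrM.
      by move: bz; rewrite ler_norml => /andP[p1 p2]; clear - hB p1 p2; apply/andP; split; lra.
    by move: bt; rewrite ler_norml => /andP[p1 p2]; clear - hB p1 p2; apply/andP; split; lra.
  rewrite -iter_linB.
  have := iter_growth l1 ll hz ht i (z - t).
  have N1R : 0 < N1%:R :> R by rewrite ltr0n.
  have N2R : 0 < N2%:R :> R by rewrite ltr0n.
  have b1 : 64 * `|z - t| < ep.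
    have -> : `|z - t| = Num.max `|z.1 - t.1| `|z.2 - t.2| by rewrite prod_normE.
    have small (x : R) : x * N1%:R <= 1 -> 64 * x < ep.
      move=> hx; move: hN1; rewrite ltr_pdivrMr // => hN1.
      have [x0|x0] := leP x 0; first by lra.
      have h1 : 64 * x < N1%:R * ep * x by rewrite ltr_pM2r.
      have h2 : x * N1%:R * ep <= 1 * ep by rewrite ler_pM2r.
      by apply: (lt_le_trans h1); rewrite mulrC mulrA -[leRHS]mul1r.
    by rewrite maxEle; case: ifP => _; exact: small.
  have b2 : 16 * (i%:R * `|l| ^+ i * (`|theta| * `|form eta (z - t)|)) <= ep / 4.
    have il : i%:R * `|l| ^+ i <= n%:R * `|l| ^+ n.
      by rewrite ler_pM ?ler_nat ?(ltnW ni) // ler_weXn2l // ltnW.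
    set x := `|form _ _| in a3 *.
    have x0 : 0 <= x by exact: normr_ge0.
    apply: (@le_trans _ _ (16 * (n%:R * `|l| ^+ n * (`|theta| * x)))).
      by rewrite ler_wpM2l // ler_wpM2r // mulr_ge0.
    rewrite (_ : 16 * _ = (n%:R * `|l| ^+ n * th) * x * (ep / 4)); last first.
      by rewrite /th; field; rewrite gt_eqF.
    rewrite -[leRHS]mul1r ler_wpM2r ?divr_ge0 ?(ltW ep0) //.
    apply: le_trans a3; rewrite mulrC ler_wpM2l //.
    exact: ltW.
  lra.
Qed.

End Spanning.

Section EntropyUpperLimit.
Context {R : realType}.
Notation T := (R * R * R)%type.
Variables (g : T -> T) (M : 'M[int]_2).
Hypotheses (mg : measurable_fun setT g) (dM : \det M = 1)
  (hg : forall z, g (pillow z) = pillow (lin M z)).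
Variables (l l' : R).
Hypotheses (l1 : 1 <= `|l|) (ll : l * l' = 1) (tl : l + l' = (\tr M)%:~R).

(** The tangent of [ln] at [1/a]; a small slope [a] absorbs [ln n.+1] into [a * n] plus a
    constant. *)
Lemma ln_tangent (a x : R) : 0 < a -> 0 < x -> ln x <= a * x - 1 - ln a.
Proof.
move=> a0 x0; have := ln_le_sub1 (mulr_gt0 a0 x0).
by rewrite lnM ?posrE // => h; lra.
Qed.

Lemma join_entropy_upper k (p : T -> 'I_k) (e : R) : measurable_labelling p -> 0 < e ->
  \forall n \near \oo, join_entropy (@normalized_area R) g p n / n%:R <= ln `|l| + e.
Proof.
move=> mp e0.
have k0 : (0 < k)%N by case: (p (pillow 0)) => j; exact: leq_trans.
have [eta [theta [_ _ hz ht]]] := eigen_decomp dM ll tl.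
(* The four quarters of [e] pay for correct letters, [- ln (1 - dl)]; for wrong letters, [eps * b];
   for [ln n.+1]; and for the constant [D]. *)
pose a : R := e / 4; have a0 : 0 < a by rewrite divr_gt0.
pose dl := 1 - expR (- a).
have d1 : 1 - dl = expR (- a) by rewrite /dl; ring.
have d01 : 0 < dl < 1.
  rewrite /dl subr_gt0 gtrBl expR_gt0 andbT.
  by rewrite -(ltr_ln (x := expR _)) ?posrE ?expR_gt0 // expRK ln1 oppr_lt0.
have la : - ln (1 - dl) = a by rewrite d1 expRK opprK.
pose b := - ln (dl / k%:R).
have b0 : 0 <= b.
  rewrite oppr_ge0 ln_le0 // ler_pdivrMr ?ltr0n // mul1r.
  by case/andP: d01 => _ /ltW h; apply: (le_trans h); rewrite ler1n.
have b10 : 0 < b + 1 by lra.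
pose eps := a / (b + 1).
have eps0 : 0 < eps by rewrite divr_gt0.
have epsb : eps * b <= a.
  by rewrite /eps -mulrA ler_piMr ?ltW // mulrC ltr_pdivrMr // mul1r ltrDl.
have [mu [muE mu_fin]] := @surface_measure_exists R.
have [G [ep ep0 [mG hG pG]]] := labelling_uniform mu_fin mp eps0.
rewrite muE in hG.
have [C C0 hC] := spanning_labels l1 ll hz ht ep0.
pose D := ln C + a - 1 - ln a.
have key n : join_entropy (@normalized_area R) g p n <= n%:R * (ln `|l| + 3 * a) + D.
  have [Y [r [mr cY Y0 hr]]] := hC n.
  apply: (le_trans (join_entropy_code mg dM hg mp mr mG hG pG hr d01)).
  rewrite la -/b.
  have YR : 0 < #|Y|%:R :> R by rewrite ltr0n.
  have l0 : 0 < `|l| by exact: lt_le_trans l1.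
  have lY : ln #|Y|%:R <= ln C + ln n.+1%:R + ln `|l| *+ n.
    apply: (@le_trans _ _ (ln (C * n.+1%:R * `|l| ^+ n))).
      by rewrite ler_ln ?posrE // !mulr_gt0 // exprn_gt0.
    by rewrite lnM ?posrE ?mulr_gt0 ?exprn_gt0 // lnM ?posrE // lnXn.
  have ln1 : ln n.+1%:R <= a * n.+1%:R - 1 - ln a by apply: ln_tangent.
  rewrite -[ln `|l| *+ n]mulr_natl in lY; rewrite -[in a * _]natr1 in ln1.
  have n0 : 0 <= n%:R :> R by [].
  have h := ler_wpM2l n0 epsb.
  rewrite /D mulrDr; move: lY ln1 h.
  move: (n%:R : R) (ln `|l|) (ln C) (ln a) (ln n.+1%:R) (ln #|Y|%:R) => x L c la' y w.
  move: (x * L) (x * (eps * b)) => u v; lra.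
near=> n.
have n0 : 0 < n%:R :> R by rewrite ltr0n; near: n; exact: nbhs_infty_gt.
rewrite ler_pdivrMr //; apply: (le_trans (key n)).
have nD : D / a <= n%:R by near: n; exact: nbhs_infty_ger.
rewrite ler_pdivrMr // in nD.
have ea : e = 4 * a by rewrite /a; field.
rewrite ea mulrC [leRHS]mulrDl; move: nD; rewrite mulrDl.
move: (ln `|l| * n%:R) => u; lra.
Unshelve. all: by end_near. Qed.

Lemma partition_entropy_upper k (p : T -> 'I_k) : measurable_labelling p ->
  partition_entropy (@normalized_area R) g p <= ln `|l|.
Proof.
move=> mp; rewrite /partition_entropy; set u := (fun n => _).
have [cu|cu] := pselect (cvgn u); last first.
  (* For a divergent sequence [limn] is the default value [0], which is at most [ln |l|]. *)
  by rewrite (dvgP cu); exact: ln_ge0.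
apply/ler_addgt0Pr => e e0; apply: limr_le => //.
exact: join_entropy_upper.
Qed.

End EntropyUpperLimit.

(** * Entropy from below *)

Section EntropyLower.
Context {R : realType}.
Notation T := (R * R * R)%type.
Notation leb2 := (@lebesgue_measure R \x @lebesgue_measure R)%E.

(** A measurable right inverse of [pillow] on the surface: the first two coordinates give [a] and
    [b] in [[0, 1/2]], and the third decides the sign of [b]. *)
Definition fold_section (x : T) : R * R :=
  let a := (2 - x.1.1) / 8 in let b := (2 - x.1.2) / 8 in
  (a, if saw (a + b) == x.2 then b else - b).

Lemma measurable_fold_section : measurable_fun setT fold_section.
Proof.
have [m1 m2 m3] := @measurable_proj3 R.
have ma : measurable_fun [set: T] (fun x => (2 - x.1.1) / 8).
  by apply: measurable_funM => //; exact: measurable_funB.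
have mb : measurable_fun [set: T] (fun x => (2 - x.1.2) / 8).
  by apply: measurable_funM => //; exact: measurable_funB.
apply: measurable_fun_pair => //; apply: measurable_fun_ifT => //; last exact: measurable_funN.
apply: measurable_fun_eqr => //; apply: (measurableT_comp measurable_saw).
exact: measurable_funD.
Qed.

Lemma fold_section_fiber (z : R * R) : exists (s : R) (k l : int),
  [/\ s = 1 \/ s = -1, fold_section (pillow z) = (s * z.1 + k%:~R, s * z.2 + l%:~R),
      - 2^-1 <= (fold_section (pillow z)).1 <= 2^-1 &
      - 2^-1 <= (fold_section (pillow z)).2 <= 2^-1].
Proof.
case: z => x y; have [a [s [k [ha hs ->]]]] := fold_decomp x.
have [b [t [l [hb ht ->]]]] := fold_decomp y.
rewrite /fold_section /pillow /= !saw_fold //.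
rewrite (_ : (2 - (2 - 8 * a)) / 8 = a); last by field.
rewrite (_ : (2 - (2 - 8 * b)) / 8 = b); last by field.
rewrite addrACA -intrD saw_int.
case/andP: (ha) => a0 a1; case/andP: (hb) => b0 b1.
have bd (c : bool) : - 2^-1 <= (if c then b else - b) <= 2^-1.
  by case: c; apply/andP; split; lra.
have ss : s * s = 1 by case: hs => ->; ring.
have same : s = t -> exists (s' : R) (k' l' : int), [/\ s' = 1 \/ s' = -1,
    (a, b) = (s' * (s * a + k%:~R) + k'%:~R, s' * (t * b + l%:~R) + l'%:~R),
    - 2^-1 <= a <= 2^-1 & - 2^-1 <= b <= 2^-1].
  move=> st; exists s, (if s == 1 then - k else k), (if s == 1 then - l else l).
  split => //; [|apply/andP; split; lra|exact: (bd true)].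
  have [s1|s1] := eqVneq s 1.
    by rewrite -st s1 !mul1r !mulrNz !addrK.
  have sN : s = -1 by case: hs => // e; rewrite e eqxx in s1.
  by rewrite -st sN; congr (_, _); ring.
have opp : s = - t -> exists (s' : R) (k' l' : int), [/\ s' = 1 \/ s' = -1,
    (a, - b) = (s' * (s * a + k%:~R) + k'%:~R, s' * (t * b + l%:~R) + l'%:~R),
    - 2^-1 <= a <= 2^-1 & - 2^-1 <= - b <= 2^-1].
  move=> st; have tE : t = - s by rewrite st opprK.
  exists s, (if s == 1 then - k else k), (if s == 1 then - l else l).
  split => //; [|apply/andP; split; lra|exact: (bd false)].
  have [s1|s1] := eqVneq s 1.
    by rewrite tE s1 !mul1r !mulrNz; congr (_, _); ring.
  have sN : s = -1 by case: hs => // e; rewrite e eqxx in s1.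
  by rewrite tE sN; congr (_, _); ring.
have [st|st] : s = t \/ s = - t by case: hs => ->; case: ht => ->; rewrite ?opprK; auto.
  have -> : saw (a + b) == saw (s * a + t * b).
    by rewrite -st -mulrDr saw_sign.
  exact: same.
have sE : saw (s * a + t * b) = saw (a - b).
  have tE : t = - s by rewrite st opprK.
  by rewrite tE mulNr -mulrN -mulrDr saw_sign.
rewrite sE; case: ifPn => [/eqP e|_]; last exact: opp.
(* The test can succeed although the signs differ, when [saw (a + b) = saw (a - b)]. Then one of [a]
   and [b] is [0] or [1/2], and changing the sign of that coordinate amounts to an integer
   translation. *)
have deg : [\/ b = 0, b = 2^-1, a = 0 | a = 2^-1].
  move: e; rewrite saw01; last by apply/andP; split; lra.
  have [ab|ab] := leP b a.
    rewrite [in RHS]saw_half; last by apply/andP; split; lra.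
    have [h|h] := leP (8 * (a + b)) 4.
      by rewrite ler0_norm => [e|]; [apply: Or41|]; lra.
    by rewrite ger0_norm => [e|]; [apply: Or44|]; lra.
  rewrite -[in RHS]sawN opprB saw_half; last by apply/andP; split; lra.
  have [h|h] := leP (8 * (a + b)) 4.
    by rewrite ler0_norm => [e|]; [apply: Or43|]; lra.
  by rewrite ger0_norm => [e|]; [apply: Or42|]; lra.
have [s' [k' [l' [hs' E _ _]]]] := opp st; case: E => E1 E2.
have bb : - 2^-1 <= b <= 2^-1 by exact: (bd true).
have aa : - 2^-1 <= a <= 2^-1 by apply/andP; split; lra.
have N1 : - s' = 1 \/ - s' = -1 by case: hs' => ->; rewrite ?opprK; auto.
case: deg => e0.
- exists s', k', l'; split => //; congr (_, _) => //.
  by rewrite -E2 e0 oppr0.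
- exists s', k', (l' + 1); split => //; congr (_, _) => //.
  by rewrite intrD addrA -E2 e0 mulr1z; lra.
- exists (- s'), (- k'), (- l'); split => //; congr (_, _).
    by rewrite mulNr mulrNz -opprD -E1 e0 oppr0.
  by rewrite mulNr mulrNz -opprD -E2 opprK.
- exists (- s'), (- k' + 1), (- l'); split => //; congr (_, _).
    by rewrite intrD addrA mulNr mulrNz -opprD -E1 e0 mulr1z; lra.
  by rewrite mulNr mulrNz -opprD -E2 opprK.
Qed.

Definition slab (eta : R * R) (c e : R) : set (R * R) := [set z | `|form eta z - c| <= e].

Lemma measurable_slab eta c e : measurable (slab eta c e).
Proof.
rewrite (_ : slab _ _ _ = (fun z => `|form eta z - c|) @^-1` `]-oo, e]); last first.
  by apply/seteqP; split => z; rewrite /slab /preimage /= in_itv.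
apply: measurable_preimage => //; apply: measurableT_comp => //.
by apply: measurable_funB => //; exact: measurable_form.
Qed.

Definition form_size (eta : R * R) : R := if eta.1 == 0 then `|eta.2| else `|eta.1|.

(** The form is completed to affine coordinates by one of the two coordinate functions, with
    determinant [form_size eta] up to sign; the slab in the unit square then falls into a rectangle
    of sides [2 e] and [1]. *)
Lemma torus_slab (eta : R * R) (c e : R) : eta != 0 -> 0 <= e ->
  (torus (slab eta c e) <= (2 * e / form_size eta)%:E)%E.
Proof.
move=> eta0 e0.
pose h (u v : R) (z : R * R) := (eta.1 * z.1 + eta.2 * z.2 + 0, u * z.1 + v * z.2 + 0).
have rect : leb2 (`[c - e, c + e] `*` `[0, 1]) = (2 * e)%:E.
  rewrite product_measure1E //= !lebesgue_measure_itv /= !lte_fin ltr01 oppr0 adde0 mule1.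
  case: ifPn => [_|]; first by rewrite -EFinD; congr EFin; ring.
  by rewrite -leNgt => h'; congr EFin; lra.
have main u v : u = 0 /\ v = 1 \/ u = 1 /\ v = 0 -> eta.1 * v - eta.2 * u != 0 ->
    (torus (slab eta c e) <= (2 * e / `|eta.1 * v - eta.2 * u|)%:E)%E.
  move=> uv D; have [mh' /(_ (`[c - e, c + e] `*` `[0, 1]))] := affine_scales_area 0 0 D.
  have mY : measurable (`[c - e, c + e]%classic `*` `[0, 1]%classic : set (R * R)) by exact: measurableX.
  rewrite rect => /(_ mY) H.
  have mh : measurable_fun setT (h u v) by exact: mh'.
  have mS := measurable_slab eta c e.
  apply: (@le_trans _ _ (leb2 (h u v @^-1` (`[c - e, c + e] `*` `[0, 1])))).
    apply: le_leb2.
    - by apply: measurableI => //; exact: measurable_unit_square.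
    - exact: measurable_preimage.
    - move=> z [/= + []]; rewrite /slab /h /= !in_itv /= ler_norml /form => /andP[p1 p2] /andP[p3 p4] /andP[p5 p6].
      clear - uv p1 p2 p3 p4 p5 p6.
      by case: uv => -[-> ->]; split; apply/andP; split; lra.
  by rewrite /h H -EFinM lee_fin mulrC.
rewrite /form_size; case: ifPn => [/eqP e1|e1].
  have e2 : eta.2 != 0.
    by apply: contra eta0 => /eqP e2; rewrite [eta]surjective_pairing e1 e2.
  have := main 1 0; rewrite mulr0 mulr1 sub0r normrN; apply; first by right.
  by rewrite oppr_eq0.
by have := main 0 1; rewrite mulr0 mulr1 subr0; apply; first by left.
Qed.

End EntropyLower.

Section EntropyValue.
Context {R : realType}.
Notation T := (R * R * R)%type.
Notation leb2 := (@lebesgue_measure R \x @lebesgue_measure R)%E.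

Lemma torus_cover (I : Type) (s : seq I) (S : I -> set (R * R)) (c : R) (X : set (R * R)) :
  0 <= c -> (forall i, measurable (S i)) -> (forall i, (torus (S i) <= c%:E)%E) ->
  measurable X -> X `&` unit_square `<=` \big[setU/set0]_(i <- s) S i ->
  (torus X <= (c *+ size s)%:E)%E.
Proof.
move=> c0 mS hS; elim: s X => [|a s IH] X mX sub.
  have := le_torus_square mX measurable0; rewrite big_nil in sub => /(_ sub).
  by rewrite /torus set0I (@measure0 _ _ _ [the measure _ _ of leb2]) mulr0n.
have mD : measurable (X `\` S a) by exact: measurableD.
have sD : (X `\` S a) `&` unit_square `<=` \big[setU/set0]_(i <- s) S i.
  by move=> z [[Xz nS] Qz]; have := sub z (conj Xz Qz); rewrite big_cons => -[].
have mU := measurableU _ _ (mS a) mD.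
apply: (@le_trans _ _ (torus (S a `|` (X `\` S a)))).
  apply: le_torus => // z Xz.
  by have [h|h] := pselect (S a z); [left|right].
apply: (le_trans (torusU_le (mS a) mD)).
by rewrite /= mulrS EFinD; apply: leeD => //; exact: IH.
Qed.

Lemma entropy_lower_bound (W : finType) (m : W -> R) (c : R) : 0 < c ->
  (forall w, 0 <= m w <= c) -> \sum_w m w = 1 -> - ln c <= \sum_w - (m w * ln (m w)).
Proof.
move=> c0 mc m1; rewrite -[- ln c]mul1r -m1 mulr_suml; apply: ler_sum => w _.
have /andP[m0 mlc] := mc w.
move: m0; rewrite le_eqVlt => /predU1P[<-|m0]; first by rewrite !mul0r oppr0.
by rewrite mulrN lerN2 ler_wpM2l ?(ltW m0) // ler_ln ?posrE.
Qed.

Variables (g : T -> T) (M : 'M[int]_2).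
Hypotheses (mg : measurable_fun setT g) (dM : \det M = 1)
  (hg : forall z, g (pillow z) = pillow (lin M z)).

(** Sections have coordinates of modulus at most [1/2], so the integer vector of a lifted step is
    bounded by the moduli of a row of [M] plus one for the image. Labels store the vector shifted by
    this bound, as natural numbers. *)
Definition lift_bound : nat :=
  (addn (addn (absz (M 0 0)) (absz (M 0 1))) (addn (absz (M 1 0)) (absz (M 1 1)))).+1.

Definition lift_label := (bool * 'I_(2 * lift_bound).+1 * 'I_(2 * lift_bound).+1)%type.

Definition lift_sign (a : lift_label) : R := if a.1.1 then 1 else -1.

Definition lift_vec (a : lift_label) : R * R :=
  ((a.1.2 : nat)%:R - lift_bound%:R, (a.2 : nat)%:R - lift_bound%:R).

(* Degenerate fibers have several valid lifts of the step from [x] to [g x];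
   labelling [x] by the set of all of them avoids a measurable choice. *)
Definition lift_valid (a : lift_label) (x : T) : bool :=
  fold_section (g x) == lift_sign a *: lin M (fold_section x) + lift_vec a.

Definition lift_itinerary (x : T) : 'I_#|{set lift_label}| :=
  enum_rank [set a | lift_valid a x]%SET.

Lemma measurable_lift_valid a : measurable [set x | lift_valid a x].
Proof.
have ms := @measurable_fold_section R.
have mgs : measurable_fun setT (fold_section \o g) by exact: measurableT_comp.
have ml : measurable_fun setT (fun x : T => lin M (fold_section x)).
  by apply: (measurableT_comp (@measurable_lin R M)).
have f1 (f : T -> R * R) : measurable_fun setT f -> measurable_fun setT (fun x => (f x).1).
  by move=> mf; apply: measurableT_comp mf; exact: measurable_fst.
have f2 (f : T -> R * R) : measurable_fun setT f -> measurable_fun setT (fun x => (f x).2).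
  by move=> mf; apply: measurableT_comp mf; exact: measurable_snd.
pose d1 x := (fold_section (g x)).1 - (lift_sign a * (lin M (fold_section x)).1 + (lift_vec a).1).
pose d2 x := (fold_section (g x)).2 - (lift_sign a * (lin M (fold_section x)).2 + (lift_vec a).2).
have -> : [set x | lift_valid a x] = (d1 @^-1` [set 0]) `&` (d2 @^-1` [set 0]).
  apply/seteqP; split => x.
    by move=> /eqP h; split; rewrite /preimage /mkset /d1 /d2 h; exact: subrr.
  move=> [h1 h2]; apply/eqP; rewrite [LHS]surjective_pairing.
  by rewrite (subr0_eq (h1 : d1 x = 0)) (subr0_eq (h2 : d2 x = 0)).
apply: measurableI; apply: measurable_preimage => //; apply: measurable_funB.
- exact: (f1 _ mgs).
- by apply: measurable_funD => //; apply: measurable_funM => //; exact: f1.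
- exact: (f2 _ mgs).
- by apply: measurable_funD => //; apply: measurable_funM => //; exact: f2.
Qed.

Lemma measurable_lift_itinerary : measurable_labelling lift_itinerary.
Proof.
move=> j.
have -> : lift_itinerary @^-1` [set j] =
    \bigcap_(a in [set: lift_label]) [set x | lift_valid a x = (a \in enum_val j)].
  apply/seteqP; split => x; rewrite /preimage /lift_itinerary /=.
    by move=> <- a _; rewrite /= enum_rankK inE.
  move=> h; apply: (can_inj enum_valK); rewrite enum_rankK.
  by apply/setP => a; rewrite inE; exact: (h a I).
apply: fin_bigcap_measurable => [|a _]; first exact: (@finite_finset lift_label).
have mv := measurable_lift_valid a.
case: (a \in enum_val j); first exact: mv.
rewrite (_ : [set x | _] = ~` [set x | lift_valid a x]); first exact: measurableC.
by apply/seteqP; split => x /=; [move=> ->|move/negP/negbTE].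
Qed.

Lemma sign_int (s : R) : s = 1 \/ s = -1 -> exists2 e : int, s = e%:~R & e = 1 \/ e = -1.
Proof. by case=> ->; [exists 1|exists (-1)]; rewrite ?mulrN1z; auto. Qed.

(** The sections over [z] and [M z] are [z] and [M z] up to sign and integers, so the step is [M] or
    [- M] plus an integer vector. *)
Lemma lift_valid_exists (z : R * R) : exists a, lift_valid a (pillow z).
Proof.
have [s1 [k1 [l1' [hs1 E1 b1 c1]]]] := fold_section_fiber (lin M z).
have [s2 [k2 [l2 [hs2 E2 b2 c2]]]] := fold_section_fiber z.
have [e1 s1E he1] := sign_int hs1; have [e2 s2E he2] := sign_int hs2.
pose e := e1 * e2.
have he : e = 1 \/ e = -1 by rewrite /e; case: he1 => ->; case: he2 => ->; auto.
pose K1 := k1 - e * (M 0 0 * k2 + M 0 1 * l2).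
pose K2 := l1' - e * (M 1 0 * k2 + M 1 1 * l2).
pose u := fold_section (pillow z).
have e22 : (e2%:~R : R) * e2%:~R = 1 by case: he2 => ->; rewrite ?mulrN1z ?mulrNN mulr1.
have F1 : (fold_section (g (pillow z))).1 = e%:~R * (lin M u).1 + K1%:~R.
  rewrite hg E1 /u E2 /lin /= /K1 /e s1E s2E !(intrD, intrB, intrM).
  transitivity (e1%:~R * (e2%:~R * e2%:~R) * ((M 0 0)%:~R * z.1 + (M 0 1)%:~R * z.2) + k1%:~R).
    by rewrite e22 mulr1.
  by ring.
have F2 : (fold_section (g (pillow z))).2 = e%:~R * (lin M u).2 + K2%:~R.
  rewrite hg E1 /u E2 /lin /= /K2 /e s1E s2E !(intrD, intrB, intrM).
  transitivity (e1%:~R * (e2%:~R * e2%:~R) * ((M 1 0)%:~R * z.1 + (M 1 1)%:~R * z.2) + l1'%:~R).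
    by rewrite e22 mulr1.
  by ring.
rewrite -hg in b1 c1; rewrite -/u in b2 c2.
have en : `|e%:~R| = 1 :> R by case: he => ->; rewrite ?mulrN1z ?normrN normr1.
have halfb (x : R) : - 2^-1 <= x <= 2^-1 -> `|x| <= 2^-1 by rewrite ler_norml.
have absR (k : int) : (`|k|%N)%:R = `|k%:~R| :> R by rewrite -intr_norm natr_absz.
have dot' (p q : int) (x y : R) : `|x| <= 2^-1 -> `|y| <= 2^-1 ->
    `|p%:~R * x + q%:~R * y| <= (`|p|%N)%:R + (`|q|%N)%:R.
  move=> hx hy; rewrite !absR; apply: le_trans (ler_normD _ _) _; rewrite !normrM.
  by apply: lerD; rewrite ler_piMr //; lra.
have dot p q := dot' p q _ _ (halfb _ b2) (halfb _ c2).
have Kb (x : R) (K : int) (p q : int) : `|x| <= 2^-1 ->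
    x = e%:~R * (p%:~R * u.1 + q%:~R * u.2) + K%:~R -> (`|K| <= `|p| + `|q| + 1)%N.
  move=> hx xE; rewrite -(ler_nat R) absR !natrD.
  have -> : K%:~R = x - e%:~R * (p%:~R * u.1 + q%:~R * u.2) by rewrite xE; ring.
  apply: le_trans (ler_normB _ _) _; rewrite normrM en mul1r.
  have := dot p q; lra.
have K1b := Kb _ _ _ _ (halfb _ b1) F1.
have K2b := Kb _ _ _ _ (halfb _ c1) F2.
have lb (K : int) : (`|K| <= lift_bound)%N -> exists j : 'I_(2 * lift_bound).+1,
    (j : nat)%:R - lift_bound%:R = K%:~R :> R.
  move=> hK; pose m : int := K + lift_bound%:Z.
  have m0 : 0 <= m by rewrite /m; clear - hK; lia.
  have h : (absz m < (2 * lift_bound).+1)%N by rewrite /m; clear - hK; lia.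
  exists (Ordinal h) => /=.
  have -> : (absz m)%:R = m%:~R :> R by rewrite -[in RHS](gez0_abs m0).
  by rewrite /m intrD addrK.
have [|j1 J1] := lb K1; first by rewrite /lift_bound; clear - K1b; lia.
have [|j2 J2] := lb K2; first by rewrite /lift_bound; clear - K2b; lia.
exists (e == 1, j1, j2); rewrite /lift_valid -/u.
have sg : lift_sign (e == 1, j1, j2) = e%:~R.
  by rewrite /lift_sign /=; case: he => ->.
apply/eqP; rewrite [LHS]surjective_pairing F1 F2 sg /lift_vec /= J1 J2.
by [].
Qed.

(** Equal labels provide one lift valid for both points. The integer vectors cancel in the
    difference, which therefore evolves by [M] up to sign. *)
Lemma itinerary_divergence (n : nat) (z t : R * R) :
  (forall i, (i < n)%N -> lift_itinerary (iter i g (pillow z)) =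
                          lift_itinerary (iter i g (pillow t))) ->
  exists2 s : R, s = 1 \/ s = -1 &
  fold_section (iter n g (pillow z)) - fold_section (iter n g (pillow t)) =
  s *: iter n (lin M) (fold_section (pillow z) - fold_section (pillow t)).
Proof.
elim: n => [|n IH] h; first by exists 1; [left|rewrite scale1r].
have [s hs E] := IH (fun i hi => h i (ltnW hi)).
have [a Va] := lift_valid_exists (iter n (lin M) z).
rewrite -(iter_pillow hg) in Va.
have Vb : lift_valid a (iter n g (pillow t)).
  have := h n (ltnSn n); rewrite /lift_itinerary => /enum_rank_inj/setP/(_ a).
  by rewrite !inE Va.
exists (lift_sign a * s).
  by rewrite /lift_sign; case: (a.1.1); case: hs => ->; rewrite ?mul1r ?mulN1r ?opprK; auto.
rewrite !iterS (eqP Va) (eqP Vb) opprD addrACA subrr addr0 -scalerBr -linB E -scalerA; congr (_ *: _).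
by rewrite linZ.
Qed.

Lemma small_int_index (m : int) : -2 < m -> m < 2 ->
  exists i : 'I_3, (i : nat)%:R - 1 = m%:~R :> R.
Proof.
move=> h1 h2; pose q : int := m + 1; have q0 : 0 <= q by rewrite /q; lia.
have h3 : (absz q < 3)%N by rewrite /q; lia.
exists (Ordinal h3) => /=.
have -> : (absz q)%:R = q%:~R :> R by rewrite -[in RHS](gez0_abs q0).
by rewrite /q intrD mulr1z addrK.
Qed.

(** After [n] steps the two sections differ by at most one in each coordinate, so the form differs
    by at most [B], and by at most [B / |l|^n] at the start. The [18] counts the lifts of the
    section to the unit square: two signs and integer translations in [{-1, 0, 1}] for each
    coordinate. *)
Lemma torus_cylinder_le (l : R) (eta : R * R) (n : nat)
    (w : {ffun 'I_n -> 'I_#|{set lift_label}|}) : 1 <= `|l| -> eta != 0 ->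
  (forall z, form eta (lin M z) = l * form eta z) ->
  (torus (@word R M _ lift_itinerary n @^-1` [set w]) <=
   ((2 * ((`|eta.1| + `|eta.2|) / `|l| ^+ n) / form_size eta) *+ 18)%:E)%E.
Proof.
move=> l1 eta0 he; set B := `|eta.1| + `|eta.2|; set c := 2 * _ / _.
have ln0 : 0 < `|l| ^+ n by rewrite exprn_gt0 // (lt_le_trans _ l1).
have B0 : 0 <= B by rewrite addr_ge0.
have fs0 : 0 <= form_size eta by rewrite /form_size; case: ifP.
have Bl : 0 <= B / `|l| ^+ n by rewrite divr_ge0 // ltW.
have c0 : 0 <= c by rewrite /c divr_ge0 // mulr_ge0.
have mw : measurable (@word R M _ lift_itinerary n @^-1` [set w]).
  exact: (@measurable_word _ _ _ mg hg _ _ n measurable_lift_itinerary w).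
have [[t Wt]|none] := pselect (exists t, word M lift_itinerary n t = w); last first.
  rewrite (_ : _ @^-1` _ = set0); last first.
    by apply/seteqP; split => // z Wz; apply: none; exists z.
  by rewrite /torus set0I (@measure0 _ _ _ [the measure _ _ of leb2]) lee_fin mulrn_wge0.
pose iv (j : 'I_3) : R := (j : nat)%:R - 1.
pose sg (b : bool) : R := if b then 1 else -1.
pose center (i : bool * 'I_3 * 'I_3) := sg i.1.1 * (form eta (fold_section (pillow t)) - form eta (iv i.1.2, iv i.2)).
have sz : size (enum {: bool * 'I_3 * 'I_3}) = 18%N by rewrite -cardE !card_prod card_bool !card_ord.
rewrite -sz; apply: (torus_cover (S := fun i => slab eta (center i) (B / `|l| ^+ n))) => //.
- by move=> i; exact: measurable_slab.
- by move=> i; exact: torus_slab.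
move=> z [/= Wz Qz]; rewrite -bigcup_seq.
have same i : (i < n)%N -> lift_itinerary (iter i g (pillow z)) =
                           lift_itinerary (iter i g (pillow t)).
  move=> ni; have := congr1 (fun f : {ffun _ -> _} => f (Ordinal ni)) (etrans Wz (esym Wt)).
  by rewrite !ffunE /= !(iter_pillow hg).
have [s hs E] := itinerary_divergence same.
have close : `|form eta (fold_section (pillow z)) - form eta (fold_section (pillow t))| <= B / `|l| ^+ n.
  have := congr1 (fun v => `|form eta v|) E.
  rewrite formZ (iter_form _ _ he) !formB !normrM normrX.
  have -> : `|s| = 1 by case: hs => ->; rewrite ?normrN normr1.
  rewrite mul1r ler_pdivlMr // mulrC => <-.
  rewrite !(iter_pillow hg) -formB.
  have [? [? [? [_ _ b1 b2]]]] := fold_section_fiber (iter n (lin M) z).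
  have [? [? [? [_ _ b3 b4]]]] := fold_section_fiber (iter n (lin M) t).
  move: b1 b2 b3 b4.
  move: (fold_section (pillow (iter n (lin M) z))) (fold_section (pillow (iter n (lin M) t))) => u v.
  move=> /andP[p1 p2] /andP[p3 p4] /andP[p5 p6] /andP[p7 p8].
  apply: le_trans (ler_normD _ _) _; rewrite !normrM /B.
  by apply: lerD; rewrite ler_piMr // ler_norml /=; apply/andP; split;
    clear - p1 p2 p3 p4 p5 p6 p7 p8; lra.
have [s' [k [j [hs' F b1 b2]]]] := fold_section_fiber z.
move: (Qz); rewrite /unit_square /= !in_itv /= => -[/andP[z10 z11] /andP[z20 z21]].
have s'n x : 0 <= x < 1 -> - 1 < s' * x < 1.
  move=> /andP[p1 p2]; clear - hs' p1 p2.
  by case: hs' => ->; rewrite ?mul1r ?mulN1r; apply/andP; split; lra.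
have bdk (m : int) x : 0 <= x < 1 -> - 2^-1 <= s' * x + m%:~R <= 2^-1 -> exists i : 'I_3, iv i = m%:~R.
  move=> /s'n /andP[x0 x1] /andP[m0 m1].
  have h1 : (-2)%:~R < (m%:~R : R) by rewrite mulrNz; clear - x1 m0; lra.
  have h2 : (m%:~R : R) < 2%:~R by clear - x0 m1; lra.
  rewrite !ltr_int in h1 h2.
  exact: small_int_index.
rewrite F /= in b1 b2.
have [i1 I1] := bdk _ _ (introT andP (conj z10 z11)) b1.
have [i2 I2] := bdk _ _ (introT andP (conj z20 z21)) b2.
exists (s' == 1, i1, i2); first by rewrite /= mem_enum.
rewrite /slab /= /center /= I1 I2.
have -> : sg (s' == 1) = s'.
  rewrite /sg; case: hs' => ->; first by rewrite eqxx.
  by case: eqP => // ->.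
have ss : s' * s' = 1 by case: hs' => ->; rewrite ?mulrNN mulr1.
have sn : `|s'| = 1 by case: hs' => ->; rewrite ?normrN normr1.
move: close; rewrite F; move: (form eta (fold_section (pillow t))) => f0.
have -> : form eta (s' * z.1 + k%:~R, s' * z.2 + j%:~R) - f0 =
    s' * (form eta z - s' * (f0 - form eta (k%:~R, j%:~R))).
  rewrite mulrBr mulrA ss mul1r /form /=; ring.
by rewrite normrM sn mul1r.
Qed.

End EntropyValue.

(** * The value of the entropy *)

Section KolmogorovSinai.
Context {R : realType}.
Notation T := (R * R * R)%type.
Variables (g : T -> T) (M : 'M[int]_2).
Hypotheses (mg : measurable_fun setT g) (dM : \det M = 1)
  (hg : forall z, g (pillow z) = pillow (lin M z)).
Variables (l l' : R).
Hypotheses (l1 : 1 <= `|l|) (ll : l * l' = 1) (tl : l + l' = (\tr M)%:~R).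

Lemma join_entropy_lower : exists c : R, forall n,
  n%:R * ln `|l| - c <= join_entropy (@normalized_area R) g (lift_itinerary g M) n.
Proof.
have [eta [theta [eta0 he _ _]]] := eigen_decomp dM ll tl.
have fs0 : 0 < form_size eta.
  rewrite /form_size; case: ifPn => [/eqP e1|e1]; rewrite normr_gt0 //.
  by apply: contra eta0 => /eqP e2; rewrite [eta]surjective_pairing e1 e2.
pose B := `|eta.1| + `|eta.2|.
have B0 : 0 < B.
  have : form_size eta <= B.
    by rewrite /form_size /B; case: ifP => _; rewrite ?lerDl ?lerDr.
  exact: lt_le_trans.
(* [36] is [18] slabs times the factor [2] of the slab width. *)
have [C CE] : exists C, C = 36 * B / form_size eta by eexists.
have C0 : 0 < C by rewrite CE divr_gt0 // mulr_gt0.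
exists (ln C) => n.
have mp := @measurable_lift_itinerary R g M mg.
rewrite (join_entropyE mg hg n mp).
have l0 : 0 < `|l| by exact: lt_le_trans l1.
have cn0 : 0 < C / `|l| ^+ n by rewrite divr_gt0 // exprn_gt0.
have mw := measurable_word mg hg (n := n) mp.
have -> : n%:R * ln `|l| - ln C = - ln (C / `|l| ^+ n).
  rewrite lnM ?posrE ?invr_gt0 ?exprn_gt0 // lnV ?posrE ?exprn_gt0 // lnXn //.
  by rewrite -mulr_natl; ring.
apply: entropy_lower_bound => // [w|].
  rewrite fine_ge0 ?torus_ge0 //=.
  rewrite -lee_fin fineK ?torus_fin //.
  have := torus_cylinder_le mg dM hg w l1 eta0 he.
  move/le_trans; apply.
  rewrite lee_fin CE -/B -mulr_natr le_eqVlt; apply/orP; left; apply/eqP.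
  by field; rewrite ?gt_eqF // ?exprn_gt0 //; apply/andP; split; rewrite gt_eqF ?exprn_gt0.
rewrite (sum_torus_labels predT mw) (_ : [set z | _] = setT) ?torusT //.
by apply/seteqP.
Qed.

(** The lift labelling attains the supremum: both bounds apply to it, so its entropies per step
    converge to [ln |l|]. *)
Lemma ks_entropy_eq : ks_entropy (@normalized_area R) g = (ln `|l|)%:E.
Proof.
apply/eqP; rewrite eq_le; apply/andP; split.
  apply: ge_ereal_sup => _ [k [p mp ->]]; rewrite lee_fin.
  exact: (partition_entropy_upper mg dM hg l1 ll tl).
have [c hc] := join_entropy_lower.
have mp := @measurable_lift_itinerary R g M mg.
suff -> : ln `|l| = partition_entropy (@normalized_area R) g (lift_itinerary g M).
  by apply: ereal_sup_ubound; exists _, (lift_itinerary g M).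
apply/esym/cvg_lim => //; apply/cvgrPdist_le => e e0.
have up := join_entropy_upper mg dM hg l1 ll tl mp e0.
near=> n.
have n0 : 0 < n%:R :> R by rewrite ltr0n; near: n; exact: nbhs_infty_gt.
have nD : c / e <= n%:R by near: n; exact: nbhs_infty_ger.
rewrite ler_pdivrMr // in nD.
have h1 : join_entropy (@normalized_area R) g (lift_itinerary g M) n / n%:R <= ln `|l| + e.
  by near: n; exact: up.
have h2 : ln `|l| - e <= join_entropy (@normalized_area R) g (lift_itinerary g M) n / n%:R.
  rewrite ler_pdivlMr //; apply: le_trans (hc n).
  by rewrite mulrBl [ln _ * _]mulrC; rewrite lerD2l lerN2 mulrC.
by rewrite distrC ler_norml; apply/andP; split; lra.
Unshelve. all: by end_near. Qed.

End KolmogorovSinai.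

(** * The spectral radius *)

Section SpectralRadius.
Context {R : realType}.

Lemma normc_real (x : R) : Normc.normc (x%:C)%C = `|x|.
Proof. by rewrite /Normc.normc /= expr0n addr0 sqrtr_sqr. Qed.

(** [eigenvalue] concerns row vectors, so the coefficients of the form [eta] are an eigenvector for
    [l]. Conversely, Cayley-Hamilton applied to a complex row eigenvector leaves only [l] and
    [l']. *)
Lemma spectral_radius_eq (A : 'M[int]_2) (l l' : R) : \det A = 1 -> 1 <= `|l| ->
  l * l' = 1 -> l + l' = (\tr A)%:~R -> spectral_radius R A = `|l|.
Proof.
move=> dA l1 ll tl; rewrite /spectral_radius; set E := [set r | _].
pose g : 'M[R[i]]_2 := map_mx (fun k : int => k%:~R : R[i]) A.
have l01 : lift ord0 ord0 = 1 :> 'I_2 by exact: val_inj.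
have row_mul (v : 'rV[R[i]]_2) (j : 'I_2) : (v *m g) 0 j = v 0 0 * (A 0 j)%:~R + v 0 1 * (A 1 j)%:~R.
  by rewrite mxE !big_ord_recl big_ord0 addr0 l01 !mxE.
have cint (k : int) : (k%:~R : R[i]) = ((k%:~R : R)%:C)%C by rewrite rmorph_int.
have up : ubound E `|l|.
  move=> r [z /eigenvalueP[v vg v0] ->].
  have h0 : v 0 0 * (A 0 0)%:~R + v 0 1 * (A 1 0)%:~R = z * v 0 0.
    by rewrite -row_mul vg mxE.
  have h1 : v 0 0 * (A 0 1)%:~R + v 0 1 * (A 1 1)%:~R = z * v 0 1.
    by rewrite -row_mul vg mxE.
  have D : ((A 0 0)%:~R * (A 1 1)%:~R - (A 0 1)%:~R * (A 1 0)%:~R : R[i]) = 1.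
    by rewrite -!intrM -intrB -det2 dA.
  have tC : ((A 0 0)%:~R + (A 1 1)%:~R : R[i]) = (l%:C + l'%:C)%C.
    by rewrite -intrD -tr2 cint -tl rmorphD.
  have llC : (l%:C * l'%:C)%C = 1 :> R[i] by rewrite -rmorphM /= ll.
  have key (x : R[i]) : x = v 0 0 \/ x = v 0 1 -> (z - (l%:C)%C) * (z - (l'%:C)%C) * x = 0.
    have -> : (z - (l%:C)%C) * (z - (l'%:C)%C) = z * z - z * ((A 0 0)%:~R + (A 1 1)%:~R) +
        ((A 0 0)%:~R * (A 1 1)%:~R - (A 0 1)%:~R * (A 1 0)%:~R).
      by rewrite D tC -llC; ring.
    case=> ->.
      transitivity (z * (z * v 0 0) - ((A 0 0)%:~R + (A 1 1)%:~R) * (z * v 0 0) +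
        ((A 0 0)%:~R * (A 1 1)%:~R - (A 0 1)%:~R * (A 1 0)%:~R) * v 0 0); first by ring.
      rewrite -h0 mulrDr !mulrA -h0.
      transitivity ((v 0 0 * (A 0 0)%:~R + v 0 1 * (A 1 0)%:~R) * (A 0 0)%:~R + (z * v 0 1) * (A 1 0)%:~R -
       ((A 0 0)%:~R + (A 1 1)%:~R) * (v 0 0 * (A 0 0)%:~R + v 0 1 * (A 1 0)%:~R) +
       ((A 0 0)%:~R * (A 1 1)%:~R - (A 0 1)%:~R * (A 1 0)%:~R) * v 0 0); first by ring.
      by rewrite -h1; ring.
    transitivity (z * (z * v 0 1) - ((A 0 0)%:~R + (A 1 1)%:~R) * (z * v 0 1) +
        ((A 0 0)%:~R * (A 1 1)%:~R - (A 0 1)%:~R * (A 1 0)%:~R) * v 0 1); first by ring.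
    rewrite -h1 mulrDr !mulrA.
    transitivity ((z * v 0 0) * (A 0 1)%:~R + (z * v 0 1) * (A 1 1)%:~R -
       ((A 0 0)%:~R + (A 1 1)%:~R) * (v 0 0 * (A 0 1)%:~R + v 0 1 * (A 1 1)%:~R) +
       ((A 0 0)%:~R * (A 1 1)%:~R - (A 0 1)%:~R * (A 1 0)%:~R) * v 0 1); first by ring.
    by rewrite -h0 -h1; ring.
  have zl : (z - (l%:C)%C) * (z - (l'%:C)%C) = 0.
    apply/eqP; apply: contraT => nz; move: v0; rewrite -[v == 0]negbK => /negP[].
    have vz (x : R[i]) : x = v 0 0 \/ x = v 0 1 -> x = 0.
      by move/key/eqP; rewrite mulf_eq0 (negbTE nz) => /eqP.
    rewrite negbK; apply/eqP/rowP; apply: ord2P; rewrite mxE; apply: vz; auto.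
  have l0 : 0 < `|l| by exact: lt_le_trans l1.
  have l'l : `|l'| <= `|l|.
    apply: (@le_trans _ _ 1) => //; rewrite -(ler_pM2l l0) -normrM ll normr1 mulr1 //.
  move/eqP: zl; rewrite mulf_eq0 !subr_eq0 => /orP[]/eqP ->; by rewrite normc_real.
have mem : E `|l|.
  have [eta [theta [eta0 he _ _]]] := eigen_decomp dA ll tl.
  exists (l%:C)%C; last by rewrite normc_real.
  apply/eigenvalueP.
  pose v : 'rV[R[i]]_2 := \row_j (if j == 0 then (eta.1%:C)%C else (eta.2%:C)%C).
  have v0 : v 0 0 = (eta.1%:C)%C by rewrite mxE.
  have v1 : v 0 1 = (eta.2%:C)%C by rewrite mxE.
  exists v.
    apply/rowP; apply: ord2P; rewrite row_mul [RHS]mxE v0 v1 !cint -!rmorphM -rmorphD /=; congr (_%:C)%C.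
      by have := he (1, 0); rewrite /form /lin /= !mulr1 !mulr0 !addr0.
    by have := he (0, 1); rewrite /form /lin /= !mulr1 !mulr0 !add0r.
  apply: contra eta0 => /eqP v00.
  have e1 : eta.1 = 0 by apply: complexI; rewrite -v0 v00 mxE.
  have e2 : eta.2 = 0 by apply: complexI; rewrite -v1 v00 mxE.
  by rewrite [eta]surjective_pairing e1 e2.
apply/eqP; rewrite eq_le; apply/andP; split.
  by apply: ge_sup => //; exists `|l|.
by apply: ub_le_sup => //; exists `|l|.
Qed.

End SpectralRadius.

(** * Local geometry of the surface and tangent norms *)

Section LocalGeometry.
Context {R : realType}.
Notation T := (R * R * R)%type.

(** Along each edge of the tetrahedron one coordinate equals [2] or [-2], its extreme values on the
    surface. *)
Definition off_edges (x : T) : Prop := [/\ `|x.1.1| < 2, `|x.1.2| < 2 & `|x.2| < 2].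

Definition is_sign (s : R) : Prop := s = 1 \/ s = -1.

Lemma saw_local (t : R) : `|saw t| < 2 -> exists2 s, is_sign s &
  exists2 d, 0 < d & forall h, `|h| < d -> saw (t + h) = saw t + 8 * s * h.
Proof.
have [a [s [k [/andP[a0 a1] hs ->]]]] := fold_decomp t.
have ha : 0 <= a <= 2^-1 by apply/andP.
rewrite saw_fold // ltr_norml => /andP[h1 h2].
exists (- s); first by case: hs => ->; [right|left; rewrite opprK].
exists (Num.min a (2^-1 - a)); first by rewrite lt_min; apply/andP; split; lra.
move=> h; rewrite lt_min ltr_norml ltr_norml => /andP[/andP[p1 p2] /andP[p3 p4]].
have -> : s * a + k%:~R + h = s * (a + s * h) + k%:~R by case: hs => ->; ring.
rewrite saw_fold //; first by ring.
by case: hs => ->; apply/andP; split; lra.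
Qed.

Lemma saw_extremal (t : R) : ~ `|saw t| < 2 -> exists k : int, 2 * t = k%:~R.
Proof.
have [a [s [k [/andP[a0 a1] hs ->]]]] := fold_decomp t.
have ha : 0 <= a <= 2^-1 by apply/andP.
rewrite saw_fold // ltr_norml => h.
have [e|e] : a = 0 \/ a = 2^-1.
- have [h1|h1] := leP a 0; first by left; lra.
  have [h2|h2] := leP 2^-1 a; first by right; lra.
  by case: h; apply/andP; split; lra.
- by exists (k + k); rewrite e intrD; ring.
- case: hs => ->; [exists (1 + (k + k))|exists (- 1 + (k + k))]; rewrite e !intrD ?mulrNz mulr1z; lra.
Qed.

(** The differential of [pillow] off the edges, where [saw] has slope [8] or [-8]. *)
Definition sign_lin (s : T) (h : R * R) : T :=
  (8 * s.1.1 * h.1, 8 * s.1.2 * h.2, 8 * s.2 * (h.1 + h.2)).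

Definition signs (s : T) : Prop := [/\ is_sign s.1.1, is_sign s.1.2 & is_sign s.2].

Lemma pillow_local (z : R * R) : off_edges (pillow z) -> exists2 s, signs s &
  exists2 d, 0 < d & forall h, `|h| < d -> pillow (z + h) = pillow z + sign_lin s h.
Proof.
case=> /saw_local[s1 hs1 [d1 d10 e1]] /saw_local[s2 hs2 [d2 d20 e2]] /saw_local[s3 hs3 [d3 d30 e3]].
exists (s1, s2, s3); first by [].
exists (Num.min (Num.min d1 d2) (d3 / 2)).
  by rewrite !lt_min d10 d20 divr_gt0.
move=> h; rewrite prod_normE !lt_min !gt_max.
move=> /andP[/andP[/andP[p1 p2] /andP[p3 p4]] /andP[p5 p6]].
rewrite /pillow /sign_lin /= e1 // e2 // addrACA e3 //.
apply: le_lt_trans (ler_normD _ _) _; lra.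
Qed.

Lemma sign_norm (s a : R) : is_sign s -> `|8 * s * a| = 8 * `|a|.
Proof. by case=> ->; rewrite !normrM ?normrN normr1 mulr1 ger0_norm. Qed.

(** The constants do not depend on the signs, so charts at the two ends of an orbit distort norms by
    a bounded factor only. *)
Lemma norm_sign_lin s h : signs s -> 8 * `|h| <= `|sign_lin s h| <= 16 * `|h|.
Proof.
case=> h1 h2 h3; rewrite [`|sign_lin _ _|]prod_normE [`|(sign_lin _ _).1|]prod_normE /=.
rewrite !sign_norm // [`|h|]prod_normE; have := ler_normD h.1 h.2.
have := normr_ge0 h.1; have := normr_ge0 h.2.
move: `|h.1| `|h.2| `|h.1 + h.2| => a b c b0 a0 hc.
have [ab|ab] := leP a b; last first.
  apply/andP; split; first by rewrite !le_max lexx.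
  by rewrite !ge_max; apply/andP; split; [apply/andP; split|]; lra.
apply/andP; split; first by rewrite !le_max lexx orbT.
by rewrite !ge_max; apply/andP; split; [apply/andP; split|]; lra.
Qed.

Lemma sign_linZ s (c : R) h : sign_lin s (c *: h) = c *: sign_lin s h.
Proof.
rewrite /sign_lin /= /GRing.scale /=; congr (_, _, _); rewrite /GRing.scale /=; ring.
Qed.

Lemma small_scale (h : R * R) (d : R) : 0 < d -> \forall t \near (0 : R), `|t *: h| < d.
Proof.
move=> d0; have p : 0 < `|h| + 1 by rewrite ltr_wpDl.
have q : 0 < d / (`|h| + 1) by rewrite divr_gt0.
near=> t.
rewrite norm_pairZ; have ht : `|t| < d / (`|h| + 1).
  near: t; exists (d / (`|h| + 1)); first by [].
  by move=> t /=; rewrite sub0r normrN.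
rewrite ltr_pdivlMr // in ht; apply: le_lt_trans ht.
by rewrite ler_wpM2l // lerDl.
Unshelve. all: by end_near. Qed.

Lemma pillow_near (z : R * R) : off_edges (pillow z) -> exists2 s, signs s &
  forall h, \forall t \near (0 : R), pillow (z + t *: h) = pillow z + t *: sign_lin s h.
Proof.
move=> /pillow_local[s hs [d d0 e]]; exists s => // h.
near=> t; rewrite e ?sign_linZ //; near: t; exact: small_scale.
Unshelve. all: by end_near. Qed.

End LocalGeometry.

Section TangentVectors.
Context {R : realType}.
Notation T := (R * R * R)%type.

Lemma max4_eq (a b c e m : R) : Num.max (Num.max a b) (Num.max c e) = m ->
  [/\ a <= m, b <= m, c <= m & e <= m] /\ [\/ a = m, b = m, c = m | e = m].
Proof.
move=> <-; split; first by split; rewrite !le_max lexx ?orbT.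
have mx (p q : R) : Num.max p q = p \/ Num.max p q = q by case: leP; auto.
case: (mx (Num.max a b) (Num.max c e)) => ->; [case: (mx a b)|case: (mx c e)] => ->;
  by [apply: Or41|apply: Or42|apply: Or43|apply: Or44].
Qed.

Lemma near_mulr_lt (b c : R) : 0 < c -> \forall t \near (0 : R), t * b < c.
Proof.
move=> c0; have p : 0 < `|b| + 1 by rewrite ltr_wpDl.
exists (c / (`|b| + 1)); first by rewrite /= divr_gt0.
move=> t /=; rewrite sub0r normrN ltr_pdivlMr // => h.
apply: le_lt_trans (ler_norm _) _; apply: le_lt_trans h.
by rewrite normrM ler_wpM2l // lerDl.
Qed.

Lemma near_neq0 (P : R -> Prop) : (\forall t \near (0 : R), P t) -> exists2 t, t != 0 & P t.
Proof.
move=> [e /= e0 h]; exists (e / 2); first by rewrite gt_eqF // divr_gt0.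
by apply: h; rewrite /= sub0r normrN ger0_norm; lra.
Qed.

Lemma sqr_sign (s : R) : is_sign s -> s * s = 1.
Proof. by case=> ->; ring. Qed.

(** Off the edges exactly one of the four linear forms takes the value [2]. The others stay below
    [2] nearby, so moving along a tangent vector keeps the active form constant. *)
Lemma tangent_form (x : T) : surfaceT x -> off_edges x -> exists2 f, signs f &
  forall v, tangent x v -> f.1.1 * v.1.1 + f.1.2 * v.1.2 + f.2 * v.2 = 0.
Proof.
case: x => [[u v] w]; rewrite /surfaceT /= => /max4_eq[[h1 h2 h3 h4] eq].
case=> /=; rewrite !ltr_norml => /andP[u1 u2] /andP[v1 v2] /andP[w1 w2].
have P1 : @is_sign R 1 by left.
have N1 : @is_sign R (-1) by right.
pose F i (x : T) : R := match i with 0%N => - x.1.1 - x.1.2 - x.2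
  | 1%N => - x.1.1 + x.1.2 + x.2 | 2%N => x.1.1 - x.1.2 + x.2 | _ => x.1.1 + x.1.2 - x.2 end.
have FD i x (t : R) y : F i (x + t *: y) = F i x + t * F i y.
  by case: x => [[? ?] ?]; case: y => [[? ?] ?]; case: i => [|[|[|i]]];
    rewrite /F /= /GRing.scale /=; ring.
have gen i (x := (u, v, w)) y : (i < 4)%N -> F i x = 2 ->
    (forall j, (j < 4)%N -> j != i -> F j x < 2) -> tangent x y -> F i y = 0.
  move=> i4 Fi Fj tan.
  have nr : \forall t \near (0 : R), forall j, (j < 4)%N -> j != i -> F j (x + t *: y) < 2.
    have nrj j : \forall t \near (0 : R), j != i -> (j < 4)%N -> F j (x + t *: y) < 2.
      have [jl|jl] := boolP ((j != i) && (j < 4)%N); last first.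
        by near=> t => ji j4; rewrite ji j4 in jl.
      case/andP: jl => ji j4; have c0 : 0 < 2 - F j x by have := Fj _ j4 ji; lra.
      near=> t => _ _; rewrite FD; have : t * F j y < 2 - F j x by near: t; exact: near_mulr_lt.
      lra.
    have H := (nrj 0, nrj 1, nrj 2, nrj 3)%N.
    near=> t; move=> [|[|[|[|//]]]] _; last 1 first.
    + by move=> ji; move: ji isT; near: t; exact: H.2.
    + by move=> ji; move: ji isT; near: t; exact: H.1.1.1.
    + by move=> ji; move: ji isT; near: t; exact: H.1.1.2.
    + by move=> ji; move: ji isT; near: t; exact: H.1.2.
  have [t t0 [tS ht]] := near_neq0 (filterI tan nr).
  have Ft : F i (x + t *: y) = 2.
    have some : exists2 j, (j < 4)%N & F j (x + t *: y) = 2.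
      move: tS; case: (x + t *: y) => [[a b] c]; rewrite /surfaceT /= => /max4_eq[_].
      by case=> e; [exists 0%N|exists 1%N|exists 2%N|exists 3%N].
    case: some => j j4 e; have [<- //|ji] := eqVneq j i.
    by have := ht j j4 ji; rewrite e ltxx.
  have : t * F i y = 0 by move: Ft; rewrite FD Fi; lra.
  by move/eqP; rewrite mulf_eq0 (negbTE t0) => /eqP.
have lift i f : (i < 4)%N -> signs f -> F i (u, v, w) = 2 ->
   (forall j, (j < 4)%N -> j != i -> F j (u, v, w) < 2) ->
   (forall y, F i y = f.1.1 * y.1.1 + f.1.2 * y.1.2 + f.2 * y.2) ->
   exists2 f : T, signs f & forall y, tangent (u, v, w) y ->
     f.1.1 * y.1.1 + f.1.2 * y.1.2 + f.2 * y.2 = 0.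
  by move=> i4 sf Fi Fj E; exists f => // y ty; rewrite -E; exact: gen.
case: eq => e.
- apply: (@lift 0%N (-1, -1, -1)) => //; last by move=> y; rewrite /F /=; ring.
  by move=> [|[|[|[|]]]] //= _ _; rewrite /F /=; lra.
- apply: (@lift 1%N (-1, 1, 1)) => //; last by move=> y; rewrite /F /=; ring.
  by move=> [|[|[|[|]]]] //= _ _; rewrite /F /=; lra.
- apply: (@lift 2%N (1, -1, 1)) => //; last by move=> y; rewrite /F /=; ring.
  by move=> [|[|[|[|]]]] //= _ _; rewrite /F /=; lra.
- apply: (@lift 3%N (1, 1, -1)) => //; last by move=> y; rewrite /F /=; ring.
  by move=> [|[|[|[|]]]] //= _ _; rewrite /F /=; lra.
Unshelve. all: by end_near. Qed.

(** Tangent vectors and values of [sign_lin] lie in the kernel of a common form with coefficients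
    [1] or [-1], so the first two coordinates determine the third; those two can be matched by
    choice of [h]. *)
Lemma tangent_pillow (z : R * R) (s : T) : off_edges (pillow z) -> signs s ->
  (forall h, \forall t \near (0 : R), pillow (z + t *: h) = pillow z + t *: sign_lin s h) ->
  forall v, tangent (pillow z) v <-> exists h, v = sign_lin s h.
Proof.
move=> off [s1 s2 s3] loc.
have tan h : tangent (pillow z) (sign_lin s h).
  by near=> t; rewrite -(near (loc h) t) //; exact: surface_pillow.
move=> v; split; last by case=> h ->.
have [f [f1 f2 f3] ker] := tangent_form (surface_pillow z) off.
move=> /ker kv; exists (s.1.1 * v.1.1 / 8, s.1.2 * v.1.2 / 8).
have := ker _ (tan (s.1.1 * v.1.1 / 8, s.1.2 * v.1.2 / 8)); rewrite /sign_lin /=.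
have -> : 8 * s.1.1 * (s.1.1 * v.1.1 / 8) = v.1.1.
  by transitivity ((s.1.1 * s.1.1) * v.1.1); [field|rewrite sqr_sign // mul1r].
have -> : 8 * s.1.2 * (s.1.2 * v.1.2 / 8) = v.1.2.
  by transitivity ((s.1.2 * s.1.2) * v.1.2); [field|rewrite sqr_sign // mul1r].
set c := 8 * s.2 * _ => kc.
have -> : c = v.2.
  by move: kv kc; case: f3 => -> *; lra.
by case: v {kv kc c} => [[a b] c'].
Unshelve. all: by end_near. Qed.

End TangentVectors.

Section TangentNorm.
Context {R : realType}.
Notation T := (R * R * R)%type.

Lemma derive_near_affine (f : T -> T) x v w :
  (\forall t \near (0 : R), f (x + t *: v) = f x + t *: w) ->
  derivable f x v /\ 'D_v f x = w.
Proof.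
move=> h.
have c : h^-1 *: ((f \o shift x) (h *: v) - f x) @[h --> (0 : R)^'] --> w.
  apply: cvg_near_cst; near=> t.
  have t0 : t != 0 by near: t; exact: nbhs_dnbhs_neq.
  have e : f (x + t *: v) = f x + t *: w by near: t; exact: nbhs_dnbhs h.
  rewrite (_ : (f \o shift x) (t *: v) = f (x + t *: v)); last by rewrite /= addrC.
  by rewrite e addrAC subrr add0r scalerA mulVf // scale1r.
by split; [exact: cvgP c|exact: cvg_lim c].
Unshelve. all: by end_near. Qed.

Variables (g : T -> T) (M : 'M[int]_2).
Hypothesis hg : forall z, g (pillow z) = pillow (lin M z).

(** Since [g^n] is covered by [M^n], the derivative is read off from the charts at the first and
    last point of the orbit segment. *)
Lemma iter_derivative n (z : R * R) (s : T) :
  (forall h, \forall t \near (0 : R), pillow (z + t *: h) = pillow z + t *: sign_lin s h) ->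
  off_edges (iter n g (pillow z)) -> exists2 s', signs s' & forall h,
  derivable (iter n g) (pillow z) (sign_lin s h) /\
  'D_(sign_lin s h) (iter n g) (pillow z) = sign_lin s' (iter n (lin M) h).
Proof.
move=> loc; rewrite (iter_pillow hg) => /pillow_near[s' hs' loc']; exists s' => // h.
apply: derive_near_affine; near=> t.
rewrite -(near (loc h) t) // !(iter_pillow hg) iter_linD iter_linZ.
by rewrite (near (loc' _) t).
Unshelve. all: by end_near. Qed.

Lemma form_le_norm (eta z : R * R) : `|form eta z| <= 2 * `|eta| * `|z|.
Proof.
have e1 : `|eta.1| <= `|eta| by rewrite prod_normE le_max lexx.
have e2 : `|eta.2| <= `|eta| by rewrite prod_normE le_max lexx orbT.
have z1 : `|z.1| <= `|z| by rewrite prod_normE le_max lexx.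
have z2 : `|z.2| <= `|z| by rewrite prod_normE le_max lexx orbT.
apply: le_trans (ler_normD _ _) _; rewrite !normrM.
have h1 : `|eta.1| * `|z.1| <= `|eta| * `|z| by rewrite ler_pM.
have h2 : `|eta.2| * `|z.2| <= `|eta| * `|z| by rewrite ler_pM.
rewrite -mulrA; lra.
Qed.

Variables l l' : R.
Hypothesis dM : \det M = 1.
Hypotheses (l1 : 1 <= `|l|) (ll : l * l' = 1) (tl : l + l' = (\tr M)%:~R).

(** If [theta = 0] then [M] is the scalar [l']; evaluating the eigenform on [eta] gives [l' = l],
    and [eta] itself is an eigenvector. *)
Lemma unit_eigenvector : exists2 h : R * R, `|h| = 1 & lin M h = l *: h.
Proof.
have [eta [theta [eta0 he hM ht]]] := eigen_decomp dM ll tl.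
have normalize (h : R * R) : h != 0 -> lin M h = l *: h ->
    exists2 h : R * R, `|h| = 1 & lin M h = l *: h.
  move=> h0 e; exists (`|h|^-1 *: h); last by rewrite linZ e !scalerA mulrC.
  by rewrite norm_pairZ ger0_norm ?invr_ge0 // mulVf ?normr_eq0.
have [theta0|] := eqVneq theta 0; last by move=> h; exact: normalize h ht.
apply: (normalize eta) => //.
have hM' z : lin M z = l' *: z by rewrite hM theta0 scaler0 addr0.
rewrite hM'; congr (_ *: _).
have ee : form eta eta != 0.
  apply: contra eta0; rewrite /form => /eqP e.
  have p1 := sqr_ge0 eta.1; have p2 := sqr_ge0 eta.2; rewrite !expr2 in p1 p2.
  have /eqP : eta.1 * eta.1 = 0 by lra.
  have /eqP : eta.2 * eta.2 = 0 by lra.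
  rewrite !mulf_eq0 !orbb => /eqP e2 /eqP e1.
  by rewrite [eta]surjective_pairing e1 e2.
by apply: (mulIf ee); rewrite -he hM' formZ.
Qed.

Lemma tangent_norm_bounds : exists2 C, 0 < C & forall n z, off_edges (pillow z) ->
  off_edges (iter n g (pillow z)) ->
  `|l| ^+ n / 2 <= tangent_norm (iter n g) (pillow z) <= C * n.+1%:R * `|l| ^+ n.
Proof.
have [eta [theta [_ _ hM ht]]] := eigen_decomp dM ll tl.
pose K : R := `|theta| * (2 * `|eta|).
have K0 : 0 <= K by rewrite mulr_ge0 // mulr_ge0.
exists (2 * (K + 1)); first by rewrite mulr_gt0 // ltr_wpDl.
move=> n z off offn; rewrite /tangent_norm; set E := [set r | _].
have [s hs loc] := pillow_near off.
have tanE := tangent_pillow off hs loc.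
have [s' hs' der] := iter_derivative loc offn.
have up : ubound E (2 * (K + 1) * n.+1%:R * `|l| ^+ n).
  move=> r [v [/tanE[h ->] hv] ->]; have [_ ->] := der h.
  have [/andP[p1 _] /andP[_ p2]] := (norm_sign_lin h hs, norm_sign_lin (iter n (lin M) h) hs').
  have h8 : `|h| <= 8^-1 by lra.
  apply: le_trans p2 _.
  have gr := iter_growth l1 ll hM ht n h.
  have ln1 : 1 <= `|l| ^+ n by exact: exprn_ege1.
  have fh : `|theta| * `|form eta h| <= K * `|h|.
    by rewrite /K -mulrA ler_wpM2l // form_le_norm.
  have N0 : 0 <= n%:R * `|l| ^+ n :> R by rewrite mulr_ge0.
  have g2 : n%:R * `|l| ^+ n * (`|theta| * `|form eta h|) <= n%:R * `|l| ^+ n * (K * 8^-1).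
    by rewrite ler_wpM2l //; apply: le_trans fh _; rewrite ler_wpM2l.
  have -> : 2 * (K + 1) * n.+1%:R * `|l| ^+ n =
      2 * (K + 1) * (n%:R * `|l| ^+ n) + 2 * (K + 1) * `|l| ^+ n.
    by rewrite -natr1; ring.
  move: N0 g2 gr.
  move: (`|l| ^+ n) (n%:R * _) ln1 => a b a1 b0 g2 gr.
  have KA : 0 <= K * a by rewrite mulr_ge0 //; lra.
  have KB : 0 <= K * b by rewrite mulr_ge0.
  have -> : 2 * (K + 1) * b + 2 * (K + 1) * a = 2 * (K * b) + 2 * b + 2 * (K * a) + 2 * a by ring.
  have e : b * (K / 8) = K * b / 8 by ring.
  rewrite e in g2; lra.
have mem : E (`|sign_lin s' (iter n (lin M) (0 : R * R))|).
  exists (sign_lin s 0); last by case: (der 0) => _ ->.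
  split; first by apply/tanE; exists 0.
  by have /andP[_] := norm_sign_lin 0 hs; rewrite normr0 mulr0 => h; apply: le_trans h _.
have E0 : E !=set0 by exists (`|sign_lin s' (iter n (lin M) (0 : R * R))|).
apply/andP; split; last by apply: ge_sup.
have [h h1 eh] := unit_eigenvector.
(* [sign_lin] stretches by at most [16], so [k] gives a tangent vector of norm at most one;
   stretching back by at least [8] explains the lower bound [|l|^n / 2]. *)
pose k : R * R := 16^-1 *: h.
have nk : `|k| = 16^-1 by rewrite norm_pairZ h1 mulr1 ger0_norm.
apply: le_trans (_ : `|sign_lin s' (iter n (lin M) k)| <= _).
  have /andP[p _] := norm_sign_lin (iter n (lin M) k) hs'; apply: le_trans p.
  rewrite iter_linZ (iter_lin_eigen _ eh) !norm_pairZ h1 normrX mulr1.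
  by rewrite [`|16^-1|]ger0_norm //; lra.
apply: ub_le_sup; first by exists (2 * (K + 1) * n.+1%:R * `|l| ^+ n).
exists (sign_lin s k); last by case: (der k) => _ ->.
split; first by apply/tanE; exists k.
by have /andP[_] := norm_sign_lin k hs; rewrite nk => p; apply: le_trans p _; lra.
Qed.

End TangentNorm.

(** * The Lyapunov exponent *)

Section Lyapunov.
Context {R : realType}.
Notation T := (R * R * R)%type.
Notation leb2 := (@lebesgue_measure R \x @lebesgue_measure R)%E.

(** Serves with [a = |l|] for tangent norms, and with [a = 1] for Farey paths whose trace becomes
    linear. *)
Lemma ln_growth_cvg (x : nat -> R) (a C : R) : 1 <= a -> 0 < C ->
  (forall n, a ^+ n / 2 <= x n <= C * n.+1%:R * a ^+ n) ->
  ln (x n) / n%:R @[n --> \oo] --> ln a.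
Proof.
move=> a1 C0 bx; apply/cvgrPdist_le => e e0.
have e2 : 0 < e / 2 by rewrite divr_gt0.
have a0 : 0 < a by exact: lt_le_trans a1.
have [K KE] : exists K, K = ln C + (e / 2 - 1 - ln (e / 2)) by eexists.
have up n : ln (x n) <= n%:R * ln a + n%:R * (e / 2) + K.
  have an : 0 < a ^+ n by rewrite exprn_gt0.
  have /andP[x1 x2] := bx n.
  have x0 : 0 < x n by apply: lt_le_trans x1; rewrite divr_gt0.
  have n0 : (0 : R) < n.+1%:R by [].
  have : ln (x n) <= ln (C * n.+1%:R * a ^+ n).
    by rewrite ler_ln ?posrE // !mulr_gt0.
  rewrite lnM ?posrE ?mulr_gt0 // lnM ?posrE // lnXn // -[ln a *+ n]mulr_natl.
  have n1 : n.+1%:R = n%:R + 1 :> R by rewrite natr1.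
  have := ln_tangent e2 n0; rewrite KE; move: (ln n.+1%:R) => z; rewrite n1; lra.
have lo n : n%:R * ln a - ln 2 <= ln (x n).
  have an : 0 < a ^+ n by rewrite exprn_gt0.
  have /andP[x1 x2] := bx n.
  have x0 : 0 < x n by apply: lt_le_trans x1; rewrite divr_gt0.
  have : ln (a ^+ n / 2) <= ln (x n) by rewrite ler_ln ?posrE // divr_gt0.
  by rewrite ln_div ?posrE // lnXn // -[ln a *+ n]mulr_natl.
near=> n.
have n0 : (0 : R) < n%:R by near: n; exact: nbhs_infty_gtr.
have nK : K / (e / 2) <= n%:R by near: n; exact: nbhs_infty_ger.
have n2 : ln 2 / e <= n%:R by near: n; exact: nbhs_infty_ger.
rewrite ler_pdivrMr // in nK; rewrite ler_pdivrMr // in n2.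
rewrite distrC ler_norml lerBrDr lerBlDr.
have := up n; have := lo n => h1 h2.
apply/andP; split; first by rewrite ler_pdivlMr //; lra.
by rewrite ler_pdivrMr //; lra.
Unshelve. all: by end_near. Qed.

Definition edges : set T := [set x | ~ off_edges x].

Lemma measurable_edges : measurable edges.
Proof.
have [m1 m2 m3] := @measurable_proj3 R.
rewrite (_ : edges = ~` ((fun x => x.1.1) @^-1` `]-2, 2[%classic `&`
  (fun x => x.1.2) @^-1` `]-2, 2[%classic `&` (fun x => x.2) @^-1` `]-2, 2[%classic)).
  apply: measurableC; apply: measurableI; first apply: measurableI;
    by apply: measurable_preimage => //; exact: measurable_itv.
apply/seteqP; split => x; rewrite /edges /off_edges /= !in_itv /= -!ltr_norml.
  by apply: contra_not => -[[? ?] ?].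
by apply: contra_not => -[? ? ?].
Qed.

(** [saw] is extremal only at half-integers, so over the unit square the edges pull back into
    finitely many lines on which [2 x], [2 y] or [2 (x + y)] is an integer below [4]. *)
Lemma torus_edges : torus (pillow @^-1` edges) = 0%E.
Proof.
pose L (k : nat) : set (R * R) := [set z | 2 * z.1 + 0 * z.2 = k%:R] `|`
  [set z | 0 * z.1 + 2 * z.2 = k%:R] `|` [set z | 2 * z.1 + 2 * z.2 = k%:R].
have L0 k : null_set2 (L k).
  have n2 : (2 : R) != 0 by rewrite pnatr_eq0.
  by apply: null_set2U; first apply: null_set2U; apply: null_set2_line; rewrite n2 ?orbT.
have [mU U0] : null_set2 (L 0%N `|` L 1%N `|` L 2%N `|` L 3%N).
  by do 3 (apply: null_set2U; last exact: L0); exact: L0.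
have mE := measurable_pillow_preimage measurable_edges.
apply/eqP; rewrite eq_le torus_ge0 // andbT -U0 /torus.
apply: le_leb2 => //; first by apply: measurableI => //; exact: measurable_unit_square.
move=> z [Ez]; rewrite /unit_square /= !in_itv /= => -[/andP[a0 a1] /andP[b0 b1]].
have small (t : R) : 0 <= t < 2 -> ~ `|saw t| < 2 ->
    exists2 k : nat, (k < 4)%N & 2 * t = k%:R.
  move=> /andP[t0 t1] /saw_extremal[[k|k] e].
    exists k; last exact: e.
    have : (k%:R : R) < 4%:R by have -> : (k%:R : R) = 2 * t; [rewrite e|lra].
    by rewrite ltr_nat.
  have k1 : 1 <= (k.+1%:R : R) by rewrite ler1n.
  by have : 2 * t = - (k.+1%:R : R); [rewrite e NegzE mulrNz|lra].
have mem k : (k < 4)%N -> L k z -> (L 0%N `|` L 1%N `|` L 2%N `|` L 3%N) z.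
  by case: k => [|[|[|[|]]]] // _ h; [do 3 left|do 2 left; right|left; right|right].
have [h1|h1] := pselect (`|saw z.1| < 2); last first.
  have [|k k4 e] := small _ _ h1; first by apply/andP; split; lra.
  by apply: (mem k k4); left; left; rewrite /= mul0r addr0.
have [h2|h2] := pselect (`|saw z.2| < 2); last first.
  have [|k k4 e] := small _ _ h2; first by apply/andP; split; lra.
  by apply: (mem k k4); left; right; rewrite /= mul0r add0r.
have [h3|h3] := pselect (`|saw (z.1 + z.2)| < 2); first by case: Ez.
have [|k k4 e] := small _ _ h3; first by apply/andP; split; lra.
by apply: (mem k k4); right; rewrite /= -mulrDr.
Qed.

Lemma pillow_fold_section (z : R * R) : pillow (fold_section (pillow z)) = pillow z.
Proof.
have [s [k [m [hs -> _ _]]]] := fold_section_fiber z.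
rewrite pillow_int; case: hs => ->; first by rewrite !mul1r; case: z.
by rewrite !mulN1r; exact: pillowN.
Qed.

Lemma measurable_fixed_points (f : T -> T) : measurable_fun setT f ->
  measurable [set x | f x = x].
Proof.
move=> mf; have [m1 m2 m3] := @measurable_proj3 R.
have eqm (p : T -> R) : measurable_fun setT p -> measurable [set x | p (f x) - p x = 0].
  move=> mp1; have m : measurable_fun setT (fun x => p (f x) - p x).
    by apply: measurable_funB => //; exact: (measurableT_comp mp1 mf).
  by have := measurable_preimage m (@measurable_set1 R 0).
rewrite (_ : [set x | _] = [set x | (f x).1.1 - x.1.1 = 0] `&`
  [set x | (f x).1.2 - x.1.2 = 0] `&` [set x | (f x).2 - x.2 = 0]).
  by apply: measurableI; first apply: measurableI; exact: eqm.
apply/seteqP; split => x /=; first by move=> ->; rewrite !subrr.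
case: x (f x) => [[a b] c] [[a' b'] c'] /= [[/eqP e1 /eqP e2] /eqP].
move: e1 e2; by rewrite !subr_eq0 => /eqP -> /eqP -> /eqP ->.
Qed.

(** [area] is a measure on the whole space, so lying in the image of [pillow] is itself an almost
    everywhere statement: points not fixed by [pillow] after [fold_section] form a measurable set
    with empty preimage. Orbits meeting the edges are a countable union of null sets. *)
Lemma ae_regular (g : T -> T) (M : 'M[int]_2) : measurable_fun setT g -> \det M = 1 ->
  (forall z, g (pillow z) = pillow (lin M z)) ->
  {ae @area R, forall x, exists2 z, x = pillow z & forall n, off_edges (iter n g x)}.
Proof.
move=> mg dM hg; have [mu [muE _]] := @surface_measure_exists R.
have neg : mu.-negligible ([set x | pillow (fold_section x) <> x] `|`
    \bigcup_n (iter n g @^-1` edges)).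
  apply: negligibleU; last apply: negligible_bigcup => n.
    exists (~` [set x | pillow (fold_section x) = x]); split => //.
      apply: measurableC; apply: measurable_fixed_points.
      exact: (measurableT_comp (@measurable_pillow R) (@measurable_fold_section R)).
    apply: (eq_trans (muE _)); rewrite (_ : _ @^-1` _ = set0); first by rewrite /torus set0I (@measure0 _ _ _ [the measure _ _ of leb2]).
    by apply/seteqP; split => // z /=; rewrite pillow_fold_section.
  exists (iter n g @^-1` edges); split => //.
    by apply: measurable_preimage measurable_edges; exact: measurable_iter.
  apply: (eq_trans (muE _)); rewrite -[RHS]torus_edges.
  rewrite -(torus_iter_lin n dM (measurable_pillow_preimage measurable_edges) (periodic_pillow _)).
  congr torus; apply/seteqP; split => z /=; by rewrite (iter_pillow hg).
case: neg => A [mA A0 sub]; exists A; split => //.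
  by apply: area_eq0 mA _; exact: (eq_trans (esym (muE _))).
apply: subset_trans sub => x /= nx; apply: contrapT => /not_orP[/contrapT h1 h2].
apply: nx; exists (fold_section x) => // n; apply: contrapT => h; apply: h2; by exists n.
Qed.

Lemma lyapunov_exponent_eq (g : T -> T) (M : 'M[int]_2) (l l' : R) :
  measurable_fun setT g -> \det M = 1 -> (forall z, g (pillow z) = pillow (lin M z)) ->
  1 <= `|l| -> l * l' = 1 -> l + l' = (\tr M)%:~R -> lyapunov_exponent g (ln `|l|).
Proof.
move=> mg dM hg l1 ll tl.
have [C C0 bounds] := tangent_norm_bounds hg dM l1 ll tl.
have [A [mA A0 sub]] := ae_regular mg dM hg; exists A; split => //.
apply: subset_trans sub => x /=; apply: contra_not.
move=> [z -> reg]; have off : off_edges (pillow z) := reg 0%N.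
split; last by apply: (ln_growth_cvg l1 C0) => n; exact: bounds.
move=> n v; have [s hs loc] := pillow_near off.
move=> /(tangent_pillow off hs loc)[h ->].
by have [s' _ der] := iter_derivative hg loc (reg n); case: (der h).
Qed.

End Lyapunov.

(** * Growth along Farey paths *)

Section Farey.
Context {R : realType}.

(** A trace at least [2] makes both eigenvalues positive, so the larger is at most their sum. *)
Lemma spectral_radius_bounds (A : 'M[int]_2) : \det A = 1 -> 2 <= \tr A ->
  1 <= spectral_radius R A <= (\tr A)%:~R.
Proof.
move=> dA t2; have t2' : 2 <= `|\tr A| by rewrite ger0_norm //; lia.
have [l [l' [ll tl l1 _]]] := @exists_eigenvalue R _ t2'.
rewrite (spectral_radius_eq dA l1 ll tl) l1 /= -tl.
have tR : 2 <= l + l' by rewrite tl (_ : 2 = (2 : int)%:~R) ?ler_int.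
have [l0|l0] := leP 0 l; first by rewrite ger0_norm //; nra.
have l'0 : 0 < l' by lra.
by have : l * l' < 0; [rewrite nmulr_rlt0|rewrite ll; lra].
Qed.

Definition farey_matrix (A : 'M[int]_2) : Prop :=
  [/\ 0 <= A 0 0, 0 <= A 0 1, 0 <= A 1 0, 0 <= A 1 1 & \det A = 1].

Lemma farey_matrix_gt0 A : farey_matrix A -> 0 < A 0 0 /\ 0 < A 1 1.
Proof. by rewrite /farey_matrix det2 => -[*]; split; nia. Qed.

Lemma farey_matrix_tr A : farey_matrix A -> 2 <= \tr A.
Proof. by move=> /farey_matrix_gt0[? ?]; rewrite tr2; lia. Qed.

Lemma farey_matrix_up A : farey_matrix A -> farey_matrix (step_up A).
Proof. by rewrite /farey_matrix !det2 !mx2E => -[*]; split; nia. Qed.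

Lemma farey_matrix_down A : farey_matrix A -> farey_matrix (step_down A).
Proof. by rewrite /farey_matrix !det2 !mx2E => -[*]; split; nia. Qed.

Lemma lower_end_up A : lower_end R (step_up A) = mediant R A.
Proof. by rewrite /lower_end /mediant !mx2E. Qed.

Lemma upper_end_down A : upper_end R (step_down A) = mediant R A.
Proof. by rewrite /upper_end /mediant !mx2E. Qed.

Lemma lt_lower_mediant A : farey_matrix A -> (lower_end R A < mediant R A)%E.
Proof.
move=> fA; have [p0 s0] := farey_matrix_gt0 fA; case: fA => _ q0 r0 _.
rewrite det2 /lower_end /mediant /Defs.frac => d.
have [s1 rs] : A 1 1 <> 0 /\ A 1 0 + A 1 1 <> 0 by split; lia.
case: eqP => // _; case: eqP => // _.
rewrite lte_fin ltr_pdivrMr ?ltr0z // mulrAC ltr_pdivlMr ?ltr0z //; last by lia.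
by rewrite -!intrM ltr_int; nia.
Qed.

Lemma lt_mediant_upper A : farey_matrix A -> (mediant R A < upper_end R A)%E.
Proof.
move=> fA; have [p0 s0] := farey_matrix_gt0 fA; case: fA => _ q0 r0 _.
rewrite det2 /upper_end /mediant /Defs.frac => d.
have rs : A 1 0 + A 1 1 <> 0 by lia.
case: eqP => // _; case: eqP => r1; first by rewrite ltry.
rewrite lte_fin ltr_pdivrMr ?ltr0z //; last by lia.
rewrite mulrAC ltr_pdivlMr ?ltr0z //; last by lia.
by rewrite -!intrM ltr_int; nia.
Qed.

(** Keeps only the comparison with the mediant, so that Farey paths and [std_path] are both
    instances. *)
Definition mediant_path (xi : \bar R) (A : nat -> 'M[int]_2) : Prop :=
  A 0%N = 1%:M /\ forall n,
    ((mediant R (A n) <= xi)%E /\ A n.+1 = step_up (A n)) \/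
    ((xi <= mediant R (A n))%E /\ A n.+1 = step_down (A n)).

Lemma farey_path_mediant xi A : farey_path xi A -> mediant_path xi A.
Proof.
move=> [A0 h]; split => // n; have [[/andP[h1 _] e]|[/andP[_ h1] e]] := h n; by [left|right].
Qed.

Lemma std_path_mediant xi : mediant_path xi (std_path xi).
Proof.
split => // n /=; case: ifPn => h; [by left|right]; split => //.
by rewrite leNgt; apply: contra h => /ltW.
Qed.

Lemma mediant_path_farey xi A n : mediant_path xi A -> farey_matrix (A n).
Proof.
move=> [A0 h]; elim: n => [|n IH]; first by rewrite A0 /farey_matrix det2 scalar_mx2 !mx2E.
by case: (h n) => -[_ ->]; [exact: farey_matrix_up|exact: farey_matrix_down].
Qed.

Lemma mediant_path_std xi A : mediant_path xi A ->
  (forall n, mediant R (A n) <> xi) -> A = std_path xi.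
Proof.
move=> [A0 h] ne; apply/funext; elim=> [|n IH] //=; rewrite -IH.
case: (h n) => -[le ->]; first by rewrite le.
by rewrite ifF //; apply/negP => ge; apply: (ne n); apply/eqP; rewrite eq_le ge.
Qed.

(** The mediant is strictly above the lower end, so once [xi] is the lower end every step goes down
    and adds the second column to the first. *)
Lemma mediant_path_lower_end xi A m : mediant_path xi A -> lower_end R (A m) = xi -> forall k,
  A (m + k)%N = mx2 (A m 0 0 + k%:Z * A m 0 1) (A m 0 1) (A m 1 0 + k%:Z * A m 1 1) (A m 1 1).
Proof.
move=> hp lo; have [_ h] := hp.
elim=> [|k IH]; first by rewrite addn0 !mul0r !addr0 -mx2_eta.
have lk : lower_end R (A (m + k)%N) = xi by rewrite IH /lower_end !mx2E.
have lt := lt_lower_mediant (mediant_path_farey (m + k) hp); rewrite lk in lt.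
rewrite addnS; case: (h (m + k)%N) => -[le ->]; first by rewrite leNgt lt in le.
by rewrite IH /step_down !mx2E; congr mx2; rewrite -[k.+1]addn1 PoszD; ring.
Qed.

Lemma mediant_path_upper_end xi A m : mediant_path xi A -> upper_end R (A m) = xi -> forall k,
  A (m + k)%N = mx2 (A m 0 0) (A m 0 1 + k%:Z * A m 0 0) (A m 1 0) (A m 1 1 + k%:Z * A m 1 0).
Proof.
move=> hp up; have [_ h] := hp.
elim=> [|k IH]; first by rewrite addn0 !mul0r !addr0 -mx2_eta.
have uk : upper_end R (A (m + k)%N) = xi by rewrite IH /upper_end !mx2E.
have lt := lt_mediant_upper (mediant_path_farey (m + k) hp); rewrite uk in lt.
rewrite addnS; case: (h (m + k)%N) => -[le ->]; last by rewrite leNgt lt in le.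
by rewrite IH /step_up !mx2E; congr mx2; rewrite -[k.+1]addn1 PoszD; ring.
Qed.

(* From the mediant on, [xi] is an endpoint of the interval: the path then adds
   the same column at every step. *)
Lemma mediant_path_linear_trace xi A m : mediant_path xi A -> mediant R (A m) = xi ->
  exists c e : int, forall k, \tr (A (m.+1 + k)%N) = c + k%:Z * e.
Proof.
move=> hp hit; have [_ h] := hp; case: (h m) => -[_ e].
- have lo : lower_end R (A m.+1) = xi by rewrite e lower_end_up.
  exists (\tr (A m.+1)), (A m.+1 0 1) => k.
  by rewrite (mediant_path_lower_end hp lo) !tr2 !mx2E; ring.
- have up : upper_end R (A m.+1) = xi by rewrite e upper_end_down.
  exists (\tr (A m.+1)), (A m.+1 1 0) => k.
  by rewrite (mediant_path_upper_end hp up) !tr2 !mx2E; ring.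
Qed.

Lemma mediant_path_growth0 xi A m : mediant_path xi A -> mediant R (A m) = xi ->
  ln (spectral_radius R (A n)) / n%:R @[n --> \oo] --> (0 : R).
Proof.
move=> hp hit; have [c [e tr]] := mediant_path_linear_trace hp hit.
have t2 n : 2 <= \tr (A n) := farey_matrix_tr (mediant_path_farey n hp).
have t0 n : 0 <= ((\tr (A n))%:~R : R) by rewrite ler0z; have := t2 n; lia.
(* [S] accounts for the finitely many matrices before the trace becomes linear. *)
pose S : R := \sum_(i < m.+1) (\tr (A i))%:~R.
have S0 : 0 <= S by rewrite sumr_ge0.
pose C : R := S + `|c|%:~R + `|e|%:~R + 1.
have c0 : 0 <= (`|c|%:~R : R) by rewrite ler0z.
have e0 : 0 <= (`|e|%:~R : R) by rewrite ler0z.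
rewrite -(@ln1 R); apply: (@ln_growth_cvg _ _ _ C) => //; first by rewrite /C; lra.
move=> n; rewrite !expr1n mulr1.
have fn := mediant_path_farey n hp; have dn : \det (A n) = 1 by case: fn.
have /andP[r1 r2] := spectral_radius_bounds dn (t2 n).
apply/andP; split; first by lra.
apply: le_trans r2 _; have n1 : (1 : R) <= n.+1%:R by rewrite ler1n.
have [nm|mn] := ltnP n m.+1.
  have h : (\tr (A n))%:~R <= S.
    by rewrite /S (bigD1 (Ordinal nm)) //= lerDl sumr_ge0.
  by apply: le_trans h _; rewrite /C; nra.
have [k nE] : exists k, n = (m.+1 + k)%N by exists (n - m.+1)%N; rewrite subnKC.
have kn : (k%:R : R) <= n.+1%:R by rewrite ler_nat nE; lia.
rewrite nE tr intrD intrM -nE.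
have h1 : (c%:~R : R) <= `|c|%:~R by rewrite ler_int ler_norm.
have h2 : (e%:~R : R) <= `|e|%:~R by rewrite ler_int ler_norm.
have k0 : 0 <= (k%:R : R) by [].
have h3 : (k%:R : R) * e%:~R <= n.+1%:R * `|e|%:~R.
  apply: (@le_trans _ _ (k%:R * `|e|%:~R)); first by rewrite ler_wpM2l.
  by rewrite ler_wpM2r.
have h4 : (`|c|%:~R : R) <= n.+1%:R * `|c|%:~R by rewrite ler_peMl.
have h5 : 0 <= n.+1%:R * S by rewrite mulr_ge0.
have -> : C * n.+1%:R = n.+1%:R * S + n.+1%:R * `|c|%:~R + n.+1%:R * `|e|%:~R + n.+1%:R.
  by rewrite /C; ring.
rewrite (_ : (k%:Z)%:~R = k%:R) //; lra.
Qed.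

Lemma farey_path_growth xi A : farey_path xi A ->
  limn_esup (fun n => (ln (spectral_radius R (A n)) / n%:R)%:E) = Lambda xi.
Proof.
move=> /farey_path_mediant hA; have hs := std_path_mediant xi.
have [[m hit]|nhit] := pselect (exists m, mediant R (A m) = xi); last first.
  by rewrite (mediant_path_std hA) // => n e; apply: nhit; exists n.
have [[m' hit']|nhit] := pselect (exists m, mediant R (std_path xi m) = xi).
  have lim0 B k : mediant_path xi B -> mediant R (B k) = xi ->
      limn_esup (fun n => (ln (spectral_radius R (B n)) / n%:R)%:E) = 0%E.
    move=> hB e; have cv := mediant_path_growth0 hB e.
    suff c : (ln (spectral_radius R (B n)) / n%:R)%:E @[n --> \oo] --> 0%E.
      by rewrite (cvg_limn_einf_sup c).
    by apply: cvg_EFin => //; near=> n.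
  exact: eq_trans (lim0 _ _ hA hit) (esym (lim0 _ _ hs hit')).
(* If only [A] met [xi], the two paths would still agree up to that moment, since no mediant before
   it equals [xi]; so the standard path would meet [xi] too. *)
suff AE k : (k <= m)%N -> A k = std_path xi k.
  by case: nhit; exists m; rewrite -AE.
elim: k => [|k IH km]; first by case: hA.
case: hA => _ h.
have sk := IH (ltnW km); rewrite /= -sk.
have ne : mediant R (A k) <> xi by move=> e; apply: nhit; exists k; rewrite -sk.
case: (h k) => -[le ->]; first by rewrite le.
by rewrite ifF //; apply/negP => ge; apply: ne; apply/eqP; rewrite eq_le ge.
Unshelve. all: by end_near. Qed.

End Farey.

Theorem theorem1 (R : realType) (P : 'M[int]_2) (hP : P \in unitmx)
    (act : 'M[int]_2 -> R * R * R -> R * R * R)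
    (hact : cayley_markov_action P act) :
  (forall A : 'M[int]_2, \det A = 1 -> hyperbolic A ->
     [/\ ergodic (@area R) (act A),
         lyapunov_exponent (act A) (ln (spectral_radius R A)) &
         ks_entropy (@normalized_area R) (act A)
           = (ln (spectral_radius R A))%:E])
  /\
  (forall (xi : \bar R) (A : nat -> 'M[int]_2),
     (0 <= xi)%E -> farey_path xi A ->
     (exists2 lam : nat -> R,
        forall n, lyapunov_exponent (act (A n)) (lam n) &
        limn_esup (fun n => (lam n / n%:R)%:E) = Lambda xi) /\
     limn_esup (fun n =>
       (ks_entropy (@normalized_area R) (act (A n)) * (n%:R^-1)%:E)%E)
       = Lambda xi).

Proof.
split=> [A dA hypA|xi A _ hA].
  have [M [dM tM mg hg]] := action_lift hP hact dA.
  have t2 : 2 <= `|\tr A| by exact: ltW hypA.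
  have [l [l' [ll tl l1 _]]] := @exists_eigenvalue R _ t2.
  have tlM : l + l' = (\tr M)%:~R by rewrite tM.
  rewrite (spectral_radius_eq dA l1 ll tl); split.
  - by apply: (hyperbolic_ergodic dM) => //; rewrite tM.
  - exact: lyapunov_exponent_eq mg dM hg l1 ll tlM.
  - by have := ks_entropy_eq mg dM hg l1 ll tlM; apply.
have hm := farey_path_mediant hA.
(* The trace may equal [2]: the identity at [n = 0] and parabolic matrices are covered because the
   exponent and the entropy were computed under [1 <= |l|]. *)
have exps n : lyapunov_exponent (act (A n)) (ln (spectral_radius R (A n))) /\
    ks_entropy (@normalized_area R) (act (A n)) = (ln (spectral_radius R (A n)))%:E.
  have fA := mediant_path_farey n hm; have dA : \det (A n) = 1 by case: fA.
  have [M [dM tM mg hg]] := action_lift hP hact dA.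
  have t2 : 2 <= `|\tr (A n)| by apply: le_trans (farey_matrix_tr fA) (ler_norm _).
  have [l [l' [ll tl l1 _]]] := @exists_eigenvalue R _ t2.
  have tlM : l + l' = (\tr M)%:~R by rewrite tM.
  rewrite (spectral_radius_eq dA l1 ll tl); split.
  - exact: lyapunov_exponent_eq mg dM hg l1 ll tlM.
  - by have := ks_entropy_eq mg dM hg l1 ll tlM; apply.
have growth := farey_path_growth hA; split.
  exists (fun n => ln (spectral_radius R (A n))); last exact: growth.
  by move=> n; case: (exps n).
rewrite -growth; congr limn_esup; apply/funext => n.
by have [_ ->] := exps n; rewrite -EFinM.
Qed.
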